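(* Let $\mathbb{K}$ be a field of characteristic $0$. The Hopf algebra $\mathbb{KS}$ on permutations, with the coupling product and the draw coproduct, is isomorphic as a Hopf algebra to the cocommutative Hopf algebra of Aguiar–Sottile associated with the Malvenuto–Reutenauer Hopf algebra of permutations (the graded dual of the graded Hopf algebra associated with the coradical filtration of the Malvenuto–Reutenauer Hopf algebra). It is also isomorphic as a Hopf algebra to the Grossman–Larson Hopf algebra of heap-ordered trees.
   Context: Permutations. $S_n$ is the set of permutations of $[n]=\{1,\dots,n\}$, written as words $a=a_1\cdots a_n$ with $a_i=a(i)$ ($n$ is the degree); $S_0=\{\epsilon\}$ with $\epsilon$ the empty permutation. $\mathbb{K}S_n$ is the vector space with basis $S_n$ and $\mathbb{KS}=\bigoplus_{n\ge0}\mathbb{K}S_n$. For a sequence $b$ of $\ell$ distinct positive integers, $\mathrm{st}(b)\in S_\ell$ is obtained by applying to each entry the unique order-preserving bijection from the set of entries of $b$ to $[\ell]$; $\mathrm{st}(\epsilon)=\epsilon$. For a sequence $\beta=b_1\cdots b_\ell$ of positive integers, $\beta^{\uparrow^n}=(b_1+n)\cdots(b_\ell+n)$. The Hopf algebra $\mathbb{KS}$. For a sequence $a=a_1\cdots a_n$ of distinct positive integers, a position $i$ with $1\le i\le n-1$ is an absolute ascent if $a_i<a_j$ for all $i<j\le n$. Cutting $a$ after each of its absolute ascents gives contiguous blocks $\alpha_1,\dots,\alpha_r$, called the atoms of $a$; one writes $a=\alpha_1|\cdots|\alpha_r$ (with $r=0$ for the empty sequence). For $K=\{i_1<\cdots<i_\ell\}\subseteq[r]$,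 $\alpha_K=\alpha_{i_1}|\cdots|\alpha_{i_\ell}$ (concatenation). The draw coproduct is $\bigtriangleup(a)=\sum_{K\subseteq[r]}\mathrm{st}(\alpha_K)\otimes\mathrm{st}(\alpha_{[r]\setminus K})$ for a permutation $a=\alpha_1|\cdots|\alpha_r$, with counit $\nu(\epsilon)=1$, $\nu(a)=0$ for $a\ne\epsilon$. The coupling product of permutations $a=\alpha_1|\cdots|\alpha_r$ of degree $n$ and $b=\beta_1|\cdots|\beta_s$ is $$a\ltimes b^{\uparrow^n}=\sum_{L\subseteq[r],\ f\colon L\hookrightarrow[s]}\ddot\alpha_1|\cdots|\ddot\alpha_r|\beta_{t_1}^{\uparrow^n}|\cdots|\beta_{t_z}^{\uparrow^n},$$ summed over subsets $L\subseteq[r]$ and injections $f\colon L\hookrightarrow[s]$, where $\{t_1<\cdots<t_z\}=[s]\setminus f(L)$, $\ddot\alpha_i=\beta_{f(i)}^{\uparrow^n}\alpha_i$ (concatenation) if $i\in L$ and $\ddot\alpha_i=\alpha_i$ if $i\notin L$. The unit is $\mu(1)=\epsilon$. With these operations $\mathbb{KS}$ is a graded connected Hopf algebra. Malvenuto–Reutenauer Hopf algebra. It is the graded connected Hopf algebra $H$ with the same underlying graded vector space $\bigoplus_{n\ge0}\mathbb{K}S_n$, with product of $a\in S_n$ and $b\in S_m$ equal to the sum of all shuffles of the words $a$ and $b^{\uparrow^n}$, with coproduct $a\mapsto\sum_{i=0}^n\mathrm{st}(a_1\cdots a_i)\otimes\mathrm{st}(a_{i+1}\cdots a_n)$, unit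 $\epsilon$, and counit the projection to degree $0$. Aguiar–Sottile Hopf algebra. The coradical filtration of a graded connected Hopf algebra $H$ with coproduct $\Delta$ is $C^{(0)}=\mathbb{K}\cdot 1$, $C^{(k)}=\Delta^{-1}\big(H\otimes C^{(k-1)}+C^{(0)}\otimes H\big)$ for $k\ge1$. It is compatible with the Hopf algebra operations, so $\mathrm{gr}(H)=\bigoplus_{k\ge0}C^{(k)}/C^{(k-1)}$ (with $C^{(-1)}=0$) is a Hopf algebra; it inherits from $H$ the grading by degree $n$, whose components $\bigoplus_k (C^{(k)}\cap H_n)/(C^{(k-1)}\cap H_n)$ are finite-dimensional when those of $H$ are. The Aguiar–Sottile Hopf algebra is the graded dual of $\mathrm{gr}(H)$ with respect to the grading by $n$, where $H$ is the Malvenuto–Reutenauer Hopf algebra. Grossman–Larson Hopf algebra of heap-ordered trees. A heap-ordered tree of degree $n$ is a rooted (non-planar) tree with node set $\{0,1,\dots,n\}$, with root $0$, whose labels increase along every path moving away from the root. The Hopf algebra has as basis all heap-ordered trees, graded by degree. Product: for heap-ordered trees $x$ of degree $p$ and $y$ of degree $q$, let $x_1,\dots,x_k$ be the subtrees obtained by deleting the root of $x$, with all labels increased by $q$; then $x\cdot y$ is the sum, over all functions $f$ from $\{1,\dots,k\}$ to the set of nodes of $y$, of the tree obtained from $y$ by attaching, for each $i$, the root of $x_i$ as a new child of the node $f(i)$. The unit is the one-node tree. Coproduct: if $x_1,\dots,x_k$ are the subtrees obtained by deleting the root of $x$, then $\Delta(x)=\sum_{X\subseteq\{1,\dots,k\}}x_X\otimes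 x_{X^c}$, where $x_X$ is the heap-ordered tree obtained by attaching the subtrees $x_i$, $i\in X$, to a root $0$ and relabelling the non-root nodes by $1,2,\dots$ in the order-preserving way, and $X^c=\{1,\dots,k\}\setminus X$. The counit is the projection to degree $0$. *)

(* Defs.v *)
From HB Require Import structures.
From mathcomp Require Import all_boot all_order all_algebra.
From mathcomp Require Import finmap monalg.
From mathcomp Require Import boolp functions.

Set Implicit Arguments.
Unset Strict Implicit.
Unset Printing Implicit Defensive.

Import GRing.Theory.

Local Open Scope ring_scope.
Local Open Scope quotient_scope.

Record subspace (K : fieldType) (V : lmodType K) := Subspace {
  subspace_pred :> {pred V};
  subspaceP : submod_closed subspace_pred
}.

Section Subspaces.
Variables (K : fieldType) (V : lmodType K).

HB.instance Definition _ (S : subspace V) :=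
  GRing.isSubmodClosed.Build K V (subspace_pred S) (subspaceP S).
HB.instance Definition _ (S : subspace V) :=
  GRing.isOppClosed.Build V (subspace_pred S)
    (GRing.zmod_closedN (GRing.submod_closedB (subspaceP S))).

Definition span_pred (P : V -> Prop) : {pred V} :=
  [pred x | `[< forall S : subspace V, (forall y, P y -> y \in S) -> x \in S >]].

Lemma span_closed P : submod_closed (span_pred P).
Proof.
split=> [|a u v /asboolP Pu /asboolP Pv]; apply/asboolP => S PS.
  exact: rpred0.
by rewrite rpredD ?rpredZ ?Pu ?Pv.
Qed.

Definition span P := Subspace (span_closed P).

Definition sub_mod (S : subspace V) : Type := {x : V | x \in S}.
HB.instance Definition _ S := SubChoice.on (sub_mod S).
HB.instance Definition _ S :=
  [SubChoice_isSubLmodule of sub_mod S by <:].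

Definition quot_mod (S : subspace V) : Type := Quotient.quot S.
HB.instance Definition _ S := GRing.Zmodule.on (quot_mod S).

Definition qcls (S : subspace V) (x : V) : quot_mod S := \pi_(Quotient.quot S) x.
Definition qrepr (S : subspace V) (q : quot_mod S) : V :=
  repr (q : Quotient.quot S).

Lemma qreprK (S : subspace V) q : qcls S (qrepr q) = q.
Proof. exact: reprK. Qed.

Lemma qclsP (S : subspace V) x y : reflect (qcls S x = qcls S y) (x - y \in S).
Proof. by rewrite Quotient.idealrBE; apply/eqP. Qed.

Lemma qclsD (S : subspace V) : {morph qcls S : x y / x + y}.
Proof. exact: Quotient.pi_add. Qed.

Definition qscale (S : subspace V) a (q : quot_mod S) := qcls S (a *: qrepr q).

Lemma qclsZ (S : subspace V) a x : qcls S (a *: x) = qscale a (qcls S x).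
Proof.
apply/qclsP; rewrite -scalerBr; apply: rpredZ.
by apply/qclsP; rewrite qreprK.
Qed.

Section QuotScale.
Variable S : subspace V.

Lemma qscaleA a b (q : quot_mod S) : qscale a (qscale b q) = qscale (a * b) q.
Proof. by rewrite -[q]qreprK -!qclsZ scalerA. Qed.
Lemma qscale1 : left_id 1 (@qscale S).
Proof. by move=> q; rewrite -[q]qreprK -qclsZ scale1r. Qed.
Lemma qscaleDr : right_distributive (@qscale S) +%R.
Proof.
by move=> a p q; rewrite -[p]qreprK -[q]qreprK -qclsD -!qclsZ -qclsD scalerDr.
Qed.
Lemma qscaleDl (q : quot_mod S) : {morph (@qscale S)^~ q : a b / a + b}.
Proof. by move=> a b /=; rewrite -[q]qreprK -!qclsZ -qclsD scalerDl. Qed.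

HB.instance Definition _ := GRing.Zmodule_isLmodule.Build K (quot_mod S)
  qscaleA qscale1 qscaleDr qscaleDl.

Lemma qcls_linear : linear (qcls S).
Proof. by move=> a x y; rewrite qclsD qclsZ. Qed.
HB.instance Definition _ :=
  GRing.isLinear.Build K V (quot_mod S) _ (qcls S) qcls_linear.

End QuotScale.
End Subspaces.

Section Preimage.
Variables (K : fieldType) (V W : lmodType K).

Lemma preim_closed (f : {linear V -> W}) (S : subspace W) :
  submod_closed [pred x | f x \in S].
Proof.
split=> [|a u v]; rewrite !inE ?linear0 ?rpred0 // => fu fv.
by rewrite linearP rpredD ?rpredZ.
Qed.

Definition preim_subspace f S := Subspace (preim_closed f S).

(* Definite description: every property this is applied to below singles out  *)
(* at most one linear map. The value is the zero map when there is none.      *)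
Definition the_linear (P : {linear V -> W} -> Prop) : {linear V -> W} :=
  if pselect (exists f, P f) is left e then projT1 (cid e)
  else (\0 : V -> W).

End Preimage.

Section LinearExtension.
Variables (K : fieldType) (T : choiceType) (V : lmodType K).

Definition mlin (f : T -> V) (z : {malg K[T]}) : V :=
  \sum_(t <- msupp z) z@_t *: f t.

Lemma mlin_linear f : linear (mlin f).
Proof.
have mlinw (d : {fset T}) (z : {malg K[T]}) : (msupp z `<=` d)%fset ->
    mlin f z = \sum_(t <- d) z@_t *: f t.
  move=> le_zd; apply: big_fset_incl le_zd _ => t _ /mcoeff_outdom ->.
  exact: scale0r.
move=> a x y; pose d := (msupp x `|` msupp y `|` msupp (a *: x + y))%fset.
rewrite (mlinw d) ?fsubsetUr // (mlinw d x); last first.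
  by rewrite /d -fsetUA fsubsetUl.
rewrite (mlinw d y); last by rewrite /d fsetUAC fsubsetUr.
rewrite scaler_sumr -big_split /=; apply: eq_bigr => t _.
by rewrite mcoeffD mcoeffZ scalerDl scalerA.
Qed.

HB.instance Definition _ f :=
  GRing.isLinear.Build K {malg K[T]} V _ (mlin f) (mlin_linear f).

Lemma mlinU f t : mlin f << t >> = f t.
Proof. by rewrite /mlin msuppU oner_eq0 big_seq_fset1 mcoeffUU scale1r. Qed.

End LinearExtension.

Section Tensor.
Variables (K : fieldType) (V W : lmodType K).

Variant tensor_relator : {malg K[(V * W)%type]} -> Prop :=
| TensorL a x x' y :
    tensor_relator (<< (a *: x + x', y) >> - a *: << (x, y) >> - << (x', y) >>)
| TensorR a x y y' :
    tensor_relator (<< (x, a *: y + y') >> - a *: << (x, y) >> - << (x, y') >>).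

Definition tensor : Type := quot_mod (span tensor_relator).
HB.instance Definition _ := GRing.Lmodule.on tensor.

Definition pure (x : V) (y : W) : tensor := qcls (span tensor_relator) << (x, y) >>.

End Tensor.

Notation "x ⊗ y" := (pure x y) (at level 40, left associativity) : ring_scope.

(* [tlift b t] is the sum of the [b x y] over a decomposition of [t] as a sum *)
(* of pure tensors [x ⊗ y]; it does not depend on the latter when [b] is      *)
(* bilinear.                                                                  *)
Section TensorLift.
Variables (K : fieldType) (V W X : lmodType K).

Definition tlift (b : V -> W -> X) (t : tensor V W) : X :=
  mlin (fun p => b p.1 p.2) (qrepr t).

Variable b : {bilinear V -> W -> X}.

Lemma tlift_qcls z :
  tlift b (qcls (span (@tensor_relator K V W)) z) = mlin (fun p => b p.1 p.2) z.
Proof.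
pose R := span (@tensor_relator K V W).
pose f : {linear {malg K[(V * W)%type]} -> X} := mlin (fun p => b p.1 p.2).
have kerP : submod_closed [pred x | f x == 0].
  split=> [|a u v]; rewrite !inE ?linear0 // linearP => /eqP -> /eqP ->.
  by rewrite scaler0 addr0.
have Rz : qrepr (qcls R z) - z \in R by apply/qclsP; rewrite qreprK.
have : qrepr (qcls R z) - z \in Subspace kerP.
  apply: (asboolW Rz) => _ [a x x' y|a x y y'];
    rewrite inE /= !linearB linearZ /= !mlinU /=.
    by rewrite linearPl addrAC addrK subrr.
  by rewrite linearPr addrAC addrK subrr.
by rewrite inE /= linearB subr_eq0 => /eqP.
Qed.

Lemma tlift_linear : linear (tlift b).
Proof.
move=> a s t; rewrite -[s]qreprK -[t]qreprK.
by rewrite -linearP !tlift_qcls linearP.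
Qed.
HB.instance Definition _ :=
  GRing.isLinear.Build K (tensor V W) X _ (tlift b) tlift_linear.

Lemma tlift_pure x y : tlift b (x ⊗ y) = b x y.
Proof. by rewrite tlift_qcls mlinU. Qed.

End TensorLift.

(* Operations only; the axioms are in [is_hopf_algebra].                      *)
Record hopf_data (K : fieldType) := HopfData {
  hopf_sort :> lmodType K;
  hmul : {linear tensor hopf_sort hopf_sort -> hopf_sort};
  hone : hopf_sort;
  hcomul : {linear hopf_sort -> tensor hopf_sort hopf_sort};
  hcounit : {linear hopf_sort -> K^o}
}.

Section HopfAlgebra.
Variables (K : fieldType) (H : hopf_data K).
Implicit Types x y z : H.

Local Notation "x ∙ y" := (hmul H (x ⊗ y)) (at level 40, left associativity).
Local Notation Δ := (hcomul H).
Local Notation ε := (hcounit H).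

Definition is_algebra : Prop :=
  [/\ forall x y z, x ∙ (y ∙ z) = (x ∙ y) ∙ z,
      forall x, hone H ∙ x = x
    & forall x, x ∙ hone H = x].

Definition is_coalgebra : Prop :=
  [/\ forall x, tlift (fun x1 x2 => tlift (fun y z => y ⊗ (z ⊗ x2)) (Δ x1)) (Δ x)
              = tlift (fun x1 x2 => x1 ⊗ Δ x2) (Δ x),
      forall x, tlift (fun x1 x2 => ε x1 *: x2) (Δ x) = x
    & forall x, tlift (fun x1 x2 => ε x2 *: x1) (Δ x) = x].

Definition is_bialgebra : Prop :=
  [/\ is_algebra, is_coalgebra,
      (forall x y, Δ (x ∙ y) =
         tlift (fun x1 x2 => tlift (fun y1 y2 => (x1 ∙ y1) ⊗ (x2 ∙ y2)) (Δ y)) (Δ x))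
      /\ Δ (hone H) = hone H ⊗ hone H
    & (forall x y, ε (x ∙ y) = ε x * ε y) /\ ε (hone H) = 1].

Definition is_antipode (S : {linear H -> H}) : Prop :=
  forall x, tlift (fun x1 x2 => S x1 ∙ x2) (Δ x) = ε x *: hone H
         /\ tlift (fun x1 x2 => x1 ∙ S x2) (Δ x) = ε x *: hone H.

Definition is_hopf_algebra : Prop :=
  is_bialgebra /\ exists S : {linear H -> H}, is_antipode S.

End HopfAlgebra.

Definition hopf_morphism (K : fieldType) (A B : hopf_data K)
    (f : {linear A -> B}) : Prop :=
  [/\ forall x y, f (hmul A (x ⊗ y)) = hmul B (f x ⊗ f y),
      f (hone A) = hone B,
      forall x, hcomul B (f x) = tlift (fun x1 x2 => f x1 ⊗ f x2) (hcomul A x)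
    & forall x, hcounit B (f x) = hcounit A x].

(* A linear bijection preserving the bialgebra structure preserves the        *)
(* antipode.                                                                  *)
Definition hopf_isomorphic (K : fieldType) (A B : hopf_data K) : Prop :=
  [/\ is_hopf_algebra A, is_hopf_algebra B
    & exists f : {linear A -> B}, bijective f /\ hopf_morphism f].

Section Graded.
Variables (K : fieldType) (V : lmodType K) (F : nat -> subspace V).

Lemma fam_closed : submod_closed
  [pred x : nat -> V |
    `[< (exists N, forall k, (N <= k)%N -> x k = 0) /\ forall k, x k \in F k >]].
Proof.
split=> [|a x y /asboolP[[N xN] Fx] /asboolP[[M yM] Fy]]; apply/asboolP.
  by split=> [|k]; [exists 0%N | exact: rpred0].
split=> [|k]; last by rewrite fctE /= rpredD ?rpredZ.
exists (maxn N M) => k; rewrite geq_max => /andP[Nk Mk].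
by rewrite !fctE /= xN // yM // scaler0 addr0.
Qed.

(* The direct sum of the [F k].                                               *)
Definition fam : Type := sub_mod (Subspace fam_closed).
HB.instance Definition _ := GRing.Lmodule.on fam.

Lemma fam_prev_closed : submod_closed
  [pred x : fam | (val x 0%N == 0) && `[< forall k, val x k.+1 \in F k >]].
Proof.
split=> [|a x y /andP[/eqP x0 /asboolP Fx] /andP[/eqP y0 /asboolP Fy]];
  apply/andP; split.
- exact/eqP.
- by apply/asboolP=> k; exact: rpred0.
- apply/eqP; rewrite -[LHS]/(a *: val x 0%N + val y 0%N) x0 y0.
  by rewrite scaler0 addr0.
- by apply/asboolP=> k; exact: (rpredD (rpredZ a (Fx k)) (Fy k)).
Qed.

(* The direct sum of the [F k / F (k - 1)], with [F (-1) = 0].                *)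
Definition gr_mod : Type := quot_mod (Subspace fam_prev_closed).
HB.instance Definition _ := GRing.Lmodule.on gr_mod.

(* The class of [x] in [F k / F (k - 1)]; meaningful for [x \in F k] only.    *)
Definition gr_cls (k : nat) (x : V) : gr_mod :=
  qcls (Subspace fam_prev_closed)
       (insubd (0 : fam) (fun j => if j == k then x else 0)).

End Graded.

Section CoradicalGraded.
Variables (K : fieldType) (H : hopf_data K).

(* [H ⊗ C + D ⊗ H]                                                            *)
Definition wedge (C D : subspace H) : subspace (tensor H H) :=
  span (fun t => exists x y, (y \in C \/ x \in D) /\ t = x ⊗ y).

Fixpoint corad (k : nat) : subspace H :=
  if k is j.+1
  then preim_subspace (hcomul H) (wedge (corad j) (span (eq (hone H))))
  else span (eq (hone H)).

Local Notation G := (gr_mod corad).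
Local Notation cls := (gr_cls corad).

(* The structure maps induced on the associated graded space: they exist and  *)
(* are unique when the coradical filtration is compatible with those of [H].  *)
Definition gr_mul : {linear tensor G G -> G} := the_linear (fun m =>
  forall i j x y, x \in corad i -> y \in corad j ->
    m (cls i x ⊗ cls j y) = cls (i + j) (hmul H (x ⊗ y))).

Definition gr_comul : {linear G -> tensor G G} := the_linear (fun D =>
  forall k x (s : seq (nat * nat * (H * H))), x \in corad k ->
    (forall p, p \in s -> [/\ (p.1.1 + p.1.2 = k)%N,
                              p.2.1 \in corad p.1.1 & p.2.2 \in corad p.1.2]) ->
    hcomul H x = \sum_(p <- s) p.2.1 ⊗ p.2.2 ->
    D (cls k x) = \sum_(p <- s) cls p.1.1 p.2.1 ⊗ cls p.1.2 p.2.2).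

Definition gr_counit : {linear G -> K^o} := the_linear (fun e =>
  forall k x, x \in corad k -> e (cls k x) = if k is 0 then hcounit H x else 0).

Definition gr_hopf : hopf_data K :=
  HopfData gr_mul (cls 0 (hone H)) gr_comul gr_counit.

(* Not the grading by [k], but the one inherited from a grading of [H].       *)
Definition gr_deg (deg : nat -> subspace H) (n : nat) : subspace gr_hopf :=
  span (fun g : gr_hopf => exists k x,
          [/\ x \in corad k, x \in deg n & g = cls k x]).

End CoradicalGraded.

Section GradedDual.
Variables (K : fieldType) (G : hopf_data K) (deg : nat -> subspace G).

Lemma gdual_closed : submod_closed
  [pred φ : G -> K^o |
    `[< linear φ /\
        exists N, forall n x, (N <= n)%N -> x \in deg n -> φ x = 0 >]].
Proof.
split=> [|a f g /asboolP[fl [N fN]] /asboolP[gl [M gM]]]; apply/asboolP; split.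
- by move=> b u v; rewrite -[RHS]/(b *: 0 + 0) scaler0 addr0.
- by exists 0%N.
- move=> b u v; rewrite -[LHS]/(a *: f (b *: u + v) + g (b *: u + v)).
  rewrite -[RHS]/(b *: (a *: f u + g u) + (a *: f v + g v)) fl gl !scalerDr !scalerA [a * b]mulrC.
  by rewrite addrACA.
exists (maxn N M) => n x; rewrite geq_max => /andP[Nn Mn] xn.
rewrite -[LHS]/(a *: f x + g x) (fN _ _ Nn xn) (gM _ _ Mn xn).
by rewrite scaler0 addr0.
Qed.

(* The direct sum of the dual spaces of the [deg n], when [G] is the direct   *)
(* sum of the [deg n].                                                        *)
Definition gdual : Type := sub_mod (Subspace gdual_closed).
HB.instance Definition _ := GRing.Lmodule.on gdual.

Definition gdual_fun (φ : gdual) : G -> K^o := \val (φ : sub_mod _).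
Local Coercion gdual_fun : gdual >-> Funclass.

(* Such an [m] exists when the coproduct of [G] respects the grading [deg].   *)
Definition gdual_mul : {linear tensor gdual gdual -> gdual} :=
  the_linear (fun m => forall (φ ψ : gdual) (x : G),
    gdual_fun (m (φ ⊗ ψ)) x
    = tlift (fun x1 x2 => φ x1 * ψ x2 : K^o) (hcomul G x)).

(* Such a [D] exists when moreover the [deg n] are finite-dimensional.        *)
Definition gdual_comul : {linear gdual -> tensor gdual gdual} :=
  the_linear (fun D => forall (φ : gdual) (x y : G),
    tlift (fun φ1 φ2 : gdual => φ1 x * φ2 y : K^o) (D φ)
    = φ (hmul G (x ⊗ y))).

Definition gdual_counit (φ : gdual) : K^o := φ (hone G).

Lemma gdual_counit_linear : linear gdual_counit.
Proof. by []. Qed.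
HB.instance Definition _ :=
  GRing.isLinear.Build K gdual K^o _ gdual_counit gdual_counit_linear.

(* The unit is the counit of [G], a functional that vanishes on [deg n] for   *)
(* [n > 0].                                                                   *)
Definition gdual_hopf : hopf_data K :=
  HopfData gdual_mul (insubd (0 : gdual) (hcounit G : G -> K^o))
           gdual_comul gdual_counit.

End GradedDual.

Section FreeHopf.
Variables (K : fieldType) (T : choiceType).
Local Notation M := {malg K[T]}.
Variables (prod : T -> T -> M) (one : M) (coprod : T -> tensor M M).
Variable (counit : T -> K^o).

Definition free_mul (x y : M) : M := mlin (fun a => mlin (prod a) y) x.

Lemma free_mul_bilinear : bilinear_for *:%R *:%R free_mul.
Proof.
split=> [y|x] a u v /=; first exact: linearP.
rewrite /free_mul /mlin scaler_sumr -big_split; apply: eq_bigr => t _ /=.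
rewrite -/(mlin _ _) -/(mlin _ _) -/(mlin _ _) linearP scalerDr !scalerA.
by rewrite [a * _]mulrC.
Qed.
HB.instance Definition _ :=
  bilinear_isBilinear.Build K M M M *:%R *:%R free_mul free_mul_bilinear.

Definition free_hopf : hopf_data K :=
  HopfData (tlift free_mul) one (mlin coprod) (mlin counit).

End FreeHopf.

Definition is_perm_word (w : seq nat) : bool := perm_eq w (iota 1 (size w)).
Definition perm_word : Type := {w : seq nat | is_perm_word w}.
HB.instance Definition _ := SubChoice.on perm_word.

Definition st (w : seq nat) : seq nat := [seq (count (ltn^~ x) w).+1 | x <- w].

Definition up (n : nat) (w : seq nat) : seq nat := [seq (x + n)%N | x <- w].

(* The letter [x] is in absolute ascent position when it is smaller than all  *)
(* the later letters; a cut after the last letter is harmless.                *)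
Fixpoint atoms (w : seq nat) : seq (seq nat) :=
  if w is x :: w' then
    if all (ltn x) w' then [:: x] :: atoms w'
    else if atoms w' is b :: bs then (x :: b) :: bs else [:: [:: x]]
  else [::].

Fixpoint shuffles (u : seq nat) : seq nat -> seq (seq nat) :=
  fix shuffles_u (v : seq nat) :=
    match u, v with
    | [::], _ => [:: v]
    | _, [::] => [:: u]
    | x :: u', y :: v' =>
        [seq x :: w | w <- shuffles u' v] ++ [seq y :: w | w <- shuffles_u v']
    end.

Definition select (T : Type) (s : seq (seq T)) (I : {set 'I_(size s)}) : seq T :=
  flatten [seq nth [::] s (val i) | i <- enum I].

(* An injection from a subset [L] of [[r]] to [[s]] is encoded as a map       *)
(* defined on [[r]] that is [None] outside [L].                               *)
Definition partial_inj (r s : nat) (f : {ffun 'I_r -> option 'I_s}) : bool :=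
  [forall i, forall j, (f i == f j) && (f i != None) ==> (i == j)].

Definition coupling_word (α β : seq (seq nat))
    (f : {ffun 'I_(size α) -> option 'I_(size β)}) : seq nat :=
  flatten [seq (if f i is Some j then nth [::] β j else [::]) ++ nth [::] α (val i)
          | i <- enum 'I_(size α)]
  ++ select [set j | [forall i, f i != Some j]].

Section PermutationAlgebras.
Variable K : fieldType.

(* The basis vector of a permutation; the words it is applied to below are    *)
(* all permutations.                                                          *)
Definition perm_vec (w : seq nat) : {malg K[perm_word]} :=
  oapp (fun p => << p >>) 0 (insub w).

Definition deg0 (p : perm_word) : K^o := (val p == [::])%:R.

Definition coupling (a b : perm_word) : {malg K[perm_word]} :=
  let α := atoms (val a) in
  let β := atoms (up (size (val a)) (val b)) in
  \sum_(f : {ffun 'I_(size α) -> option 'I_(size β)} | partial_inj f)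
    perm_vec (coupling_word f).

Definition draw (a : perm_word) : tensor {malg K[perm_word]} {malg K[perm_word]} :=
  let α := atoms (val a) in
  \sum_(I : {set 'I_(size α)}) perm_vec (st (select I)) ⊗ perm_vec (st (select (~: I))).

Definition KS : hopf_data K := free_hopf coupling (perm_vec [::]) draw deg0.

Definition shuffle_prod (a b : perm_word) : {malg K[perm_word]} :=
  \sum_(w <- shuffles (val a) (up (size (val a)) (val b))) perm_vec w.

Definition deconcat (a : perm_word) : tensor {malg K[perm_word]} {malg K[perm_word]} :=
  \sum_(i < (size (val a)).+1)
    perm_vec (st (take i (val a))) ⊗ perm_vec (st (drop i (val a))).

Definition malvenuto_reutenauer : hopf_data K :=
  free_hopf shuffle_prod (perm_vec [::]) deconcat deg0.

Definition mr_deg (n : nat) : subspace malvenuto_reutenauer :=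
  span (fun x : malvenuto_reutenauer =>
          exists2 p : perm_word, size (val p) = n & x = << p >>).

Definition aguiar_sottile : hopf_data K :=
  @gdual_hopf K (gr_hopf malvenuto_reutenauer) (gr_deg mr_deg).

End PermutationAlgebras.

(* A heap-ordered tree of degree [n] is encoded by the word of length [n]     *)
(* whose [i]-th letter, counting from 1, is the parent of the node [i]; the   *)
(* only condition is that it be smaller than [i].                             *)
Definition is_htree (x : seq nat) : bool :=
  all (fun i => (nth 0%N x i <= i)%N) (iota 0 (size x)).
Definition htree : Type := {x : seq nat | is_htree x}.
HB.instance Definition _ := SubChoice.on htree.

Section HeapOrderedTrees.
Variable x : seq nat.

(* The root is its own parent here.                                           *)
Definition parent (i : nat) : nat := nth 0%N (0%N :: x) i.

Definition root_children : seq nat :=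
  [seq i <- iota 1 (size x) | parent i == 0%N].

(* The child of the root whose subtree contains the node [i > 0].             *)
Definition branch (i : nat) : nat :=
  iter i (fun j => if parent j == 0%N then j else parent j) i.

Definition graft (y : seq nat)
    (f : {ffun 'I_(size root_children) -> 'I_(size y).+1}) : seq nat :=
  y ++ [seq if parent i == 0%N
            then nth 0%N [seq val (f j) | j <- enum 'I_(size root_children)]
                     (index i root_children)
            else (parent i + size y)%N | i <- iota 1 (size x)].

Definition subforest (I : {set 'I_(size root_children)}) : seq nat :=
  let nodes := [seq i <- iota 1 (size x)
                 | branch i \in [seq nth 0%N root_children (val j) | j <- enum I]] in
  [seq index (parent i) (0%N :: nodes) | i <- nodes].

End HeapOrderedTrees.

Section GrossmanLarson.
Variable K : fieldType.

(* The basis vector of a tree; the words it is applied to below all encode    *)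
(* trees.                                                                     *)
Definition htree_vec (x : seq nat) : {malg K[htree]} :=
  oapp (fun p => << p >>) 0 (insub x).

Definition gl_prod (x y : htree) : {malg K[htree]} :=
  \sum_(f : {ffun 'I_(size (root_children (val x))) -> 'I_(size (val y)).+1})
    htree_vec (graft f).

Definition gl_coprod (x : htree) : tensor {malg K[htree]} {malg K[htree]} :=
  \sum_(I : {set 'I_(size (root_children (val x)))})
    htree_vec (subforest I) ⊗ htree_vec (subforest (~: I)).

Definition grossman_larson : hopf_data K :=
  free_hopf gl_prod (htree_vec [::]) gl_coprod
    (fun x : htree => (val x == [::])%:R : K^o).

End GrossmanLarson.

(* Main.v *)
(* Every Hopf algebra of the statement is identified with the tensor Hopf     *)
(* algebra T(V) on some alphabet V: words, concatenation, unshuffling.        *)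
(*                                                                            *)
(* Permutations form a free monoid under (a, b) |-> a b^{up n}. Cutting a     *)
(* permutation repeatedly, with the draw coproduct, into irreducible left     *)
(* factors is a unitriangular map onto words, and turns the monoid algebra    *)
(* into T(V). Merging the atoms of a permutation along the blocks of a set    *)
(* partition is a unitriangular automorphism that preserves the draw          *)
(* coproduct and turns the monoid product into the coupling product. The      *)
(* Grossman-Larson algebra is treated alike: forests form a free monoid under *)
(* juxtaposition, and reattaching their trees to smaller nodes in all         *)
(* possible ways turns juxtaposition into the Grossman-Larson product.        *)
(*                                                                            *)
(* For the Malvenuto-Reutenauer algebra H the same cutting map, with          *)
(* deconcatenation in place of the draw coproduct, is a coalgebra isomorphism *)
(* from H to the words on V with deconcatenation. Hence the coradical         *)
(* filtration of H is given by the length of words, and as the coproduct is   *)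
(* multiplicative, the product of two words is their shuffle up to shorter    *)
(* words. So gr(H) is the shuffle algebra on V, whose graded dual is T(V).    *)
(*                                                                            *)
(* The irreducible permutations and the irreducible forests are both          *)
(* countably infinite sets, so that the two alphabets may be exchanged.       *)

From HB Require Import structures.
From mathcomp Require Import all_boot all_order all_algebra.
From mathcomp Require Import finmap monalg.
From mathcomp Require Import boolp classical_sets functions cardinality.
From mathcomp Require Import zify.
Require Import Defs.

Set Implicit Arguments.
Unset Strict Implicit.
Unset Printing Implicit Defensive.

Import GRing.Theory.
Local Open Scope ring_scope.

(** * Linear maps, tensors and bialgebra isomorphisms *)

(** Everything is compared with [word_hopf], the tensor Hopf algebra T(V) with concatenation and
    unshuffling, where V has as basis the irreducible elements of a free monoid. The Hopf axioms are
    verified for T(V) alone ([word_hopfP]); [is_hopf_algebra_iso] carries them, antipode included,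
    along linear bijections that respect the other operations.

    The engine is [theta]. In a graded monoid whose elements can be cut into pairs, [theta a] lists
    the words obtained by cutting off irreducible left factors until nothing is left. If cutting a
    product beyond its first factor yields only reducible left factors, then [theta] is
    multiplicative ([sum_theta_op]). It sends a product of letters to the corresponding word plus
    longer words of the same weight, so it is bijective ([theta_bijective], by
    [unitriangular_bijective]). Coassociativity makes it a coalgebra map: to unshuffling when the
    coproduct consists of the cuts and their mirror images ([sum_theta_splits]), to deconcatenation
    when it consists of the cuts and the term with trivial left factor ([sum_theta_cuts]).

    For [KS] this applies to shifted concatenation in place of coupling ([concat_iso]). A set
    partition of a disjoint union amounts to partitions of the two parts and a partial matching
    between their blocks ([sum_merges_cat]); hence merging atoms in all ways turns shifted
    concatenation into coupling ([concat_KS_iso]). Likewise, reattaching trees inside a forest and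
    then grafting them on another one is reattaching them in the juxtaposition ([sum_fills_grafts]),
    which gives [word_GL_iso].

    For the Malvenuto-Reutenauer algebra, [theta] is an isomorphism of coalgebras onto words with
    deconcatenation ([mr_words_hd]). This determines the coradical filtration ([coradP]), and
    multiplicativity of the coproduct forces the leading part of the product to be the shuffle
    ([wcoef_mul_wvec]). In the graded dual, deconcatenation becomes concatenation and shuffling
    becomes unshuffling, so T(V) reappears ([cofree_gdual_iso]). Here the letters are the same
    irreducible permutations as for [KS]; for trees, [letters_bij] exchanges the two countably
    infinite alphabets. *)

Definition linear_of (K : fieldType) (V W : lmodType K) (f : V -> W) (fP : linear f) :
    {linear V -> W} := HB.pack f (GRing.isLinear.Build K V W *:%R f fP).

Lemma linear_0 (K : fieldType) (V W : lmodType K) (f : V -> W) : linear f -> f 0 = 0.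
Proof. by move=> fL; exact: (linear0 (linear_of fL)). Qed.

Lemma linear_D (K : fieldType) (V W : lmodType K) (f : V -> W) :
  linear f -> {morph f : x y / x + y}.
Proof. by move=> fL; exact: (linearD (linear_of fL)). Qed.

Lemma linear_Z (K : fieldType) (V W : lmodType K) (f : V -> W) :
  linear f -> forall a x, f (a *: x) = a *: f x.
Proof. by move=> fL a x; rewrite -[a *: x]addr0 fL (linear_0 fL) addr0. Qed.

Lemma linear_sums (K : fieldType) (V W : lmodType K) (f : V -> W) (fL : linear f)
    (I : Type) (r : seq I) (P : pred I) F :
  f (\sum_(i <- r | P i) F i) = \sum_(i <- r | P i) f (F i).
Proof. exact: (linear_sum (linear_of fL)). Qed.

Section MalgLinear.
Variables (K : fieldType) (T : choiceType) (V : lmodType K).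

Lemma malg_sumU (z : {malg K[T]}) : z = \sum_(t <- msupp z) z@_t *: << t >>.
Proof.
rewrite [LHS]monalgE; apply: eq_bigr => t _; apply/malgP => u.
by rewrite mcoeffZ !mcoeffU; case: eqP => _; rewrite ?mulr1 // mulr0.
Qed.

Lemma linear_malgE (f : {linear {malg K[T]} -> V}) z :
  f z = \sum_(t <- msupp z) z@_t *: f << t >>.
Proof.
rewrite [in LHS](malg_sumU z) linear_sum; apply: eq_bigr => t _.
by rewrite linearZ.
Qed.

Lemma malg_linear_ext (f g : {linear {malg K[T]} -> V}) :
  (forall t, f << t >> = g << t >>) -> f =1 g.
Proof. by move=> fg z; rewrite !linear_malgE; apply: eq_bigr => t _; rewrite fg. Qed.

Lemma malg_ext (f g : {malg K[T]} -> V) : linear f -> linear g ->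
  (forall t, f << t >> = g << t >>) -> forall z, f z = g z.
Proof.
by move=> fL gL; exact: (@malg_linear_ext (linear_of fL) (linear_of gL)).
Qed.

Lemma malg_ind (P : {malg K[T]} -> Prop) :
  P 0 -> (forall a t z, P z -> P (a *: << t >> + z)) -> forall z, P z.
Proof.
move=> P0 PS z; rewrite [z]malg_sumU.
elim: (msupp z : seq T) => [|t s IH]; first by rewrite big_nil.
by rewrite big_cons; apply: PS.
Qed.

End MalgLinear.

(* Sealed copies: unification would otherwise unfold these operations down to *)
(* representatives of quotient classes.                                       *)
HB.lock Definition tpure := @pure.
HB.lock Definition tlft := @tlift.
Arguments tpure {K V W} x y.
Arguments tlft {K V W X} b t.
Local Notation "x ⊗ y" := (tpure x y) : ring_scope.

Lemma pureE : @pure = @tpure. Proof. by rewrite tpure.unlock. Qed.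
Lemma tliftE0 : @tlift = @tlft. Proof. by rewrite tlft.unlock. Qed.

Section TensorTools.
Variables (K : fieldType) (V W X : lmodType K).

Lemma relator0 (z : {malg K[(V * W)%type]}) : tensor_relator z -> qcls (span (@tensor_relator K V W)) z = 0.
Proof.
move=> Rz; rewrite -(linear0 (qcls _)); apply/qclsP; rewrite subr0.
by apply/asboolP => S; exact.
Qed.

Lemma pure_linearl (y : W) : linear (fun x : V => x ⊗ y).
Proof.
move=> a x x'; apply/eqP; rewrite -subr_eq0 opprD addrA tpure.unlock /pure -linearZ -!linearB.
by apply/eqP/relator0; exact: TensorL.
Qed.

Lemma pure_linearr (x : V) : linear (fun y : W => x ⊗ y).
Proof.
move=> a y y'; apply/eqP; rewrite -subr_eq0 opprD addrA tpure.unlock /pure -linearZ -!linearB.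
by apply/eqP/relator0; exact: TensorR.
Qed.

Lemma tensor_ind (P : tensor V W -> Prop) :
  (forall x y, P (x ⊗ y)) -> (forall s t, P s -> P t -> P (s + t)) ->
  forall t, P t.
Proof.
move=> Pp PD t; rewrite -[t]qreprK; elim/malg_ind: (qrepr t) => [|a p z Pz].
  by rewrite linear0 -(linear_0 (pure_linearl 0)).
rewrite linearD; apply: PD => //; rewrite linearZ /=.
have := Pp (a *: p.1) p.2; rewrite (linear_Z (pure_linearl p.2)) tpure.unlock.
by case: p.
Qed.

Lemma tensor_ext (f g : tensor V W -> X) : linear f -> linear g ->
  (forall x y, f (x ⊗ y) = g (x ⊗ y)) -> forall t, f t = g t.
Proof.
move=> fL gL fg; elim/tensor_ind => // s t IHs IHt.
by rewrite (linear_D fL) (linear_D gL); congr (_ + _).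
Qed.

End TensorTools.

Section Bilinear.
Variables (K : fieldType) (V W X : lmodType K).
Implicit Types b : V -> W -> X.

Definition is_bilinear b :=
  (forall y, linear (b^~ y)) /\ (forall x, linear (b x)).

Definition bilin b (bP : is_bilinear b) : {bilinear V -> W -> X} :=
  HB.pack b (bilinear_isBilinear.Build K V W X *:%R *:%R b (bP.1, bP.2)).

Lemma tliftE b (bP : is_bilinear b) x y : tlft b (x ⊗ y) = b x y.
Proof. by rewrite -pureE -tliftE0; exact: (tlift_pure (bilin bP)). Qed.

Lemma tliftP b (bP : is_bilinear b) : linear (tlft b).
Proof. by rewrite -tliftE0; exact: (tlift_linear (bilin bP)). Qed.

(** All three lifts are evaluated on the same chosen representative of [t], so the identity holds
    term by term. *)
Lemma tlift_linb b b' a t :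
  tlft (fun x y => a *: b x y + b' x y) t = a *: tlft b t + tlft b' t.
Proof.
rewrite -tliftE0 /tlift /mlin scaler_sumr -big_split; apply: eq_bigr => p _ /=.
by rewrite scalerDr !scalerA mulrC.
Qed.

Lemma eq_tlift b b' t : (forall x y, b x y = b' x y) -> tlft b t = tlft b' t.
Proof.
by move=> bb'; rewrite -tliftE0 /tlift /mlin; apply: eq_bigr => p _; rewrite bb'.
Qed.

End Bilinear.

Lemma linear_tlift (K : fieldType) (V W X Y : lmodType K) (h : X -> Y) (b : V -> W -> X) t :
  linear h -> h (tlft b t) = tlft (fun x y => h (b x y)) t.
Proof.
move=> hL; rewrite -tliftE0 /tlift /mlin (linear_sums hL).
by apply: eq_bigr => p _; rewrite (linear_Z hL).
Qed.

Lemma is_bilinear_pure (K : fieldType) (V W : lmodType K) : is_bilinear (@tpure K V W).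
Proof. by split=> x; [exact: pure_linearl | exact: pure_linearr]. Qed.

Section TensorMap.
Variables (K : fieldType).

Lemma tmap_bilinear (V W V' W' : lmodType K) (f : V -> V') (g : W -> W') :
  linear f -> linear g -> is_bilinear (fun x y => f x ⊗ g y).
Proof.
by move=> fL gL; split=> z a u v; rewrite ?fL ?gL ?pure_linearl ?pure_linearr.
Qed.

Definition tmap (V W V' W' : lmodType K) (f : V -> V') (g : W -> W') :
  tensor V W -> tensor V' W' := tlft (fun x y => f x ⊗ g y).

Section TensorMapLinear.
Variables (V W V' W' X : lmodType K) (f : V -> V') (g : W -> W').
Hypotheses (fL : linear f) (gL : linear g).

Lemma tmapP : linear (tmap f g). Proof. exact: tliftP (tmap_bilinear fL gL). Qed.

Lemma tmap_pure x y : tmap f g (x ⊗ y) = f x ⊗ g y.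
Proof. exact: (tliftE (tmap_bilinear fL gL)). Qed.

Lemma tlift_tmap (b : V' -> W' -> X) : is_bilinear b ->
  forall t, tlft b (tmap f g t) = tlft (fun x y => b (f x) (g y)) t.
Proof.
move=> bP; have bP' : is_bilinear (fun x y => b (f x) (g y)).
  by split=> z a u v; rewrite ?fL ?gL ?bP.1 ?bP.2.
apply: tensor_ext => [a u v||x y]; first by rewrite tmapP (tliftP bP).
  exact: tliftP.
by rewrite tmap_pure (tliftE bP) (tliftE bP').
Qed.

End TensorMapLinear.
End TensorMap.

Lemma tmapK (K : fieldType) (V W V' W' : lmodType K) (f : V -> V') (f' : V' -> V)
    (g : W -> W') (g' : W' -> W) : linear f -> linear f' -> linear g -> linear g' ->
  cancel f f' -> cancel g g' -> cancel (tmap f g) (tmap f' g').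
Proof.
move=> fL f'L gL g'L fK gK; apply: tensor_ext => [||x y].
- by move=> a s t; rewrite !tmapP.
- by move=> a s t.
by rewrite !tmap_pure // fK gK.
Qed.

Section LinearInverse.
Variables (K : fieldType) (V W : lmodType K) (f : {linear V -> W}) (g : W -> V).
Hypotheses (fK : cancel f g) (gK : cancel g f).

Lemma can_linear : linear g.
Proof. by move=> a u v; apply: (can_inj fK); rewrite linearP !gK. Qed.

End LinearInverse.

Lemma bijective_linear_inv (K : fieldType) (V W : lmodType K) (f : {linear V -> W}) :
  bijective f -> exists g : {linear W -> V}, cancel f g /\ cancel g f.
Proof.
by case=> g fK gK; exists (linear_of (can_linear fK gK)).
Qed.

Section NestedLifts.
Variables (K : fieldType) (V W X Y Z : lmodType K).

Lemma linear_comp (f : V -> W) (g : W -> X) : linear f -> linear g -> linear (g \o f).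
Proof. by move=> fL gL a u v; rewrite /= fL gL. Qed.

Lemma is_bilinear_comp (b : V -> W -> X) (f : Y -> V) (g : Z -> W) :
  is_bilinear b -> linear f -> linear g -> is_bilinear (fun y z => b (f y) (g z)).
Proof. by move=> bP fL gL; split=> z a u v; rewrite ?fL ?gL ?bP.1 ?bP.2. Qed.

Lemma is_bilinear_post (b : V -> W -> X) (f : X -> Y) :
  is_bilinear b -> linear f -> is_bilinear (fun y z => f (b y z)).
Proof. by move=> bP fL; split=> z a u v; rewrite ?bP.1 ?bP.2 fL. Qed.

Lemma is_bilinear_tliftl (c : V -> W -> X -> Y) (h : Z -> tensor V W) :
  (forall x, is_bilinear (fun y z => c y z x)) -> (forall y z, linear (c y z)) ->
  linear h -> is_bilinear (fun z x => tlft (fun v w => c v w x) (h z)).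
Proof.
move=> cP cL hL; split=> [x|z] a u v; first by rewrite hL (tliftP (cP x)).
by rewrite -tlift_linb; apply: eq_tlift => y y'; rewrite cL.
Qed.

Lemma is_bilinear_tlift (c : X -> Y -> V -> W -> Z) t :
  (forall y z, is_bilinear (fun x1 x2 => c x1 x2 y z)) ->
  is_bilinear (fun x1 x2 => tlft (c x1 x2) t).
Proof.
move=> cP; split=> x a u v; rewrite -tlift_linb; apply: eq_tlift => y z.
  by rewrite (cP y z).1.
by rewrite (cP y z).2.
Qed.

Lemma is_bilinear_scale (f : V -> K^o) (g : W -> X) :
  linear f -> linear g -> is_bilinear (fun x y => f x *: g y).
Proof.
move=> fL gL; split=> x a u v; rewrite ?fL ?gL.
  by rewrite scalerDl scalerA.
by rewrite scalerDr !scalerA mulrC.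
Qed.

Lemma is_bilinearC (b : V -> W -> X) : is_bilinear b -> is_bilinear (fun y x => b x y).
Proof. by case. Qed.

Lemma linear_id : linear (@id V). Proof. by []. Qed.

End NestedLifts.

Section NestedPure.
Variables (K : fieldType) (V W X Y : lmodType K).

Lemma is_bilinear_assoc (h : V -> tensor X Y) : linear h ->
  is_bilinear (fun (x1 : V) (x2 : W) => tlft (fun y z => y ⊗ (z ⊗ x2)) (h x1)).
Proof.
move=> hL; apply: (@is_bilinear_tliftl _ _ _ _ _ _ (fun y z x2 => y ⊗ (z ⊗ x2))) => //; last first.
  by move=> y z a u v /=; rewrite !pure_linearr.
by move=> x; split=> z a u v /=; rewrite ?pure_linearl ?pure_linearr.
Qed.

Lemma is_bilinear_purer (h : W -> X) : linear h ->
  is_bilinear (fun (x1 : V) (x2 : W) => x1 ⊗ h x2).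
Proof. by move=> hL; apply: (is_bilinear_comp (@is_bilinear_pure _ _ _) (@linear_id _ _) hL). Qed.

End NestedPure.

(** Sealed like [tpure]; [is_hopf_algebraP] restates the axioms in terms of these operations. *)
HB.lock Definition hm (K : fieldType) (H : hopf_data K) (x y : H) : H := hmul H (x ⊗ y).
HB.lock Definition hd (K : fieldType) (H : hopf_data K) (x : H) : tensor H H := hcomul H x.
HB.lock Definition he (K : fieldType) (H : hopf_data K) (x : H) : K^o := hcounit H x.
HB.lock Definition h1 (K : fieldType) (H : hopf_data K) : H := hone H.
Arguments h1 {K H}.
Local Notation "x ∙ y" := (hm x y) (at level 40, left associativity) : ring_scope.

Section HopfOps.
Variables (K : fieldType) (H : hopf_data K).

Lemma hmE (x y : H) : hmul H (x ⊗ y) = x ∙ y. Proof. by rewrite hm.unlock. Qed.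
Lemma hdE (x : H) : hcomul H x = hd x. Proof. by rewrite hd.unlock. Qed.
Lemma heE (x : H) : hcounit H x = he x. Proof. by rewrite he.unlock. Qed.
Lemma h1E : hone H = h1. Proof. by rewrite h1.unlock. Qed.

Lemma hm_bilinear : is_bilinear (@hm K H).
Proof. by split=> z a u v; rewrite -!hmE ?pure_linearl ?pure_linearr linearP. Qed.
Lemma hd_linear : linear (@hd K H). Proof. by move=> a u v; rewrite -!hdE linearP. Qed.
Lemma he_linear : linear (@he K H). Proof. by move=> a u v; rewrite -!heE linearP. Qed.

Lemma comulM_bilinear t :
  is_bilinear (fun x1 x2 : H => tlft (fun y1 y2 => (x1 ∙ y1) ⊗ (x2 ∙ y2)) t).
Proof.
apply: is_bilinear_tlift => y z.
by split=> x a u v; rewrite hm_bilinear.1 ?pure_linearl ?pure_linearr.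
Qed.

Lemma comulM_bilinearr (x1 x2 : H) :
  is_bilinear (fun y1 y2 => (x1 ∙ y1) ⊗ (x2 ∙ y2)).
Proof. by split=> x a u v; rewrite hm_bilinear.2 ?pure_linearl ?pure_linearr. Qed.

Lemma coassocl_bilinear :
  is_bilinear (fun x1 x2 : H => tlft (fun y z => y ⊗ (z ⊗ x2)) (hd x1)).
Proof. exact: is_bilinear_assoc hd_linear. Qed.

Lemma coassocr_bilinear : is_bilinear (fun x1 x2 : H => x1 ⊗ hd x2).
Proof. exact: is_bilinear_purer hd_linear. Qed.

Lemma counitl_bilinear : is_bilinear (fun x1 x2 : H => he x1 *: x2).
Proof. by apply: is_bilinear_scale; [exact: he_linear | exact: linear_id]. Qed.

Lemma counitr_bilinear : is_bilinear (fun x1 x2 : H => he x2 *: x1).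
Proof. exact: is_bilinearC counitl_bilinear. Qed.

Lemma antipodel_bilinear (S : H -> H) : linear S -> is_bilinear (fun x1 x2 : H => S x1 ∙ x2).
Proof. by move=> SL; apply: (is_bilinear_comp hm_bilinear SL); exact: linear_id. Qed.

Lemma antipoder_bilinear (S : H -> H) : linear S -> is_bilinear (fun x1 x2 : H => x1 ∙ S x2).
Proof. by move=> SL; apply: (is_bilinear_comp hm_bilinear _ SL); exact: linear_id. Qed.

Lemma is_hopf_algebraP : is_hopf_algebra H <->
  [/\ [/\ forall x y z : H, x ∙ (y ∙ z) = (x ∙ y) ∙ z, forall x : H, h1 ∙ x = x
        & forall x : H, x ∙ h1 = x],
      [/\ forall x : H, tlft (fun x1 x2 : H => tlft (fun y z => y ⊗ (z ⊗ x2)) (hd x1)) (hd x)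
                        = tlft (fun x1 x2 : H => x1 ⊗ hd x2) (hd x),
          forall x : H, tlft (fun x1 x2 : H => he x1 *: x2) (hd x) = x
        & forall x : H, tlft (fun x1 x2 : H => he x2 *: x1) (hd x) = x],
      (forall x y : H, hd (x ∙ y) =
         tlft (fun x1 x2 : H => tlft (fun y1 y2 => (x1 ∙ y1) ⊗ (x2 ∙ y2)) (hd y)) (hd x))
      /\ hd (h1 : H) = h1 ⊗ h1,
      (forall x y : H, he (x ∙ y) = he x * he y) /\ he (h1 : H) = 1
    & exists2 S : H -> H, linear S & forall x,
        tlft (fun x1 x2 : H => S x1 ∙ x2) (hd x) = he x *: (h1 : H)
        /\ tlft (fun x1 x2 : H => x1 ∙ S x2) (hd x) = he x *: (h1 : H)].
Proof.
rewrite hm.unlock hd.unlock he.unlock h1.unlock -pureE -tliftE0.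
split=> [[[HA HC HD HE] [S SP]]|[HA HC HD HE [S SL SP]]]; split => //.
  by exists S => //; exact: linearP.
by exists (linear_of SL).
Qed.

End HopfOps.

(** * Transport of the Hopf structure along isomorphisms *)

Section HopfIso.
Variable K : fieldType.
Implicit Types A B C : hopf_data K.

Definition bialg_morphism A B (f : A -> B) :=
  [/\ linear f, forall x y, f (x ∙ y) = f x ∙ f y, f h1 = h1,
      forall x, hd (f x) = tmap f f (hd x) & forall x, he (f x) = he x].

Definition bialg_iso A B := exists2 f : A -> B, bijective f & bialg_morphism f.

Lemma bialg_iso_sym A B : bialg_iso A B -> bialg_iso B A.
Proof.
case=> f [g fK gK] [fL fM f1 fD fe].
have gL : linear g by exact: (@can_linear _ _ _ (linear_of fL)).
exists g; first by exists f.
split=> // [x y||x|x].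
- by apply: (can_inj fK); rewrite fM !gK.
- by rewrite -f1 fK.
- by rewrite -[x in RHS]gK fD tmapK.
- by rewrite -fe gK.
Qed.

Lemma bialg_iso_trans A B C : bialg_iso A B -> bialg_iso B C -> bialg_iso A C.
Proof.
case=> f fbij [fL fM f1 fD fe] [g gbij [gL gM g1 gD ge]].
exists (g \o f); first exact: bij_comp.
split=> [|x y||x|x] /=; rewrite ?fM ?f1 ?gD ?fD ?ge //; first exact: linear_comp.
by rewrite [LHS](tlift_tmap fL fL) //; exact: tmap_bilinear.
Qed.

(** Each axiom in [B] is the image under [f] of the same axiom in [A]. The antipode of [B] is
    [f \o S \o g], where [g] is the inverse of [f]. *)
Lemma is_hopf_algebra_iso A B : bialg_iso A B -> is_hopf_algebra A -> is_hopf_algebra B.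
Proof.
case=> f fbij [fL fM f1 fD fe] /is_hopf_algebraP.
case=> [[mA m1l m1r] [cA c1l c1r] [DM D1] [eM e1] [S SL SP]].
case: fbij => g fK gK.
have gL : linear g by exact: (@can_linear _ _ _ (linear_of fL)).
have ffL := tmapP fL fL; have fffL := tmapP fL ffL.
apply/is_hopf_algebraP; split; [split | split | split | split |].
- by move=> x y z; rewrite -[x]gK -[y]gK -[z]gK -!fM mA.
- by move=> x; rewrite -[x]gK -f1 -fM m1l.
- by move=> x; rewrite -[x]gK -f1 -fM m1r.
- move=> x; rewrite -[x]gK fD [LHS](tlift_tmap fL fL); last exact: coassocl_bilinear.
  rewrite [RHS](tlift_tmap fL fL); last exact: coassocr_bilinear.
  (* Both sides are images, under the tensor cube of [f], of the two sides of coassociativity in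
     [A]. *)
  transitivity (tmap f (tmap f f)
    (tlft (fun x1 x2 : A => tlft (fun y z => y ⊗ (z ⊗ x2)) (hd x1)) (hd (g x)))).
    rewrite [RHS]linear_tlift //; apply: eq_tlift => x1 x2.
    rewrite [RHS]linear_tlift // fD [LHS](tlift_tmap fL fL).
      by apply: eq_tlift => y z; rewrite !tmap_pure.
    by split=> z a u v; rewrite ?pure_linearl ?pure_linearr.
  rewrite cA [LHS]linear_tlift //; apply: eq_tlift => x1 x2.
  by rewrite tmap_pure // fD.
- move=> x; rewrite -[x]gK fD [LHS](tlift_tmap fL fL); last exact: counitl_bilinear.
  rewrite -[in RHS](c1l (g x)) [RHS]linear_tlift //; apply: eq_tlift => x1 x2.
  by rewrite (linear_Z fL) fe.
- move=> x; rewrite -[x]gK fD [LHS](tlift_tmap fL fL); last exact: counitr_bilinear.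
  rewrite -[in RHS](c1r (g x)) [RHS]linear_tlift //; apply: eq_tlift => x1 x2.
  by rewrite (linear_Z fL) fe.
- move=> x y; rewrite -[x]gK -[y]gK -fM !fD DM.
  rewrite [RHS](tlift_tmap fL fL); last exact: comulM_bilinear.
  rewrite [LHS]linear_tlift //; apply: eq_tlift => x1 x2.
  rewrite [RHS](tlift_tmap fL fL); last exact: comulM_bilinearr.
  rewrite [LHS]linear_tlift //; apply: eq_tlift => y1 y2.
  by rewrite tmap_pure // !fM.
- by rewrite -f1 fD D1 tmap_pure.
- by move=> x y; rewrite -[x]gK -[y]gK -fM !fe eM.
- by rewrite -f1 fe.
- have S'L : linear (f \o S \o g) by exact: linear_comp (linear_comp gL SL) fL.
  exists (f \o S \o g) => // x; rewrite -[x]gK fD fe -f1 -(linear_Z fL).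
  have [SPl SPr] := SP (g x); split.
    rewrite -SPl [LHS](tlift_tmap fL fL); last exact: antipodel_bilinear.
    by rewrite [RHS]linear_tlift //; apply: eq_tlift => x1 x2 /=; rewrite fK fM.
  rewrite -SPr [LHS](tlift_tmap fL fL); last exact: antipoder_bilinear.
  by rewrite [RHS]linear_tlift //; apply: eq_tlift => x1 x2 /=; rewrite fK fM.
Qed.

Lemma hopf_isomorphic_of A B : is_hopf_algebra A -> bialg_iso A B -> hopf_isomorphic A B.
Proof.
move=> AP AB; split; [exact: AP | exact: is_hopf_algebra_iso AB AP |].
case: AB => f fbij; rewrite /bialg_morphism /tmap hm.unlock hd.unlock he.unlock h1.unlock.
rewrite -pureE -tliftE0 => -[fL fM f1 fD fe].
by exists (linear_of fL); split => //; split.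
Qed.

End HopfIso.

(** * The tensor Hopf algebra on words *)

Section Splits.
Variable T : Type.
Implicit Types s t : seq T.

(** One pair of complementary subwords for each set of positions: the terms of the unshuffling
    coproduct, with multiplicity. *)
Fixpoint splits s : seq (seq T * seq T) :=
  if s is x :: s' then
    [seq (x :: p.1, p.2) | p <- splits s'] ++ [seq (p.1, x :: p.2) | p <- splits s']
  else [:: ([::], [::])].

Variable V : nmodType.

(** Here and below, an equality of two lists of terms up to order is expressed by equal sums of an
    arbitrary function with values in an arbitrary commutative monoid. *)
Lemma sum_splits_cons x s (F : seq T * seq T -> V) :
  \sum_(p <- splits (x :: s)) F p =
  \sum_(p <- splits s) F (x :: p.1, p.2) + \sum_(p <- splits s) F (p.1, x :: p.2).
Proof. by rewrite /= big_cat !big_map. Qed.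

Lemma sum_splits0 (F : seq T * seq T -> V) :
  \sum_(p <- splits [::]) F p = F ([::], [::]).
Proof. by rewrite big_seq1. Qed.

Lemma sum_splitsC s (F : seq T -> seq T -> V) :
  \sum_(p <- splits s) F p.1 p.2 = \sum_(p <- splits s) F p.2 p.1.
Proof.
elim: s F => [|x s IH] F; first by rewrite !sum_splits0.
rewrite !sum_splits_cons /= addrC; congr (_ + _).
  by rewrite (IH (fun u v => F u (x :: v))).
by rewrite (IH (fun u v => F (x :: u) v)).
Qed.

(** Both sides run over the ways of dealing the letters of [s] out to three words. *)
Lemma sum_splitsA s (F : seq T -> seq T -> seq T -> V) :
  \sum_(p <- splits s) \sum_(q <- splits p.1) F q.1 q.2 p.2 =
  \sum_(p <- splits s) \sum_(q <- splits p.2) F p.1 q.1 q.2.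
Proof.
elim: s F => [|x s IH] F; first by rewrite !sum_splits0.
rewrite !sum_splits_cons /=.
under eq_bigr do rewrite big_cat !big_map /=.
under [X in _ = _ + X]eq_bigr do rewrite big_cat !big_map /=.
rewrite !big_split /= (IH (fun u v w => F (x :: u) v w)).
by rewrite (IH (fun u v w => F u (x :: v) w)) (IH (fun u v w => F u v (x :: w))) addrA.
Qed.

Lemma sum_splits_cat s t (F : seq T -> seq T -> V) :
  \sum_(p <- splits (s ++ t)) F p.1 p.2 =
  \sum_(p <- splits s) \sum_(q <- splits t) F (p.1 ++ q.1) (p.2 ++ q.2).
Proof.
elim: s F => [|x s IH] F; first by rewrite sum_splits0.
rewrite cat_cons !sum_splits_cons (IH (fun u v => F (x :: u) v)).
by rewrite (IH (fun u v => F u (x :: v))).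
Qed.

(** Reversal of words respects unshuffling; this serves for [theta_iso_op], where the product is
    read in the opposite order. *)
Lemma sum_splits_rev s (F : seq T -> seq T -> V) :
  \sum_(p <- splits (rev s)) F p.1 p.2 = \sum_(p <- splits s) F (rev p.1) (rev p.2).
Proof.
elim: s F => [|x s IH] F; first by rewrite !sum_splits0.
rewrite rev_cons -cats1 sum_splits_cat.
under eq_bigr do rewrite sum_splits_cons !sum_splits0 /= cats0.
rewrite (IH (fun u v => F (u ++ [:: x]) v + F (u ++ [::]) (v ++ [:: x]))).
rewrite big_split !sum_splits_cons /=; congr (_ + _); apply: eq_bigr => p _.
  by rewrite rev_cons cats1.
by rewrite rev_cons cats1 cats0.
Qed.

Lemma sum_splits_nil s (F : seq T -> V) :
  \sum_(p <- splits s) (if nilp p.1 then F p.2 else 0) = F s.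
Proof.
elim: s F => [|x s IH] F; first by rewrite sum_splits0.
by rewrite sum_splits_cons /= big1 // add0r (IH (F \o cons x)).
Qed.

End Splits.

(** The terms of the deconcatenation coproduct, the one with empty prefix first. *)
Fixpoint cuts (T : Type) (s : seq T) : seq (seq T * seq T) :=
  ([::], s) :: if s is x :: s' then [seq (x :: p.1, p.2) | p <- cuts s'] else [::].

Lemma splits_map (T U : Type) (f : T -> U) s :
  splits (map f s) = [seq (map f p.1, map f p.2) | p <- splits s].
Proof. by elim: s => [|x s IH] //=; rewrite IH map_cat -!map_comp. Qed.

Lemma subseq_splits (T : eqType) (s : seq T) p : p \in splits s ->
  [/\ subseq p.1 s, subseq p.2 s & perm_eq (p.1 ++ p.2) s].
Proof.
elim: s p => [|x s IH] p /=; first by rewrite inE => /eqP ->.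
rewrite mem_cat => /orP[] /mapP[q /IH[q1 q2 qs] ->] /=.
  by rewrite eqxx perm_cons; split=> //; exact: subseq_trans q2 (subseq_cons _ _).
rewrite eqxx; split=> //; first exact: subseq_trans q1 (subseq_cons _ _).
by rewrite (perm_catCA _ [:: x]) /= perm_cons.
Qed.

Section FreeHopfBasis.
Variables (K : fieldType) (T : choiceType) (prod : T -> T -> {malg K[T]}).
Variables (one : {malg K[T]}) (coprod : T -> tensor {malg K[T]} {malg K[T]}).
Variable (counit : T -> K^o).
Local Notation H := (free_hopf prod one coprod counit).

Lemma free_hm (a b : T) : (<< a >> : H) ∙ << b >> = prod a b.
Proof.
rewrite -hmE -pureE; transitivity (free_mul prod << a >> << b >>); first exact: tlift_pure.
by rewrite /free_mul !mlinU.
Qed.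

Lemma free_hd a : hd (<< a >> : H) = coprod a.
Proof. by rewrite -hdE; exact: mlinU. Qed.

Lemma free_he a : he (<< a >> : H) = counit a.
Proof. by rewrite -heE; exact: mlinU. Qed.

Lemma free_h1 : h1 = (one : H). Proof. by rewrite h1.unlock. Qed.

Lemma free_ext (X : lmodType K) (f g : H -> X) : linear f -> linear g ->
  (forall a : T, f << a >> = g << a >>) -> forall x, f x = g x.
Proof. exact: malg_ext. Qed.

Lemma free_bialg_morphism (B : hopf_data K) (f : H -> B) : linear f ->
  (forall a b : T, f ((<< a >> : H) ∙ << b >>) = f << a >> ∙ f << b >>) -> f h1 = h1 ->
  (forall a, hd (f << a >>) = tmap f f (hd (<< a >> : H))) ->
  (forall a, he (f << a >>) = he (<< a >> : H)) -> bialg_morphism f.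
Proof.
move=> fL fM f1 fD fe.
have hmL (C : hopf_data K) (u : C) : linear (fun v : C => u ∙ v) := (hm_bilinear C).2 u.
have hmR (C : hopf_data K) (u : C) : linear (fun v : C => v ∙ u) := (hm_bilinear C).1 u.
split=> //.
- move=> x y; move: x; apply: malg_ext => [||a].
  + exact: (linear_comp (hmR H y) fL).
  + exact: (linear_comp fL (hmR B _)).
  move: y; apply: malg_ext => [||b] //.
  + exact: (linear_comp (hmL H _) fL).
  + exact: (linear_comp fL (hmL B _)).
- apply: malg_ext => //.
  + exact: (linear_comp fL (@hd_linear _ B)).
  + exact: (linear_comp (@hd_linear _ H) (tmapP fL fL)).
- apply: malg_ext => //; first exact: (linear_comp fL (@he_linear _ B)).
  exact: (@he_linear _ H).
Qed.

End FreeHopfBasis.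

Section WordHopf.
Variables (K : fieldType) (A : choiceType).
Local Notation W := {malg K[seq A]}.

Definition word_hopf : hopf_data K :=
  free_hopf (fun u v : seq A => << u ++ v >> : W) << [::] >>
    (fun w => \sum_(p <- splits w) pure (<< p.1 >> : W) (<< p.2 >> : W))
    (fun w => (w == [::])%:R).
Local Notation H := word_hopf.
Implicit Types u v w : seq A.

Lemma word_hm u v : (<< u >> : H) ∙ << v >> = << u ++ v >>.
Proof. exact: free_hm. Qed.

Lemma word_h1 : h1 = (<< [::] >> : H). Proof. exact: free_h1. Qed.

Lemma word_hd w :
  hd (<< w >> : H) = \sum_(p <- splits w) (<< p.1 >> : H) ⊗ (<< p.2 >> : H).
Proof. by rewrite -pureE; exact: free_hd. Qed.

Lemma word_he w : he (<< w >> : H) = (w == [::])%:R.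
Proof. exact: free_he. Qed.

Lemma tlift_word_hd (X : lmodType K) (b : H -> H -> X) : is_bilinear b ->
  forall w, tlft b (hd (<< w >> : H)) = \sum_(p <- splits w) b << p.1 >> << p.2 >>.
Proof.
move=> bP w; rewrite word_hd (linear_sums (tliftP bP)).
by apply: eq_bigr => p _; rewrite tliftE.
Qed.

(** The antiautomorphism that negates every letter. *)
Definition word_antipode : H -> H := mlin (fun w => (-1) ^+ size w *: (<< rev w >> : H)).

Lemma word_antipodeP : linear word_antipode. Proof. exact: mlin_linear. Qed.

Lemma word_antipodeU w : word_antipode << w >> = (-1) ^+ size w *: (<< rev w >> : H).
Proof. exact: mlinU. Qed.

Lemma hml_linear (B : hopf_data K) (u : B) : linear (fun v : B => u ∙ v).
Proof. exact: (hm_bilinear B).2. Qed.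

Lemma hmr_linear (B : hopf_data K) (v : B) : linear (fun u : B => u ∙ v).
Proof. exact: (hm_bilinear B).1. Qed.

(** The first letter [x] of a nonempty word lands in one of the two parts. As the antipode of
    [x :: p] is minus the antipode of [p] times [x], the two terms cancel for each split of the
    rest. *)
Lemma word_antipodel u :
  \sum_(p <- splits u) word_antipode << p.1 >> ∙ << p.2 >> = (u == [::])%:R *: (h1 : H).
Proof.
case: u => [|x u].
  by rewrite sum_splits0 word_antipodeU !scale1r word_hm word_h1.
rewrite sum_splits_cons scale0r -big_split big1 //= => p _.
rewrite !word_antipodeU exprS mulN1r scaleNr (linear_Z (hmr_linear _)) -scaleNr.
rewrite (linear_Z (hmr_linear _)) !word_hm rev_cons cat_rcons -scalerDl.
by rewrite addNr scale0r.
Qed.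

Lemma word_antipoder u :
  \sum_(p <- splits u) (<< p.1 >> : H) ∙ word_antipode << p.2 >> = (u == [::])%:R *: (h1 : H).
Proof.
elim: u => [|x u IH].
  by rewrite sum_splits0 word_antipodeU !scale1r word_hm word_h1.
rewrite sum_splits_cons scale0r /=.
(* The splits with [x] on the left add up to [x] times the sum for [u], those with [x] on the right
   to minus that sum times [x]. By induction the sum for [u] is a multiple of the unit, so the two
   cancel. *)
transitivity ((<< [:: x] >> : H) ∙ ((u == [::])%:R *: (h1 : H)) -
              ((u == [::])%:R *: (h1 : H)) ∙ << [:: x] >>).
  rewrite -IH (linear_sums (hml_linear _)) (linear_sums (hmr_linear _)).
  rewrite -sumrN; congr (_ + _); apply: eq_bigr => p _.
    by rewrite word_antipodeU !(linear_Z (hml_linear _)) !word_hm.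
  rewrite !word_antipodeU /= exprS mulN1r !(linear_Z (hml_linear _)) !word_hm.
  by rewrite (linear_Z (hmr_linear _)) word_hm rev_cons -cats1 catA scaleNr.
rewrite (linear_Z (hml_linear _)) (linear_Z (hmr_linear _)) !word_h1 !word_hm.
by rewrite cats0 subrr.
Qed.

Lemma word_hopfP : is_hopf_algebra H.
Proof.
have hmR := @hmr_linear H; have hmL := @hml_linear H.
have hdL := @hd_linear _ H; have heL := @he_linear _ H.
apply/is_hopf_algebraP; split; [split | split | split | split |].
- move=> x y z; move: x; apply: free_ext => [||u].
  + exact: hmR.
  + exact: (linear_comp (hmR _) (hmR _)).
  move: y; apply: free_ext => [||v].
  + exact: (linear_comp (hmR _) (hmL _)).
  + exact: (linear_comp (hmL _) (hmR _)).
  move: z; apply: free_ext => [||w].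
  + exact: (linear_comp (hmL _) (hmL _)).
  + exact: hmL.
  by rewrite !word_hm catA.
- by apply: free_ext => [||u] //; rewrite word_h1 word_hm.
- by apply: free_ext => [||u] //; rewrite word_h1 word_hm cats0.
- apply: free_ext => [||w].
  + exact: linear_comp hdL (tliftP (coassocl_bilinear _)).
  + exact: linear_comp hdL (tliftP (coassocr_bilinear _)).
  rewrite !tlift_word_hd; [|exact: coassocr_bilinear|exact: coassocl_bilinear].
  transitivity (\sum_(p <- splits w) \sum_(q <- splits p.1)
     ((<< q.1 >> : H) ⊗ ((<< q.2 >> : H) ⊗ (<< p.2 >> : H)))).
    apply: eq_bigr => p _; rewrite tlift_word_hd //.
    by split=> z a u v; rewrite ?pure_linearl ?pure_linearr.
  rewrite (sum_splitsA w (fun u v t => (<< u >> : H) ⊗ ((<< v >> : H) ⊗ (<< t >> : H)))).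
  by apply: eq_bigr => p _; rewrite word_hd (linear_sums (pure_linearr _)).
- apply: free_ext => [||w] //.
    by move=> a u v; rewrite hdL (tliftP (counitl_bilinear _)).
  rewrite tlift_word_hd; last exact: counitl_bilinear.
  rewrite -[RHS](sum_splits_nil w (fun v => << v >> : H)); apply: eq_bigr => p _.
  by rewrite word_he; case: p.1 => [|? ?]; rewrite ?scale1r ?scale0r.
- apply: free_ext => [||w] //.
    by move=> a u v; rewrite hdL (tliftP (counitr_bilinear _)).
  rewrite tlift_word_hd; last exact: counitr_bilinear.
  rewrite (sum_splitsC w (fun u v => he (<< v >> : H) *: (<< u >> : H))).
  rewrite -[RHS](sum_splits_nil w (fun v => << v >> : H)); apply: eq_bigr => p _.
  by rewrite word_he; case: p.1 => [|? ?]; rewrite ?scale1r ?scale0r.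
- move=> x y; move: x; apply: free_ext => [||u].
  + exact: linear_comp (hmR _) hdL.
  + exact: linear_comp hdL (tliftP (comulM_bilinear _)).
  move: y; apply: free_ext => [||v].
  + exact: linear_comp (hmL _) hdL.
  + move=> a y z; rewrite -tlift_linb; apply: eq_tlift => x1 x2.
    by rewrite hdL (tliftP (comulM_bilinearr _ _)).
  rewrite word_hm [LHS]word_hd [RHS]tlift_word_hd; last exact: comulM_bilinear.
  rewrite [LHS](sum_splits_cat u v (fun s t => (<< s >> : H) ⊗ (<< t >> : H))).
  apply: eq_bigr => p _; rewrite tlift_word_hd; last exact: comulM_bilinearr.
  by apply: eq_bigr => q _; rewrite !word_hm.
- by rewrite word_h1 word_hd sum_splits0.
- move=> x y; move: x; apply: free_ext => [||u].
  + exact: linear_comp (hmR _) heL.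
  + by move=> a x z; rewrite heL mulrDl scalerAl.
  move: y; apply: free_ext => [||v].
  + exact: linear_comp (hmL _) heL.
  + by move=> a y z; rewrite heL mulrDr scalerAr.
  by rewrite word_hm !word_he; case: u => [|? ?]; rewrite ?mul1r ?mul0r.
- by rewrite word_h1 word_he.
- have SL := word_antipodeP; exists word_antipode => // x.
  split; move: x; apply: free_ext => [||w].
  + exact: linear_comp hdL (tliftP (antipodel_bilinear SL)).
  + by move=> a x y; rewrite heL scalerDl scalerA.
  + by rewrite tlift_word_hd ?word_he ?word_antipodel //; exact: antipodel_bilinear.
  + exact: linear_comp hdL (tliftP (antipoder_bilinear SL)).
  + by move=> a x y; rewrite heL scalerDl scalerA.
  + by rewrite tlift_word_hd ?word_he ?word_antipoder //; exact: antipoder_bilinear.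
Qed.

End WordHopf.

(** * Factorization into irreducibles *)

Section Unitriangular.
Variables (K : fieldType) (A B : choiceType) (f : {malg K[A]} -> {malg K[B]}).
Variables (k : B -> A) (rank : B -> nat) (low : B -> seq B).
Hypothesis fL : linear f.
Hypothesis k_surj : forall a, exists b, k b = a.
Hypothesis f_low : forall b, f << k b >> = << b >> + \sum_(c <- low b) << c >>.
Hypothesis low_rank : forall b c, c \in low b -> (rank c < rank b)%N.

Let g : {malg K[B]} -> {malg K[B]} := f \o mlin (fun b => << k b >>).
(** On a basis vector [N] is minus a sum of basis vectors of smaller rank. So [N] is locally
    nilpotent, and [g], the identity minus [N], is bijective. *)
Let N (z : {malg K[B]}) := z - g z.

Let gL : linear g. Proof. exact: linear_comp (@mlin_linear _ _ _ _) fL. Qed.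
Let NL : linear N.
Proof. by move=> a u v; rewrite /N gL opprD addrACA -scalerBr. Qed.
Let iterNL n : linear (iter n N).
Proof. by elim: n => [|n IH] a u v //; rewrite !iterS IH NL. Qed.

Let iterN_basis n b : (rank b < n)%N -> iter n N << b >> = 0.
Proof.
elim: n b => [|n IH] b // lt_bn; rewrite iterSr /N /g /= mlinU f_low opprD addrA subrr add0r.
rewrite -scaleN1r (linear_Z (iterNL n)) (linear_sums (iterNL n)).
rewrite big_seq big1 ?scaler0 // => c /low_rank lt_cb; apply: IH.
exact: leq_trans lt_cb lt_bn.
Qed.

Let iterN_nil z : exists n, iter n N z = 0.
Proof.
elim/malg_ind: z => [|a b z [n nz]]; first by exists 0%N.
exists (n + (rank b).+1)%N; rewrite iterNL {2}addnC !iterD nz iterN_basis //.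
by rewrite !(linear_0 (iterNL _)) scaler0 addr0.
Qed.

Let g_surj z : exists y, g y = z.
Proof.
have [n] := iterN_nil z; elim: n z => [|n IH] z.
  by move=> /= ->; exists 0; exact: linear_0.
(* [y] is a preimage under [g] of [N z], that is, of [z - g z]; it exists because [N z] is killed by
   one iteration less. *)
rewrite iterSr => /IH[y gy]; exists (z + y).
by rewrite (linear_D gL) gy /N addrC subrK.
Qed.

Let g_inj0 z : g z = 0 -> z = 0.
Proof.
move=> gz; have [n] := iterN_nil z.
suff -> : iter n N z = z by [].
by elim: n => // n IH; rewrite iterS IH /N gz subr0.
Qed.

(** Surjectivity of [f] follows from that of [g]. For injectivity, [k] is onto, so any vector killed
    by [f] comes from a vector killed by [g]. *)
Lemma unitriangular_bijective : bijective f.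
Proof.
have k_lin_surj z : exists y, mlin (fun b => << k b >>) y = z :> {malg K[A]}.
  elim/malg_ind: z => [|a t z [y yz]]; first by exists 0; exact: (linear_0 (mlin_linear _)).
  have [b kb] := k_surj t; exists (a *: << b >> + y).
  by rewrite mlin_linear mlinU kb yz.
have f_inj : injective f.
  move=> x y fxy; apply/eqP; rewrite -subr_eq0; apply/eqP.
  have : f (x - y) = 0.
    by rewrite (linear_D fL) -scaleN1r (linear_Z fL) scaleN1r fxy subrr.
  have [z <-] := k_lin_surj (x - y) => /g_inj0 ->; exact: (linear_0 (mlin_linear _)).
have f_surj z : exists x, f x = z.
  by have [y <-] := g_surj z; exists (mlin (fun b => << k b >>) y).
exists (fun z => projT1 (cid (f_surj z))) => [x|z]; last by case: cid.
by apply: f_inj; case: cid.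
Qed.

End Unitriangular.

(** * Cutting off irreducible left factors *)

Section Factorization.
Variables (T : choiceType) (op : T -> T -> T) (e : T) (sz : T -> nat).
(* The terms of a coproduct, or only those whose left factor contains a       *)
(* distinguished generator (the first atom, the first node).                  *)
Variable cut : T -> seq (T * T).

Definition irreducible a :=
  (a != e) && `[< forall b c, a = op b c -> b = e \/ c = e >].

Definition letter : Type := {a : T | irreducible a}.
HB.instance Definition _ := Choice.on letter.

(* The words obtained by cutting off irreducible elements repeatedly; [n] is  *)
(* only a bound on the number of cuts.                                        *)
Fixpoint theta_rec n a : seq (seq letter) :=
  if a == e then [:: [::]] else
  if n is m.+1 then
    flatten [seq oapp (fun v : letter => map (cons v) (theta_rec m p.2)) [::] (insub p.1)
            | p <- cut a]
  else [::].

Definition theta a := theta_rec (sz a) a.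

Definition letters_prod (w : seq letter) := foldr (fun v => op (val v)) e w.

Definition weight (w : seq letter) := \sum_(v <- w) sz (val v).

Hypotheses (op1 : left_id e op) (op1r : right_id e op) (opA : associative op).
Hypotheses (szM : forall a b, sz (op a b) = (sz a + sz b)%N) (sz1 : sz e = 0%N).
Hypothesis sz_eq0 : forall a, sz a = 0%N -> a = e.
Hypothesis cut_sz : forall a p, p \in cut a -> (sz p.1 + sz p.2)%N = sz a.
Hypothesis cut_neq1 : forall a p, p \in cut a -> p.1 != e.
(** As [F] is arbitrary, this says that [(a, e)] occurs once among the cuts of [a] and is the only
    one with trivial right factor. The next hypothesis compares the cuts of a product with those of
    its first factor, up to cuts whose left factor is reducible. *)
Hypothesis cut_full : forall (V : nmodType) (F : T -> V) a, a != e ->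
  \sum_(p <- cut a | p.2 == e) F p.1 = F a.
Hypothesis cut_op : forall (V : nmodType) (F : T -> T -> V) a b, a != e ->
  (forall x y, ~~ irreducible x -> F x y = 0) ->
  \sum_(p <- cut (op a b)) F p.1 p.2 = \sum_(p <- cut a) F p.1 (op p.2 b).

Lemma sz_gt0 a : a != e -> (0 < sz a)%N.
Proof. by move=> a1; rewrite lt0n; apply: contraNneq a1 => /sz_eq0 ->. Qed.

Lemma cut_lt a p : p \in cut a -> (sz p.2 < sz a)%N.
Proof.
move=> pa; rewrite -(cut_sz pa) -addn1 addnC leq_add2r.
exact: sz_gt0 (cut_neq1 pa).
Qed.

Lemma theta_rec1 n : theta_rec n e = [:: [::]].
Proof. by case: n => [|n] /=; rewrite eqxx. Qed.

Lemma theta_recE n m a : (sz a <= n)%N -> (sz a <= m)%N -> theta_rec n a = theta_rec m a.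
Proof.
elim: n m a => [|n IH] m a.
  by rewrite leqn0 => /eqP/sz_eq0 ->; rewrite !theta_rec1.
case: m => [|m]; first by move=> _; rewrite leqn0 => /eqP/sz_eq0 ->; rewrite !theta_rec1.
move=> le_an le_am /=; case: eqP => // _; congr flatten; apply/eq_in_map => p pa.
congr (oapp _ _ _); apply/funext => v; congr (map _ _).
by apply: IH; rewrite -ltnS (leq_trans (cut_lt pa)).
Qed.

Lemma theta1 : theta e = [:: [::]].
Proof. by rewrite /theta sz1 /= eqxx. Qed.

Lemma thetaE a : a != e ->
  theta a = flatten [seq oapp (fun v : letter => map (cons v) (theta p.2)) [::] (insub p.1)
                    | p <- cut a].
Proof.
move=> a1; rewrite {1}/theta; have := sz_gt0 a1; case Ea: (sz a) => [|n] // _ /=.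
rewrite (negPf a1); congr flatten; apply/eq_in_map => p pa; congr (oapp _ _ _).
apply/funext => v; congr (map _ _); apply: theta_recE => //.
by rewrite -ltnS -Ea cut_lt.
Qed.

Lemma sum_theta (V : nmodType) (F : seq letter -> V) a : a != e ->
  \sum_(w <- theta a) F w =
  \sum_(p <- cut a) oapp (fun v => \sum_(w <- theta p.2) F (v :: w)) 0 (insub p.1).
Proof.
move=> a1; rewrite thetaE // big_flatten big_map; apply: eq_bigr => p _.
by case: insub => [v|] /=; rewrite ?big_map ?big_nil.
Qed.

Lemma oapp_insub_irr (V : nmodType) x (G : letter -> V) :
  ~~ irreducible x -> oapp G 0 (insub x) = 0.
Proof. by move=> x_red; rewrite insubN. Qed.

(** Only cuts with irreducible left factor contribute to [theta], and by [cut_op] those of [op a b]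
    are those of [a] with [b] appended to the right factor. The rest is induction on the size of
    [a]. *)
Lemma sum_theta_op (V : nmodType) (F : seq letter -> V) a b :
  \sum_(w <- theta (op a b)) F w =
  \sum_(u <- theta a) \sum_(v <- theta b) F (u ++ v).
Proof.
elim/ltn_ind: (sz a) {-2}a (erefl (sz a)) F => n IH {}a an F.
case: (eqVneq a e) => [->|a1]; first by rewrite op1 theta1 big_seq1.
have ab1 : op a b != e.
  by apply: contraTneq (sz_gt0 a1) => /(congr1 sz)/eqP; rewrite szM sz1 addn_eq0 => /andP[/eqP->].
rewrite [RHS]sum_theta // sum_theta //.
rewrite (cut_op (F := fun x y => oapp (fun v => \sum_(w <- theta y) F (v :: w)) 0 (insub x))) //.
  apply: eq_big_seq => p pa.
  case: insub => [v|] //=.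
  by rewrite (IH (sz p.2) _ _ _ (fun w => F (v :: w))) // -an cut_lt.
by move=> x y; exact: oapp_insub_irr.
Qed.

Lemma weight_theta a w : w \in theta a -> weight w = sz a.
Proof.
elim/ltn_ind: (sz a) {-2}a (erefl (sz a)) w => n IH {}a an w.
case: (eqVneq a e) => [->|a1].
  by rewrite theta1 inE => /eqP ->; rewrite /weight big_nil sz1.
rewrite thetaE // => /flattenP[_ /mapP[p pa ->]].
case: insubP => //= v _ vp /mapP[u up ->]; rewrite /weight big_cons.
have lt_pn : (sz p.2 < n)%N by rewrite -an cut_lt.
by rewrite -/(weight u) (IH _ lt_pn _ erefl _ up) -(cut_sz pa) -vp.
Qed.

Lemma theta_nil a : a != e -> [::] \notin theta a.
Proof.
move=> a1; rewrite thetaE //; apply/flattenP => -[_ /mapP[p pa ->]].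
by case: insubP => //= v _ vp /mapP[].
Qed.

Lemma size_weight w : (size w <= weight w)%N.
Proof.
elim: w => [|v w IH] //; rewrite /weight big_cons.
by apply: (@leq_add 1%N); last exact: IH; apply: sz_gt0; case/andP: (valP v).
Qed.

Lemma letters_prod_cat u v : letters_prod (u ++ v) = op (letters_prod u) (letters_prod v).
Proof. by elim: u => [|x u IH] /=; rewrite ?op1 // IH opA. Qed.

Lemma letters_prod_surj a : exists w, letters_prod w = a.
Proof.
elim/ltn_ind: (sz a) {-2}a (erefl (sz a)) => n IH {}a an.
case: (eqVneq a e) => [->|a1]; first by exists [::].
case irr_a: (irreducible a).
  by exists [:: Sub a irr_a]; rewrite /= op1r.
move: irr_a; rewrite /irreducible a1 /= => /asboolPn/existsNP[b /existsNP[c]].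
move=> /not_implyP[abc /not_orP[/eqP b1 /eqP c1]].
have [|u ub] := IH (sz b) _ b erefl.
  by rewrite -an abc szM -addn1 leq_add2l sz_gt0.
have [|v vc] := IH (sz c) _ c erefl.
  by rewrite -an abc szM -add1n leq_add2r sz_gt0.
by exists (u ++ v); rewrite letters_prod_cat ub vc.
Qed.

(** The cut [(val v, e)] gives the one-letter word; any other cut leaves a nontrivial rest, hence at
    least one more letter. *)
Lemma theta_letter (v : letter) : exists s, (forall (V : nmodType) (F : seq letter -> V),
    \sum_(w <- theta (val v)) F w = F [:: v] + \sum_(w <- s) F w)
  /\ {in s, forall w, 1 < size w}%N.
Proof.
have v1 : val v != e by case/andP: (valP v).
exists (flatten [seq oapp (fun v : letter => map (cons v) (theta p.2)) [::] (insub p.1)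
                | p <- cut (val v) & p.2 != e]).
split=> [V F|w /flattenP[_ /mapP[p + ->]]]; last first.
  rewrite mem_filter => /andP[p1 pv]; case: insubP => //= x _ _ /mapP[u up ->].
  by case: u up => // up; rewrite (negPf (theta_nil p1)) in up.
rewrite sum_theta // (bigID (fun p => p.2 == e)) /= big_flatten big_map big_filter; congr (_ + _).
  under eq_bigr => p /eqP p1 do rewrite p1 theta1.
  rewrite (cut_full (fun x => oapp (fun v => \sum_(w <- [:: [::]]) F (v :: w)) 0 (insub x))) //.
  by rewrite valK /= big_seq1.
by apply: eq_bigr => p _; case: insub => [x|] /=; rewrite ?big_map ?big_nil.
Qed.

(** By multiplicativity the words are concatenations of one word from [theta] of each letter. Taking
    the leading term everywhere gives [w], any other choice a longer word. *)
Lemma theta_letters_prod w : exists s, (forall (V : nmodType) (F : seq letter -> V),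
    \sum_(u <- theta (letters_prod w)) F u = F w + \sum_(u <- s) F u)
  /\ {in s, forall u, size w < size u}%N.
Proof.
elim: w => [|x w [s [sE s_gt]]].
  by exists [::]; split => // V F; rewrite theta1 big_seq1 big_nil addr0.
have [r [rE r_gt]] := theta_letter x.
exists (map (cons x) s ++ [seq u ++ w | u <- r] ++ [seq u ++ v | u <- r, v <- s]).
split=> [V F|u].
  rewrite /= sum_theta_op rE !big_cat !big_map big_allpairs_dep /= sE -addrA.
  congr (_ + (_ + _)); rewrite -big_split; apply: eq_bigr => u _; exact: sE.
rewrite !mem_cat => /or3P[/mapP[v /s_gt ? ->]|/mapP[v /r_gt v2 ->]|/allpairsP[[v t] /= [/r_gt v2 /s_gt t2 ->]]] //=.
  by rewrite size_cat -[(size w).+1]add1n ltn_add2r.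
by rewrite size_cat; apply: ltnW; exact: (leq_add v2 t2).
Qed.

Lemma sz_letters_prod w : sz (letters_prod w) = weight w.
Proof.
elim: w => [|x v IH] /=; first by rewrite /weight big_nil sz1.
by rewrite szM IH /weight big_cons.
Qed.

Lemma letters_prod_theta w : w \in theta (letters_prod w).
Proof.
have [s [sE _]] := theta_letters_prod w; apply: contraT => w_notin.
(* With values in [nat] and the indicator of [w] for [F], the identity counts the occurrences of
   [w]. *)
have := sE nat (fun v => (v == w : nat)); rewrite eqxx big_seq big1 // => v v_in.
by case: eqP v_in => // ->; rewrite (negPf w_notin).
Qed.

Lemma theta_bijective (K : fieldType) :
  bijective (mlin (fun a => \sum_(w <- theta a) << w >>) : {malg K[T]} -> {malg K[seq letter]}).
Proof.
pose low w := projT1 (cid (theta_letters_prod w)).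
have lowP w := projT2 (cid (theta_letters_prod w)).
(* All the words in [theta (letters_prod w)] have the weight of [w], and lengths are bounded by
   weights; hence [weight - size] decreases when words get longer. *)
apply: (@unitriangular_bijective _ _ _ _ letters_prod (fun w => weight w - size w)%N low).
- exact: mlin_linear.
- exact: letters_prod_surj.
- by move=> w; rewrite mlinU (lowP w).1.
move=> w u us; have [sE s_gt] := lowP w.
have u_in : u \in theta (letters_prod w).
  apply: contraT => u_notin.
  have := sE nat (fun v => (v == u : nat)); rewrite big_seq big1; last first.
    by move=> v v_in; case: eqP v_in => // ->; rewrite (negPf u_notin).
  by rewrite (big_rem u) //= eqxx addrCA.
rewrite (weight_theta u_in) sz_letters_prod ltn_sub2l ?s_gt //.
by rewrite -sz_letters_prod -(weight_theta u_in); apply: leq_trans (size_weight u); exact: s_gt.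
Qed.

Lemma irreducible_op a b : a != e -> b != e -> ~~ irreducible (op a b).
Proof.
move=> a1 b1; rewrite /irreducible negb_and; apply/orP; right; apply/asboolPn => /(_ a b erefl).
by case=> /eqP; apply/negP.
Qed.

(** * The cutting map as a morphism of coalgebras *)

Section Coproducts.
Variable full : T -> seq (T * T).
Hypothesis full1 : full e = [:: (e, e)].
Hypothesis cut_assoc : forall (V : nmodType) (F : T -> T -> T -> V) a, a != e ->
  \sum_(p <- cut a) \sum_(q <- full p.2) F p.1 q.1 q.2 =
  \sum_(p <- cut a) \sum_(q <- cut p.1) F q.1 q.2 p.2.

(** By [cut_assoc], splitting what is left after the first letter amounts to cutting [a] in two and
    taking the first letter from the left part. *)
Lemma sum_theta_cut (V : nmodType) (F : seq letter -> seq letter -> V) a : a != e ->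
  \sum_(p <- cut a) oapp (fun v => \sum_(q <- full p.2) \sum_(u <- theta q.1)
      \sum_(w <- theta q.2) F (v :: u) w) 0 (insub p.1) =
  \sum_(p <- cut a) \sum_(u <- theta p.1) \sum_(w <- theta p.2) F u w.
Proof.
move=> a1; pose G x y z := oapp (fun v => \sum_(u <- theta y) \sum_(w <- theta z)
  F (v :: u) w) 0 (insub x).
transitivity (\sum_(p <- cut a) \sum_(q <- full p.2) G p.1 q.1 q.2).
  by apply: eq_bigr => p _; rewrite /G; case: insub => //=; rewrite big1.
rewrite (cut_assoc G a1); apply: eq_big_seq => p pa.
by rewrite sum_theta ?(cut_neq1 pa).
Qed.

(** A cut of a nonempty word either is empty on the left, which matches the term [(e, a)], or keeps
    the first letter on the left, which matches [cut a] by [sum_theta_cut]. *)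
Lemma sum_theta_cuts (V : nmodType) (F : seq letter -> seq letter -> V) a :
    (forall a, a != e -> full a = (e, a) :: cut a) ->
  \sum_(w <- theta a) \sum_(q <- cuts w) F q.1 q.2 =
  \sum_(p <- full a) \sum_(u <- theta p.1) \sum_(w <- theta p.2) F u w.
Proof.
move=> fullE; elim/ltn_ind: (sz a) {-2}a (erefl (sz a)) F => n IH {}a an F.
case: (eqVneq a e) => [->|a1]; first by rewrite full1 !big_seq1 theta1 /= !big_seq1.
rewrite fullE // big_cons theta1 big_seq1 -sum_theta_cut //.
have -> : \sum_(w <- theta a) \sum_(q <- cuts w) F q.1 q.2 =
    \sum_(w <- theta a) (F [::] w + if w is x :: w' then
       \sum_(q <- cuts w') F (x :: q.1) q.2 else 0).
  by apply: eq_bigr => -[|x w] _; rewrite ?big_seq1 ?addr0 // big_cons big_map.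
rewrite big_split /=; congr (_ + _).
rewrite sum_theta //; apply: eq_big_seq => p pa.
case: insub => //= v; rewrite (IH (sz p.2) _ _ _ (fun u w => F (v :: u) w)) //.
by rewrite -an cut_lt.
Qed.

Hypothesis fullE : forall a, a != e ->
  full a = cut a ++ [seq (p.2, p.1) | p <- cut a].

Lemma sum_fullC (V : nmodType) (F : T -> T -> V) a :
  \sum_(p <- full a) F p.1 p.2 = \sum_(p <- full a) F p.2 p.1.
Proof.
case: (eqVneq a e) => [->|a1]; first by rewrite full1 !big_seq1.
by rewrite fullE // !big_cat !big_map /= addrC.
Qed.

(** The first letter goes to the left or to the right word. The first case is [sum_theta_cut]; the
    second is its mirror image, reached by the symmetry [sum_fullC]. *)
Lemma sum_theta_splits (V : nmodType) (F : seq letter -> seq letter -> V) a :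
  \sum_(w <- theta a) \sum_(q <- splits w) F q.1 q.2 =
  \sum_(p <- full a) \sum_(u <- theta p.1) \sum_(w <- theta p.2) F u w.
Proof.
elim/ltn_ind: (sz a) {-2}a (erefl (sz a)) F => n IH {}a an F.
case: (eqVneq a e) => [->|a1]; first by rewrite full1 !big_seq1 theta1 /= !big_seq1.
rewrite fullE // big_cat big_map /= -sum_theta_cut //.
under [X in _ = _ + X]eq_bigr do rewrite exchange_big.
rewrite -(sum_theta_cut (fun u w => F w u)) // -big_split sum_theta //.
apply: eq_big_seq => p pa.
case: insub => [v|] /=; last by rewrite addr0.
have lt_pn : (sz p.2 < n)%N by rewrite -an cut_lt.
under eq_bigr do rewrite sum_splits_cons.
rewrite big_split (IH _ lt_pn _ erefl (fun u w => F (v :: u) w)); congr (_ + _).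
rewrite (IH _ lt_pn _ erefl (fun u w => F u (v :: w))).
rewrite (sum_fullC (fun x y => \sum_(u <- theta x) \sum_(w <- theta y) F u (v :: w))).
by apply: eq_bigr => q _; rewrite exchange_big.
Qed.

Variable K : fieldType.
Variables (prod : T -> T -> {malg K[T]}) (one : {malg K[T]}).
Variables (coprod : T -> tensor {malg K[T]} {malg K[T]}) (counit : T -> K^o).
Hypothesis one1 : one = << e >>.
Hypothesis coprodE : forall a, coprod a = \sum_(p <- full a) << p.1 >> ⊗ << p.2 >>.
Hypothesis counitE : forall a, counit a = (a == e)%:R.
Local Notation H := (free_hopf prod one coprod counit).
Local Notation W := (word_hopf K letter).

Section ThetaMorphism.
(** [r] will be the identity or the reversal of words. *)
Variable r : seq letter -> seq letter.
Hypothesis r_nil : r [::] = [::].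
Hypothesis r_neq0 : forall w, w != [::] -> r w != [::].
Hypothesis r_splits : forall (V : nmodType) w (F : seq letter -> seq letter -> V),
  \sum_(p <- splits (r w)) F p.1 p.2 = \sum_(p <- splits w) F (r p.1) (r p.2).

Definition theta_map : H -> W := mlin (fun a => \sum_(w <- theta a) (<< r w >> : W)).

Lemma theta_map_linear : linear theta_map. Proof. exact: mlin_linear. Qed.

Lemma theta_mapU a : theta_map << a >> = \sum_(w <- theta a) (<< r w >> : W).
Proof. exact: mlinU. Qed.

Lemma theta_map_morphism :
  (forall a b, theta_map (prod a b) = theta_map << a >> ∙ theta_map << b >>) ->
  bialg_morphism theta_map.
Proof.
move=> tM; have tL := theta_map_linear.
apply: free_bialg_morphism => // [a b||a|a].
- by rewrite [in LHS]free_hm.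
- by rewrite free_h1 one1 theta_mapU theta1 big_seq1 r_nil word_h1.
- rewrite free_hd coprodE theta_mapU (linear_sums (@hd_linear _ W)).
  rewrite (linear_sums (tmapP tL tL)).
  transitivity (\sum_(w <- theta a) \sum_(q <- splits w)
     ((<< r q.1 >> : W) ⊗ (<< r q.2 >> : W))).
    by apply: eq_bigr => w _; rewrite word_hd (r_splits w (fun u v => (<< u >> : W) ⊗ (<< v >> : W))).
  rewrite (sum_theta_splits (fun u v => (<< r u >> : W) ⊗ (<< r v >> : W))).
  apply: eq_bigr => p _; rewrite tmap_pure // !theta_mapU.
  rewrite (linear_sums (pure_linearl _)); apply: eq_bigr => u _.
  by rewrite (linear_sums (pure_linearr _)).
- rewrite free_he counitE theta_mapU (linear_sums (@he_linear _ W)).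
  case: (eqVneq a e) => [->|a1].
    by rewrite theta1 big_seq1 r_nil word_he eqxx.
  rewrite big_seq big1 // => w wa; rewrite word_he.
  have w0 : w != [::] by apply: contraTneq wa => ->; exact: theta_nil.
  by rewrite (negPf (r_neq0 w0)).
Qed.

End ThetaMorphism.

Lemma theta_iso : (forall a b, prod a b = << op a b >>) -> bialg_iso H W.
Proof.
move=> prodE; exists (theta_map id); first exact: theta_bijective.
apply: theta_map_morphism => // a b; rewrite prodE !theta_mapU.
rewrite (sum_theta_op (fun w => << w >> : W)) (linear_sums ((hm_bilinear W).1 _)).
apply: eq_bigr => u _; rewrite (linear_sums ((hm_bilinear W).2 _)).
by apply: eq_bigr => v _; rewrite word_hm.
Qed.

(** Reversing the words of [theta] gives an antimorphism for [op], hence a morphism for the opposite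
    product. *)
Lemma theta_iso_op : (forall a b, prod a b = << op b a >>) -> bialg_iso H W.
Proof.
move=> prodE; pose rv : {malg K[seq letter]} -> {malg K[seq letter]} :=
  mlin (fun w => << rev w >>).
have rvU w : rv << w >> = << rev w >> by exact: mlinU.
have rvL : linear rv by exact: mlin_linear.
have rvK : involutive rv.
  apply: malg_ext; [exact: (linear_comp rvL rvL) | by [] | move=> w].
  by rewrite !rvU revK.
have th_rv : theta_map rev =1 rv \o mlin (fun a => \sum_(w <- theta a) << w >>).
  apply: malg_ext; [exact: mlin_linear | exact: (linear_comp (mlin_linear _) rvL) | move=> a].
  rewrite theta_mapU /= mlinU (linear_sums rvL).
  by apply: eq_bigr => w _; rewrite rvU.
exists (theta_map rev).
  apply: (eq_bij _ (fsym th_rv)).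
  by apply: bij_comp (theta_bijective K); exists rv.
apply: theta_map_morphism => // [w|V w F|a b].
- by apply: contraNneq => /(congr1 rev); rewrite revK => ->.
- exact: sum_splits_rev.
rewrite prodE !theta_mapU (sum_theta_op (fun w => << rev w >> : W)) exchange_big.
rewrite (linear_sums ((hm_bilinear W).1 _)).
apply: eq_bigr => u _; rewrite (linear_sums ((hm_bilinear W).2 _)).
by apply: eq_bigr => v _; rewrite word_hm rev_cat.
Qed.

End Coproducts.
End Factorization.

(* The cuts beyond [a] have a product as left factor, which [F] neglects.     *)
Lemma cut_op_of_full (T : choiceType) (op : T -> T -> T) (e : T)
    (cut full : T -> seq (T * T)) (V : nmodType) (F : T -> T -> V) a b :
  right_id e op -> (forall p, p \in cut a -> p.1 != e) ->
  (forall G : T -> T -> V, \sum_(p <- cut (op a b)) G p.1 p.2 =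
     \sum_(p <- cut a) \sum_(q <- full b) G (op p.1 q.1) (op p.2 q.2)) ->
  (forall G : T -> V, \sum_(q <- full b | q.1 == e) G q.2 = G b) ->
  (forall x y, ~~ irreducible op e x -> F x y = 0) ->
  \sum_(p <- cut (op a b)) F p.1 p.2 = \sum_(p <- cut a) F p.1 (op p.2 b).
Proof.
move=> op1r cut_neq1 cutM full1 F0; rewrite cutM big_seq [RHS]big_seq.
apply: eq_bigr => p pa; rewrite (bigID (fun q => q.1 == e)) /= [X in _ + X]big1 ?addr0.
  under eq_bigr => q /eqP q1 do rewrite q1 op1r.
  exact: (full1 (fun y => F p.1 (op p.2 y))).
by move=> q q1; apply/F0/irreducible_op => //; exact: cut_neq1.
Qed.

(** * Couplings and set partitions *)

Section Couplings.
Variable T : Type.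
Local Notation word := (seq T).
Implicit Types (a b c : word) (p q r : seq word).

Fixpoint picks (U : Type) (s : seq U) : seq (U * seq U) :=
  if s is x :: s' then (x, s') :: [seq (y.1, x :: y.2) | y <- picks s'] else [::].

(* The atoms of the terms of the coupling product of two words, whose atoms   *)
(* are [p] and [q].                                                           *)
Fixpoint couplings p q : seq (seq word) :=
  if p is a :: p' then
    [seq a :: r | r <- couplings p' q] ++
    flatten [seq [seq (x.1 ++ a) :: r | r <- couplings p' x.2] | x <- picks q]
  else [:: q].

(* One term for each set partition of [p], whose blocks are concatenated in   *)
(* decreasing order.                                                          *)
Fixpoint merges p : seq (seq word) :=
  if p is a :: p' then flatten [seq couplings [:: a] q | q <- merges p'] else [:: [::]].

Arguments picks : simpl never.
Arguments couplings : simpl never.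
Arguments merges : simpl never.

Variable V : nmodType.

Lemma sum_picks_cons (U : Type) (x : U) s (F : U * seq U -> V) :
  \sum_(y <- picks (x :: s)) F y = F (x, s) + \sum_(y <- picks s) F (y.1, x :: y.2).
Proof. by rewrite [picks _]/= big_cons big_map. Qed.

Lemma sum_picksC (U : Type) (s : seq U) (F : U -> U -> seq U -> V) :
  \sum_(x <- picks s) \sum_(y <- picks x.2) F x.1 y.1 y.2 =
  \sum_(x <- picks s) \sum_(y <- picks x.2) F y.1 x.1 y.2.
Proof.
elim: s F => [|z s IH] F; first by rewrite !big_nil.
rewrite !sum_picks_cons /=.
under [X in _ + X = _]eq_bigr do rewrite sum_picks_cons.
under [X in _ = _ + X]eq_bigr do rewrite sum_picks_cons.
rewrite !big_split /= (IH (fun u v t => F u v (z :: t))) !addrA.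
by congr (_ + _); rewrite addrC.
Qed.

Lemma sum_couplings_cons a p q (F : seq word -> V) :
  \sum_(r <- couplings (a :: p) q) F r =
  \sum_(r <- couplings p q) F (a :: r) +
  \sum_(x <- picks q) \sum_(r <- couplings p x.2) F ((x.1 ++ a) :: r).
Proof.
rewrite [couplings _ _]/= big_cat big_map big_flatten big_map; congr (_ + _).
by apply: eq_bigr => x _; rewrite big_map.
Qed.

Lemma sum_couplings_nil q (F : seq word -> V) : \sum_(r <- couplings [::] q) F r = F q.
Proof. exact: big_seq1. Qed.

Lemma sum_couplings1 a q (F : seq word -> V) :
  \sum_(r <- couplings [:: a] q) F r =
  F (a :: q) + \sum_(x <- picks q) F ((x.1 ++ a) :: x.2).
Proof.
rewrite sum_couplings_cons sum_couplings_nil; congr (_ + _).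
by apply: eq_bigr => x _; rewrite sum_couplings_nil.
Qed.

(** An atom of a coupling is an atom of [q] left alone, an atom of [p] left alone, or an atom of [p]
    preceded by one of [q]. *)
Lemma sum_picks_couplings p q (F : word -> seq word -> V) :
  \sum_(r <- couplings p q) \sum_(x <- picks r) F x.1 x.2 =
  \sum_(x <- picks q) \sum_(r <- couplings p x.2) F x.1 r +
  \sum_(y <- picks p) (\sum_(r <- couplings y.2 q) F y.1 r +
    \sum_(x <- picks q) \sum_(r <- couplings y.2 x.2) F (x.1 ++ y.1) r).
Proof.
elim: p q F => [|c p IH] q F.
  rewrite sum_couplings_nil big_nil addr0; apply: eq_bigr => x _.
  by rewrite sum_couplings_nil.
(* The atom [c] is left alone in [A], [B], [C], [D] and receives an atom of [q] in [E], [G], [J],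
   [L]. Within each group the picked atom is, in this order, the one containing [c], one of [q],
   another one of [p] alone, another one of [p] with an atom of [q] in front. *)
pose A := \sum_(r <- couplings p q) F c r.
pose B := \sum_(x <- picks q) \sum_(r <- couplings p x.2) F x.1 (c :: r).
pose C := \sum_(y <- picks p) \sum_(r <- couplings y.2 q) F y.1 (c :: r).
pose D := \sum_(y <- picks p) \sum_(x <- picks q) \sum_(r <- couplings y.2 x.2)
  F (x.1 ++ y.1) (c :: r).
pose E := \sum_(x <- picks q) \sum_(r <- couplings p x.2) F (x.1 ++ c) r.
pose G := \sum_(x <- picks q) \sum_(y <- picks x.2) \sum_(r <- couplings p y.2)
  F x.1 ((y.1 ++ c) :: r).
pose J := \sum_(y <- picks p) \sum_(x <- picks q) \sum_(r <- couplings y.2 x.2)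
  F y.1 ((x.1 ++ c) :: r).
pose L := \sum_(y <- picks p) \sum_(x <- picks q) \sum_(z <- picks x.2)
  \sum_(r <- couplings y.2 z.2) F (x.1 ++ y.1) ((z.1 ++ c) :: r).
transitivity ((A + (B + (C + D))) + (E + (G + (J + L)))).
  rewrite sum_couplings_cons; congr (_ + _).
    under eq_bigr do rewrite sum_picks_cons.
    by rewrite big_split (IH q (fun b r => F b (c :: r))) big_split.
  under eq_bigr => x _ do under eq_bigr do rewrite sum_picks_cons.
  under eq_bigr => x _ do
    rewrite big_split (IH x.2 (fun b r => F b ((x.1 ++ c) :: r))) big_split.
  rewrite !big_split /=; congr (_ + (_ + (_ + _))).
  - by rewrite (sum_picksC q (fun u v t => \sum_(r <- couplings p t) F v ((u ++ c) :: r))).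
  - by rewrite exchange_big.
  rewrite exchange_big; apply: eq_bigr => y _.
  by rewrite (sum_picksC q (fun u v t => \sum_(r <- couplings y.2 t) F (v ++ y.1) ((u ++ c) :: r))).
transitivity ((B + G) + ((A + E) + ((C + J) + (D + L)))).
  by rewrite addrACA [X in _ + X]addrACA [X in _ + (_ + X)]addrACA addrCA.
congr (_ + _).
  by under [RHS]eq_bigr => x _ do rewrite sum_couplings_cons; rewrite big_split.
rewrite [in RHS]sum_picks_cons /=; congr (_ + _).
under [RHS]eq_bigr => y _.
  rewrite sum_couplings_cons.
  under [X in _ + X]eq_bigr => x _ do rewrite sum_couplings_cons.
  rewrite big_split; over.
by rewrite !big_split.
Qed.

(** Associativity of coupling when the left factor is a single atom: what may be put in front of [a]
    is given by [sum_picks_couplings]. *)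
Lemma sum_couplings_assoc a p q (F : seq word -> V) :
  \sum_(r <- couplings p q) \sum_(t <- couplings [:: a] r) F t =
  \sum_(r <- couplings [:: a] p) \sum_(t <- couplings r q) F t.
Proof.
under eq_bigr do rewrite sum_couplings1.
rewrite big_split (sum_picks_couplings p q (fun b r => F ((b ++ a) :: r))) /=.
rewrite sum_couplings1 sum_couplings_cons -addrA; congr (_ + (_ + _)).
apply: eq_bigr => y _; rewrite sum_couplings_cons; congr (_ + _).
by apply: eq_bigr => x _; apply: eq_bigr => r _; rewrite catA.
Qed.

Lemma sum_merges_cons a p (F : seq word -> V) :
  \sum_(r <- merges (a :: p)) F r = \sum_(q <- merges p) \sum_(r <- couplings [:: a] q) F r.
Proof. by rewrite [merges _]/= big_flatten big_map. Qed.

(** A set partition of [p ++ q] restricts to set partitions of [p] and of [q], and is recovered from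
    them by a partial matching between their blocks, that is, by a coupling. *)
Lemma sum_merges_cat p q (F : seq word -> V) :
  \sum_(r <- merges (p ++ q)) F r =
  \sum_(s <- merges p) \sum_(t <- merges q) \sum_(r <- couplings s t) F r.
Proof.
elim: p F => [|a p IH] F.
  by rewrite big_seq1; apply: eq_bigr => t _; rewrite sum_couplings_nil.
rewrite cat_cons !sum_merges_cons IH; apply: eq_bigr => s _.
rewrite [RHS]exchange_big; apply: eq_bigr => t _.
exact: sum_couplings_assoc.
Qed.

Lemma sum_picks_splits (U : Type) (s : seq U) (F : U -> seq U -> seq U -> V) :
  \sum_(x <- picks s) \sum_(y <- splits x.2) F x.1 y.1 y.2 =
  \sum_(y <- splits s) \sum_(x <- picks y.1) F x.1 x.2 y.2.
Proof.
elim: s F => [|z s IH] F; first by rewrite sum_splits0 !big_nil.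
rewrite sum_picks_cons sum_splits_cons /=.
under [X in _ + X = _]eq_bigr do rewrite sum_splits_cons.
rewrite big_split (IH (fun x u v => F x (z :: u) v)) (IH (fun x u v => F x u (z :: v))).
under [X in _ = X + _]eq_bigr do rewrite sum_picks_cons.
by rewrite big_split addrA.
Qed.

(** Distributing the blocks of a set partition over two parts distributes the atoms and leaves a set
    partition of each part. *)
Lemma sum_merges_splits p (F : seq word -> seq word -> V) :
  \sum_(r <- merges p) \sum_(x <- splits r) F x.1 x.2 =
  \sum_(y <- splits p) \sum_(s <- merges y.1) \sum_(t <- merges y.2) F s t.
Proof.
elim: p F => [|a p IH] F; first by rewrite sum_splits0 !big_seq1.
rewrite sum_merges_cons sum_splits_cons /= -big_split /=.
(* The ways of adding [a] to a split [(s, t)] of the blocks: on the left or on the right, alone or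
   at the end of an existing block. *)
pose G s t := \sum_(r <- couplings [:: a] s) F r t + \sum_(r <- couplings [:: a] t) F s r.
transitivity (\sum_(q <- merges p) \sum_(x <- splits q) G x.1 x.2).
  apply: eq_bigr => q _; rewrite sum_couplings1 sum_splits_cons.
  under [X in _ + X = _]eq_bigr do rewrite sum_splits_cons.
  rewrite big_split /= (sum_picks_splits q (fun b u v => F ((b ++ a) :: u) v)).
  under [X in _ + (_ + X) = _]eq_bigr => x _ do
    rewrite (sum_splitsC x.2 (fun u v => F u ((x.1 ++ a) :: v))).
  rewrite (sum_picks_splits q (fun b u v => F v ((b ++ a) :: u))).
  rewrite (sum_splitsC q (fun u v => \sum_(x <- picks u) F v ((x.1 ++ a) :: x.2))).
  rewrite addrACA -!big_split; apply: eq_bigr => y _ /=.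
  by rewrite /G !sum_couplings1.
rewrite (IH G); apply: eq_bigr => y _; rewrite /G /=.
under eq_bigr do rewrite big_split.
rewrite big_split /= sum_merges_cons; congr (_ + _); apply: eq_bigr => s _.
  by rewrite exchange_big.
by rewrite sum_merges_cons.
Qed.

End Couplings.

Section CouplingMembers.
Variable T : eqType.
Implicit Types (a : seq T) (p q r : seq (seq T)).

Lemma perm_picks (U : eqType) (s : seq U) x : x \in picks s -> perm_eq (x.1 :: x.2) s.
Proof.
elim: s x => [|z s IH] x //=; rewrite inE => /orP[/eqP -> //|/mapP[y /IH ys ->]] /=.
by rewrite (perm_catCA [:: y.1] [:: z] y.2) /= perm_cons.
Qed.

Lemma mem_couplings1 a q r : r \in couplings [:: a] q ->
  r = a :: q \/ exists2 x, x \in picks q & r = (x.1 ++ a) :: x.2.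
Proof.
rewrite /= inE => /orP[/eqP|]; first by left.
move=> /flattenP[_ /mapP[x xq ->]]; rewrite inE => /eqP ->; right; by exists x.
Qed.

Lemma perm_merges p r : r \in merges p -> perm_eq (flatten r) (flatten p).
Proof.
elim: p r => [|a p IH] r /=; first by rewrite inE => /eqP ->.
move=> /flattenP[_ /mapP[q /IH qp ->]] /mem_couplings1[->|[x xq ->]] /=.
  by rewrite perm_cat2l.
rewrite -catA perm_catCA perm_cat2l -(permPr qp).
by have /perm_flatten := perm_picks xq.
Qed.

(** The first term is the partition into singletons; every other one has fewer blocks. This makes
    merging unitriangular. *)
Lemma merges_head p : exists2 s, merges p = p :: s & {in s, forall r, size r < size p}%N.
Proof.
elim: p => [|a p [s ps s_lt]]; first by exists [::].
rewrite /= ps /=.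
exists (flatten [seq [:: (x.1 ++ a) :: x.2] | x <- picks p] ++
        flatten [seq couplings [:: a] q | q <- s]) => // r.
rewrite mem_cat => /orP[|] /flattenP[_ /mapP[x xs ->]].
  by rewrite inE => /eqP -> /=; have /perm_size /= -> := perm_picks xs.
have lt_x := s_lt _ xs; move=> /mem_couplings1[->|[y yx ->]] //=.
by have /perm_size /= -> := perm_picks yx; rewrite ltnW.
Qed.

Lemma merges_map (U : Type) (f : T -> U) p :
  merges (map (map f) p) = [seq map (map f) r | r <- merges p].
Proof.
have picks_map (X Y : Type) (g : X -> Y) s :
    picks (map g s) = [seq (g x.1, map g x.2) | x <- picks s].
  by elim: s => [|x s IH] //=; rewrite IH -!map_comp.
elim: p => [|a p IH] //=; rewrite IH -map_comp map_flatten -map_comp.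
congr flatten; apply: eq_map => q /=; rewrite picks_map map_flatten -!map_comp; congr (_ :: flatten _).
by apply: eq_map => x /=; rewrite map_cat.
Qed.

End CouplingMembers.

(** * Standardization and atoms *)

Section Standardization.
Implicit Types (u v w : seq nat).

Definition below w x := count (ltn^~ x) w.

Definition mono_on (f : nat -> nat) w := {in w &, forall x y, (f x < f y)%N = (x < y)%N}.

Lemma mono_onS f u w : {subset u <= w} -> mono_on f w -> mono_on f u.
Proof. by move=> sub fw x y /sub xw /sub yw; exact: fw. Qed.

Lemma stE w : st w = map (fun x => (below w x).+1) w. Proof. by []. Qed.

Lemma size_st w : size (st w) = size w. Proof. exact: size_map. Qed.

Lemma below_le w x y : (x <= y)%N -> (below w x <= below w y)%N.
Proof. by move=> xy; apply: sub_count => z /= zx; exact: leq_trans zx xy. Qed.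

Lemma below_lt w x y : x \in w -> (x < y)%N -> (below w x < below w y)%N.
Proof.
rewrite /below; elim: w => [|z w IH] //=; rewrite inE => /orP[/eqP <- | xw] xy.
  by rewrite ltnn xy add0n add1n ltnS; exact: below_le (ltnW xy).
have := IH xw xy; case: (ltnP z x) => [zx | _]; last by rewrite add0n => lt; apply: ltn_addl.
by rewrite (ltn_trans zx xy) ltn_add2l.
Qed.

Lemma st_mono w : mono_on (fun x => (below w x).+1) w.
Proof.
move=> x y xw yw; rewrite ltnS; apply/idP/idP => [|]; last exact: below_lt.
by apply: contraTltn => yx; rewrite -leqNgt; exact: below_le.
Qed.

Lemma mono_on_inj f w : mono_on f w -> {in w &, injective f}.
Proof.
move=> fM x y xw yw fxy; case: (ltngtP x y) => // lt.
  by move: lt; rewrite -fM // fxy ltnn.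
by move: lt; rewrite -fM // fxy ltnn.
Qed.

Lemma st_map f w : mono_on f w -> st (map f w) = st w.
Proof.
move=> fM; rewrite !stE -map_comp; apply/eq_in_map => x xw /=; congr _.+1.
by rewrite /below count_map; apply: eq_in_count => y yw /=; rewrite fM.
Qed.

Lemma st_st w : st (st w) = st w. Proof. by rewrite [X in st X]stE st_map //; exact: st_mono. Qed.

Lemma st_uniq w : uniq w -> uniq (st w).
Proof. by move=> uw; rewrite stE map_inj_in_uniq //; exact/mono_on_inj/st_mono. Qed.

Lemma is_perm_wordP w : reflect (uniq w /\ forall x, (x \in w) = (0 < x <= size w)%N) (is_perm_word w).
Proof.
apply: (iffP idP) => [pw | [uw wE]].
  split=> [|x]; first by rewrite (perm_uniq pw) iota_uniq.
  by rewrite (perm_mem pw) mem_iota add1n ltnS.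
apply: uniq_perm => // [|x]; first exact: iota_uniq.
by rewrite wE mem_iota add1n ltnS.
Qed.

Lemma is_perm_word_bounded w : uniq w -> {in w, forall x, 0 < x <= size w}%N -> is_perm_word w.
Proof.
move=> uw wle; have sub : {subset w <= iota 1 (size w)}.
  by move=> x /wle; rewrite mem_iota add1n ltnS.
apply: uniq_perm => //; first exact: iota_uniq.
by have [] := uniq_min_size uw sub; rewrite ?size_iota.
Qed.

Lemma below_lt_size w x : x \in w -> (below w x < size w)%N.
Proof.
move=> xw; rewrite -(count_predC (ltn^~ x) w) -addn1 leq_add2l -has_count.
by apply/hasP; exists x => //=; rewrite ltnn.
Qed.

Lemma st_perm_word w : uniq w -> is_perm_word (st w).
Proof.
move=> uw; apply: is_perm_word_bounded; first exact: st_uniq.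
by rewrite size_st => _ /mapP[x xw ->] /=; exact: below_lt_size.
Qed.

Lemma st_id w : is_perm_word w -> st w = w.
Proof.
move=> pw; rewrite stE -[RHS]map_id; apply/eq_in_map => x.
rewrite (perm_mem pw) mem_iota add1n ltnS => /andP[x0 xw].
rewrite /below (permP pw) -(subnKC (leq_trans (leq_pred x) xw)) iotaD count_cat.
rewrite (eqP (_ : count _ _ == size (iota 1 x.-1))); last first.
  by rewrite -all_count; apply/allP => y; rewrite mem_iota /=; lia.
rewrite (eqP (_ : count _ _ == 0%N)) ?size_iota ?addn0 ?prednK //.
by rewrite -leqn0 leqNgt -has_count; apply/hasPn => y; rewrite mem_iota /=; lia.
Qed.

Lemma st_perm u v : perm_eq u v -> forall x, below u x = below v x.
Proof. by move/permP => uv x; exact: uv. Qed.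

Lemma up_mono n w : mono_on (addn^~ n) w.
Proof. by move=> x y _ _; rewrite ltn_add2r. Qed.

Lemma st_up n w : st (up n w) = st w.
Proof. exact: (st_map (@up_mono n w)). Qed.

Lemma up_up n m w : up n (up m w) = up (m + n) w.
Proof. by rewrite /up -map_comp; apply: eq_map => x /=; rewrite addnA. Qed.

Lemma st_cat u v : {in u & v, forall x y, (x < y)%N} ->
  st (u ++ v) = st u ++ up (size u) (st v).
Proof.
move=> uv; rewrite stE map_cat; congr (_ ++ _); last rewrite /up -map_comp.
  apply/eq_in_map => x xu; congr _.+1; rewrite /below count_cat.
  rewrite [X in (_ + X)%N](eqP (_ : count _ v == 0%N)) ?addn0 //.
  by rewrite -leqn0 leqNgt -has_count; apply/hasPn => y yv /=; rewrite -leqNgt ltnW ?uv.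
apply/eq_in_map => x xv /=; rewrite addSn; congr _.+1; rewrite /below count_cat addnC; congr addn.
by apply/eqP; rewrite -all_count; apply/allP => y yu; exact: uv.
Qed.

End Standardization.

Section Atoms.
Implicit Types (a b u v w : seq nat) (p q : seq (seq nat)).

Lemma flatten_atoms w : flatten (atoms w) = w.
Proof.
elim: w => [|x w IH] //=; case: ifP => [_|/negP w1] /=; first by rewrite IH.
by case: (atoms w) IH => [|b p] /= <-.
Qed.

Lemma atoms_nil w : atoms w = [::] -> w = [::].
Proof. by move=> w0; rewrite -(flatten_atoms w) w0. Qed.

Lemma atoms_map f w : mono_on f w -> atoms (map f w) = map (map f) (atoms w).
Proof.
elim: w => [|x w IH] //= fM.
have sub : {subset w <= x :: w} by move=> y yw; rewrite inE yw orbT.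
rewrite (IH (mono_onS sub fM)) all_map.
rewrite (_ : all (preim f (ltn (f x))) w = all (ltn x) w); last first.
  by apply: eq_in_all => y yw /=; rewrite fM // ?mem_head ?sub.
by case: ifP => //= _; case: (atoms w).
Qed.

Lemma atoms_cat u w : {in u & w, forall x y, (x < y)%N} -> atoms (u ++ w) = atoms u ++ atoms w.
Proof.
elim: u => [|x u IH] //= xuw; rewrite all_cat IH; last first.
  by move=> y z yu zw; apply: xuw; rewrite // inE yu orbT.
have -> : all (ltn x) w by apply/allP => y yw; apply: xuw; rewrite ?mem_head.
rewrite andbT; case: ifP => //=.
by case Eu: (atoms u) => [|b p] //=; rewrite (atoms_nil Eu).
Qed.

Definition is_atom a := atoms a == [:: a].

Lemma is_atom_nil a : is_atom a -> a != [::]. Proof. by case: a. Qed.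

Lemma atoms_atom a w : is_atom a -> all (ltn (last 0%N a)) w -> atoms (a ++ w) = a :: atoms w.
Proof.
elim: a => [|x a IH] //; case: (eqVneq a [::]) => [-> /= _ -> //|a0].
rewrite /is_atom /=; case: ifP => [_ /eqP[/esym/eqP]|xa]; first by rewrite (negPf a0).
case Ea: (atoms a) => [|c p]; first by rewrite (atoms_nil Ea) in a0.
move=> /eqP[ca p0]; rewrite all_cat xa /= => aw.
rewrite IH //; first by rewrite /is_atom Ea ca p0.
by case: (a) a0 aw.
Qed.

(** These are exactly the values of [atoms], by [atoms_flatten] and [atomic_atoms]. An atom ends
    with its smallest letter, so only its last letter has to be compared with the later ones. *)
Definition atomic p := all is_atom p && pairwise (fun a b => all (ltn (last 0%N a)) b) p.

Lemma atoms_flatten p : atomic p -> atoms (flatten p) = p.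
Proof.
elim: p => [|a p IH] // /andP[/= /andP[ap allp] /andP[a_lt pp]].
rewrite atoms_atom // ?IH //; first by apply/andP.
by apply/allP => x /flattenP[b bp xb]; exact: (allP (allP a_lt _ bp)).
Qed.

Lemma atomic_subseq p q : subseq p q -> atomic q -> atomic p.
Proof.
move=> pq /andP[aq wq]; apply/andP; split; last exact: subseq_pairwise pq wq.
by apply/allP => x /(mem_subseq pq)/(allP aq).
Qed.

Lemma atomic_atoms w : atomic (atoms w).
Proof.
elim: w => [|x w IH] //=; case: ifP => [xw | /negbT xw].
  have /andP[aw pw] := IH; apply/andP; split; first by rewrite /= aw /is_atom /= eqxx.
  rewrite /= pw andbT; apply/allP => b bw; apply/allP => y yb; apply: (allP xw).
  by rewrite -(flatten_atoms w); apply/flattenP; exists b.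
case Ew: (atoms w) IH => [|b p]; first by rewrite (atoms_nil Ew) in xw.
move=> /andP[/= /andP[ab ap] /andP[b_lt pp]]; apply/andP; split => /=; rewrite ?ap ?pp ?andbT; last first.
  by case: (b) (is_atom_nil ab) b_lt.
have b0 := is_atom_nil ab.
rewrite /is_atom /= (eqP ab).
case: ifP => // xb; move: xw; rewrite -(flatten_atoms w) Ew /= all_cat xb /= => /negP[].
apply/allP => y /flattenP[c cp yc].
(* If [x] is below all of [b], it is below the last letter of [b], hence below everything that
   follows, against the choice of [x]. *)
have lt1 : (x < last 0%N b)%N by case: (b) b0 xb => // z c' _ /allP; apply; exact: mem_last.
exact: ltn_trans lt1 (allP (allP b_lt _ cp) _ yc).
Qed.

(** The last letter of [a] is below every letter of [b], so no letter of [b] becomes an absolute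
    ascent. Hence a later atom put in front of an earlier one yields an atom. *)
Lemma is_atom_cat b a : is_atom a -> all (ltn (last 0%N a)) b -> is_atom (b ++ a).
Proof.
move=> aa; elim: b => [|x b IH] //= /andP[lt_x lt_b].
rewrite /is_atom /= (eqP (IH lt_b)); case: ifP => // /allP/(_ (last 0%N a)).
case: (a) (is_atom_nil aa) lt_x => //= y c _ lt_x; rewrite mem_cat mem_last orbT => /(_ isT); lia.
Qed.

Lemma last_atom_cat b a : is_atom a -> last 0%N (b ++ a) = last 0%N a.
Proof. by case: a => // x a _; rewrite last_cat. Qed.

Lemma atomic_couplings1 a q r : atomic (a :: q) -> r \in couplings [:: a] q -> atomic r.
Proof.
move=> aq /mem_couplings1[-> // | [x xq ->]].
have xq' := perm_picks xq.
have sub : subseq x.2 q.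
  elim: (q) x xq {xq'} => [|z s IH] x //=; rewrite inE => /orP[/eqP -> | /mapP[y /IH ys ->]].
    exact: subseq_cons.
  by rewrite /= eqxx.
move: aq => /andP[/= /andP[aa aq] /andP[a_lt pq]].
have x1q : x.1 \in q by rewrite -(perm_mem xq') mem_head.
have : atomic x.2 by apply: atomic_subseq sub _; exact/andP.
move=> /andP[ax px]; apply/andP; split => /=.
  by rewrite is_atom_cat ?ax //; exact: (allP a_lt).
by rewrite px andbT last_atom_cat //; apply/allP => b /(mem_subseq sub)/(allP a_lt).
Qed.

Lemma atomic_merges p r : atomic p -> r \in merges p -> atomic r.
Proof.
elim: p r => [|a p IH] r /=; first by rewrite inE => _ /eqP ->.
move=> /andP[/= /andP[aa ap] /andP[a_lt pp]] /flattenP[_ /mapP[q qp ->]].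
apply: atomic_couplings1; have aq : atomic q by apply: IH qp; exact/andP.
case/andP: aq => aq pq; apply/andP; split; rewrite /= ?aa ?aq ?pq ?andbT //.
apply/allP => b bq; apply/allP => x xb.
have : x \in flatten p by rewrite -(perm_mem (perm_merges qp)); apply/flattenP; exists b.
by case/flattenP => c cp xc; exact: (allP (allP a_lt _ cp)).
Qed.

End Atoms.

(** * Sums over subsets and functions as sums over lists *)

Section AllSequences.

Fixpoint seqs (X : Type) n (r : seq X) : seq (seq X) :=
  if n is m.+1 then [seq x :: s | x <- r, s <- seqs m r] else [:: [::]].

Lemma mem_seqs (X : eqType) n (r s : seq X) :
  (s \in seqs n r) = (size s == n) && all [in r] s.
Proof.
elim: n s => [|n IH] s; first by case: s.
apply/allpairsP/idP => [[[x t] /= [xr]]|].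
  by rewrite IH => /andP[/eqP <- tr] ->; rewrite /= eqxx xr.
by case: s => // x s /= /andP[ss /andP[xr sr]]; exists (x, s); rewrite IH -eqSS ss.
Qed.

Lemma uniq_seqs (X : eqType) n (r : seq X) : uniq r -> uniq (seqs n r).
Proof.
move=> ur; elim: n => [|n IH] //=; apply: allpairs_uniq => //.
by move=> [x s] [y t] _ _ [-> ->].
Qed.

Variable V : nmodType.

Lemma sum_seqsS (X : Type) n (r : seq X) (F : seq X -> V) :
  \sum_(s <- seqs n.+1 r) F s = \sum_(x <- r) \sum_(s <- seqs n r) F (x :: s).
Proof. by rewrite /= big_allpairs_dep. Qed.

(** Functions on ['I_n] are replaced by the lists of their values, on which one can argue by
    induction. *)
Lemma sum_ffun_seqs (X : finType) n (P : pred (seq X)) (F : seq X -> V) :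
  \sum_(f : {ffun 'I_n -> X} | P (codom f)) F (codom f) =
  \sum_(s <- seqs n (enum X) | P s) F s.
Proof.
rewrite -(big_map (fun f : {ffun 'I_n -> X} => codom f) P F); apply: perm_big.
apply: uniq_perm.
- rewrite map_inj_uniq ?index_enum_uniq // => f g fg; apply/ffunP => i.
  have := congr1 (fun s => nth (f i) s i) fg.
  have E (h : {ffun 'I_n -> X}) : codom h = map h (enum 'I_n) by [].
  by rewrite !E !(nth_map i) -?enumT ?size_enum_ord // !nth_ord_enum.
- exact: uniq_seqs (enum_uniq _).
move=> s; rewrite mem_seqs; apply/mapP/idP => [[f _ ->]|/andP[/eqP sn _]].
  by rewrite size_codom card_ord eqxx; apply/allP => x _ /=; rewrite mem_enum.
case: n sn => [|n] sn.
  case: s sn => // _; have f0 : 'I_0 -> X by case.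
  by exists [ffun i => f0 i]; rewrite ?mem_index_enum // /codom /image_mem enum_ord0.
case: s sn => // x s sn; exists [ffun i : 'I_n.+1 => nth x (x :: s) i].
  exact: mem_index_enum.
apply: (@eq_from_nth _ x); first by rewrite size_codom card_ord.
rewrite sn => i lt_in; rewrite (nth_map (Ordinal lt_in)) ?size_enum_ord //.
by rewrite ffunE nth_enum_ord.
Qed.

Lemma sum_set_seqs n (F : seq bool -> V) :
  \sum_(I : {set 'I_n}) F [seq i \in I | i <- enum 'I_n] =
  \sum_(s <- seqs n [:: true; false]) F s.
Proof.
have -> : seqs n [:: true; false] = seqs n (enum {: bool}) by rewrite enumT unlock.
rewrite -(sum_ffun_seqs n xpredT F) (reindex (fun f : {ffun 'I_n -> bool} => [set i | f i])) /=.
  by apply: eq_bigr => f _; congr F; apply: eq_map => i; rewrite inE.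
exists (fun I : {set 'I_n} => [ffun i => i \in I]) => [f _|I _]; last by apply/setP => i; rewrite inE ffunE.
by apply/ffunP => i; rewrite ffunE inE.
Qed.

Lemma enum_mask n (I : {set 'I_n}) :
  enum I = mask [seq i \in I | i <- enum 'I_n] (enum 'I_n).
Proof. by rewrite -filter_mask enumT. Qed.

Lemma map_nth_mask (X : Type) (d : X) s (I : {set 'I_(size s)}) :
  [seq nth d s (val i) | i <- enum I] = mask [seq i \in I | i <- enum 'I_(size s)] s.
Proof.
rewrite enum_mask map_mask; congr mask.
by rewrite -[RHS](mkseq_nth d) /mkseq -val_enum_ord -[RHS]map_comp.
Qed.

Lemma sum_masks_splits (X : Type) (s : seq X) (F : seq X -> seq X -> V) :
  \sum_(m <- seqs (size s) [:: true; false]) F (mask m s) (mask (map negb m) s) =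
  \sum_(p <- splits s) F p.1 p.2.
Proof.
elim: s F => [|x s IH] F; first by rewrite !big_seq1.
rewrite sum_seqsS sum_splits_cons !big_cons big_nil addr0 /=.
by rewrite (IH (fun u v => F (x :: u) v)) (IH (fun u v => F u (x :: v))).
Qed.

Lemma sum_sets_splits (X : Type) (d : X) (s : seq X) (F : seq X -> seq X -> V) :
  \sum_(I : {set 'I_(size s)})
    F [seq nth d s (val i) | i <- enum I] [seq nth d s (val i) | i <- enum (~: I)] =
  \sum_(p <- splits s) F p.1 p.2.
Proof.
rewrite -sum_masks_splits -(sum_set_seqs _ (fun m => F (mask m s) (mask (map negb m) s))).
apply: eq_bigr => I _; rewrite !map_nth_mask -map_comp.
by congr (F _ (mask _ s)); apply: eq_map => i /=; rewrite inE.
Qed.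

End AllSequences.

(** * Permutations *)

Lemma enum_option (T : finType) : enum {: option T} = None :: map Some (enum T).
Proof. by rewrite !enumT [in LHS]unlock. Qed.

Section CouplingWords.
Variables (m : nat) (bf : 'I_m -> seq nat) (V : nmodType).
Implicit Types (p : seq (seq nat)) (s : seq (option 'I_m)) (js : seq 'I_m).

(** [s] gives for each atom the index of the block put in front of it, if any; [js] are the indices
    still available. *)
Definition matching js s := uniq (pmap id s) && all (oapp [in js] true) s.

Definition matching_word p js s : seq nat :=
  flatten [seq oapp bf [::] x.1 ++ x.2 | x <- zip s p] ++
  flatten [seq bf j | j <- js & Some j \notin s].

Lemma picks_map_uniq js : uniq js ->
  picks (map bf js) = [seq (bf j, map bf (filter (predC1 j) js)) | j <- js].
Proof.
elim: js => [|j js IH] //= /andP[j_js ujs]; rewrite eqxx IH // -map_comp /=.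
have -> : [seq x <- js | x != j] = js.
  by apply/all_filterP/allP => x xjs; apply: contraNneq j_js => <-.
congr (_ :: _); apply/eq_in_map => k kjs /=; congr pair.
by case: eqP j_js kjs => //= -> /negP.
Qed.

(** The first atom of [p] takes no block or some [bf j], after which [j] is no longer available. *)
Lemma sum_matchings p js (G : seq nat -> V) : uniq js ->
  \sum_(s <- seqs (size p) (enum {: option 'I_m}) | matching js s) G (matching_word p js s) =
  \sum_(q <- couplings p (map bf js)) G (flatten q).
Proof.
elim: p js G => [|a p IH] js G ujs.
  rewrite big_mkcond !big_seq1 /= /matching_word /=; congr (G (flatten (map _ _))).
  by apply/all_filterP/allP.
rewrite big_mkcond sum_seqsS sum_couplings_cons /= {1}enum_option big_cons; congr (_ + _).
  rewrite -(IH js (fun w => G (a ++ w)) ujs) [RHS]big_mkcond; apply: eq_bigr => s _.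
  rewrite /matching /=; case: ifP => // _; rewrite /matching_word /= -catA.
  by congr (G (_ ++ (_ ++ flatten (map _ _)))); apply: eq_filter => j; rewrite inE.
rewrite big_map picks_map_uniq // big_map.
have jsE : perm_eq js (filter [in js] (enum 'I_m)).
  apply: uniq_perm => // [|j]; first by rewrite filter_uniq ?enum_uniq.
  by rewrite mem_filter mem_enum andbT.
rewrite [RHS](perm_big _ jsE) /=.
rewrite big_filter big_mkcond [RHS]big_mkcond; apply: eq_bigr => j _ /=.
case: ifP => jjs; last first.
  by rewrite big1 // => s _; rewrite /matching /= jjs andbF.
rewrite -(IH (filter (predC1 j) js) (fun w => G ((bf j ++ a) ++ w))) ?filter_uniq //.
rewrite [RHS]big_mkcond; apply: eq_bigr => s _.
(* Injectivity forbids using [j] again, which amounts to removing it from [js]. *)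
have -> : matching js (Some j :: s) = matching (filter (predC1 j) js) s.
  rewrite /matching /= jjs /=.
  rewrite (_ : all (oapp [in filter (predC1 j) js] true) s =
               (j \notin pmap id s) && all (oapp [in js] true) s); last first.
    elim: s => [|[k|] s IHs] //=.
    rewrite inE mem_filter IHs /= negb_or [j == k]eq_sym !andbA; do ?bool_congr.
    by case: (k == j); case: (k \in js); rewrite ?andbF ?andbT.
  by case: (j \in _); case: (uniq _).
case: ifP => // _; rewrite /matching_word /= -catA.
congr (G (_ ++ (_ ++ flatten (map _ _)))); rewrite -filter_predI; apply: eq_filter => k /=.
by rewrite inE negb_or andbC; congr (_ && ~~ _).
Qed.

End CouplingWords.

(** * Standardized splits of permutations *)

Section PermWords.
Implicit Types (a b c : perm_word).

Lemma perm_word0 : is_perm_word [::]. Proof. by []. Qed.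
Definition p0 : perm_word := Sub [::] perm_word0.
Definition pw (w : seq nat) : perm_word := insubd p0 w.

Lemma pwK w : is_perm_word w -> val (pw w) = w.
Proof. by move=> ww; rewrite val_insubd ww. Qed.

Lemma val_pw a : pw (val a) = a. Proof. exact: valKd. Qed.

Lemma perm_vecE (K : fieldType) w : is_perm_word w -> perm_vec K w = << pw w >>.
Proof. by move=> ww; rewrite /perm_vec /pw /insubd insubT. Qed.

Lemma perm_uniqP a : uniq (val a). Proof. by case/is_perm_wordP: (valP a). Qed.

Lemma mem_perm_word a x : (x \in val a) = (0 < x <= size (val a))%N.
Proof. by case/is_perm_wordP: (valP a) => _ ->. Qed.

Definition pst w := pw (st w).

Lemma val_pst w : uniq w -> val (pst w) = st w.
Proof. by move=> uw; rewrite pwK // st_perm_word. Qed.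

Lemma pst_val a : pst (val a) = a.
Proof. by rewrite /pst st_id ?val_pw // (valP a). Qed.

Lemma pst0 w : uniq w -> (pst w == p0) = (w == [::]).
Proof. by move=> uw; rewrite -val_eqE val_pst //= -!size_eq0 size_st. Qed.

Lemma perm_word_shift a b : is_perm_word (val a ++ up (size (val a)) (val b)).
Proof.
apply: is_perm_word_bounded.
  rewrite cat_uniq perm_uniqP map_inj_uniq ?perm_uniqP ?andbT; last exact: addIn.
  apply/negP => /hasP[_ /mapP[x xb ->] xa].
  move: xb (xa : (x + size (val a))%N \in val a); rewrite !mem_perm_word; lia.
move=> x; rewrite mem_cat size_cat size_map => /orP[|/mapP[y + ->]].
  by rewrite mem_perm_word => /andP[-> xa]; exact: leq_trans xa (leq_addr _ _).
by rewrite mem_perm_word => /andP[y0 yb]; rewrite addn_gt0 y0 addnC leq_add2l.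
Qed.

Definition pshift a b : perm_word := Sub _ (perm_word_shift a b).

Lemma shift_lt a b : {in val a & up (size (val a)) (val b), forall x y, (x < y)%N}.
Proof.
move=> x _ + /mapP[y + ->]; rewrite !mem_perm_word; lia.
Qed.

Lemma atoms_shift a b :
  atoms (val (pshift a b)) = atoms (val a) ++ map (up (size (val a))) (atoms (val b)).
Proof.
rewrite /= atoms_cat; last exact: shift_lt.
by rewrite /up atoms_map //; exact: up_mono.
Qed.

Lemma pst_cat u v : uniq (u ++ v) -> {in u & v, forall x y, (x < y)%N} ->
  pst (u ++ v) = pshift (pst u) (pst v).
Proof.
move=> uuv uv; have /and3P[uu _ uv'] : [&& uniq u, ~~ has [in u] v & uniq v] by rewrite -cat_uniq.
by apply: val_inj; rewrite /= !val_pst // st_cat // size_st.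
Qed.

Lemma pst_up n w : pst (up n w) = pst w. Proof. by rewrite /pst st_up. Qed.

Definition pfull a : seq (perm_word * perm_word) :=
  [seq (pst (flatten p.1), pst (flatten p.2)) | p <- splits (atoms (val a))].

(** Keeping the first atom on the left makes the left factors nontrivial and selects one term from
    each pair of mirror terms of [pfull]. *)
Definition pcut a : seq (perm_word * perm_word) :=
  if atoms (val a) is x :: s then
    [seq (pst (flatten (x :: p.1)), pst (flatten p.2)) | p <- splits s]
  else [::].

Lemma subseq_flatten (T : eqType) (s t : seq (seq T)) :
  subseq s t -> subseq (flatten s) (flatten t).
Proof.
elim: t s => [|y t IH] [|x s] //=; first by move=> _; exact: sub0seq.
case: eqP => [-> /IH|_ /IH] st; first exact: cat_subseq.
exact: subseq_trans st (suffix_subseq _ _).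
Qed.

Lemma flatten_eq0 (s : seq (seq nat)) : atomic s -> (flatten s == [::]) = (s == [::]).
Proof. by case: s => [|[|x a] s]. Qed.

Section Standardized.
Variables (p : seq (seq nat)).
Hypotheses (ap : atomic p) (up : uniq (flatten p)).

Let ast (q : seq (seq nat)) := map (map (fun x => (below (flatten p) x).+1)) q.

Let stp : st (flatten p) = flatten (ast p).
Proof. by rewrite stE map_flatten. Qed.

Let atoms_pst : atoms (val (pst (flatten p))) = ast p.
Proof. by rewrite val_pst // stE atoms_map ?atoms_flatten //; exact: st_mono. Qed.

Let pst_ast q : subseq q p -> pst (flatten (ast q)) = pst (flatten q).
Proof.
move=> qp; rewrite /pst /ast -map_flatten st_map //.
by apply: mono_onS (@st_mono _); exact/mem_subseq/subseq_flatten.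
Qed.

(** Standardization is increasing on the letters: it sends atoms to atoms, and a subword has the
    same standardization before and after. *)
Lemma sum_pfull (V : nmodType) (F : perm_word -> perm_word -> V) :
  \sum_(q <- pfull (pst (flatten p))) F q.1 q.2 =
  \sum_(q <- splits p) F (pst (flatten q.1)) (pst (flatten q.2)).
Proof.
rewrite big_map atoms_pst splits_map big_map big_seq [RHS]big_seq.
by apply: eq_bigr => q /subseq_splits[q1 q2 _] /=; rewrite !pst_ast.
Qed.

End Standardized.

Lemma sum_pcut (V : nmodType) (F : perm_word -> perm_word -> V) x p :
    atomic (x :: p) -> uniq (flatten (x :: p)) ->
  \sum_(q <- pcut (pst (flatten (x :: p)))) F q.1 q.2 =
  \sum_(q <- splits p) F (pst (flatten (x :: q.1))) (pst (flatten q.2)).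
Proof.
move=> ap u; pose f := fun z => (below (flatten (x :: p)) z).+1.
have pst_f q : subseq q (x :: p) -> pst (flatten (map (map f) q)) = pst (flatten q).
  move=> qp; rewrite /pst -map_flatten st_map //.
  by apply: mono_onS (@st_mono _); exact/mem_subseq/subseq_flatten.
have At : atoms (val (pst (flatten (x :: p)))) = map f x :: map (map f) p.
  by rewrite val_pst // stE atoms_map ?atoms_flatten //; exact: st_mono.
rewrite /pcut At big_map splits_map big_map big_seq [RHS]big_seq.
apply: eq_bigr => q /subseq_splits[q1 q2 _] /=.
have q1x : subseq (x :: q.1) (x :: p) by rewrite /= eqxx.
have q2x : subseq q.2 (x :: p) := subseq_trans q2 (subseq_cons _ _).
by rewrite -(pst_f _ q2x); have /= -> := pst_f _ q1x.
Qed.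

Lemma uniq_atoms a p : subseq p (atoms (val a)) -> uniq (flatten p).
Proof.
move=> pa; apply: subseq_uniq (subseq_flatten pa) _.
by rewrite flatten_atoms perm_uniqP.
Qed.

Lemma pcutE a x s : atoms (val a) = x :: s ->
  pcut a = [seq (pst (flatten (x :: p.1)), pst (flatten p.2)) | p <- splits s].
Proof. by rewrite /pcut => ->. Qed.

Lemma p0_atoms a : a != p0 -> exists x s, atoms (val a) = x :: s.
Proof.
case Ea: (atoms (val a)) => [|x s]; last by exists x, s.
by rewrite -val_eqE /= (atoms_nil Ea) eqxx.
Qed.

End PermWords.

(** * Shifted concatenation with the draw coproduct *)

Section ConcatenationAlgebra.
Implicit Types (a b c : perm_word).

Definition psize a := size (val a).

Lemma pshift0 : left_id p0 pshift.
Proof. by move=> a; apply: val_inj; rewrite /= /up (eq_map (fun x => addn0 x)) map_id. Qed.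

Lemma pshift0r : right_id p0 pshift.
Proof. by move=> a; apply: val_inj; rewrite /= cats0. Qed.

Lemma pshiftA : associative pshift.
Proof.
move=> a b c; apply: val_inj; rewrite /= size_cat size_map.
by rewrite /up map_cat -/(up _ _) catA -[map _ (map _ _)]/(up _ (up _ _)) up_up addnC.
Qed.

Lemma psizeM a b : psize (pshift a b) = (psize a + psize b)%N.
Proof. by rewrite /psize /= size_cat size_map. Qed.

Lemma psize_eq0 a : psize a = 0%N -> a = p0.
Proof. by move/size0nil => a0; apply: val_inj. Qed.

Lemma pcut_in a p : p \in pcut a -> exists x s q,
  [/\ atoms (val a) = x :: s, q \in splits s,
      uniq (flatten (x :: q.1)) && uniq (flatten q.2), atomic q.2
    & p = (pst (flatten (x :: q.1)), pst (flatten q.2))].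
Proof.
case: (eqVneq a p0) => [->|/p0_atoms[x [s As]]] //.
rewrite (pcutE As) => /mapP[q qs ->]; exists x, s, q.
have [q1 q2 _] := subseq_splits qs.
have q2s : subseq q.2 (atoms (val a)) by rewrite As; exact: subseq_trans q2 (subseq_cons _ _).
split=> //; last exact: atomic_subseq q2s (atomic_atoms _).
by apply/andP; split; apply: (@uniq_atoms a) => //; rewrite As /= eqxx.
Qed.

Lemma pcut_size a p : p \in pcut a -> (psize p.1 + psize p.2)%N = psize a.
Proof.
case/pcut_in => x [s [q [As qs /andP[u1 u2] _ ->]]]; rewrite /psize /= !val_pst // !size_st.
rewrite -(flatten_atoms (val a)) As /= !size_cat -addnA; congr addn.
have [_ _ /perm_flatten/perm_size <-] := subseq_splits qs.
by rewrite flatten_cat size_cat.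
Qed.

Lemma pcut_neq0 a p : p \in pcut a -> p.1 != p0.
Proof.
case/pcut_in => x [s [q [As _ /andP[u1 _] _ ->]]]; rewrite pst0 //=.
have := atomic_atoms (val a); rewrite As => /andP[/= /andP[/is_atom_nil + _] _].
by case: x As {u1}.
Qed.

Lemma pcut_full (V : nmodType) (F : perm_word -> V) a : a != p0 ->
  \sum_(p <- pcut a | p.2 == p0) F p.1 = F a.
Proof.
case/p0_atoms => x [s As]; rewrite (pcutE As) big_map big_mkcond /=.
rewrite -[in RHS](pst_val a) -(flatten_atoms (val a)) As.
rewrite -[RHS](sum_splits_nil s (fun t => F (pst (flatten (x :: t))))).
rewrite -(sum_splitsC s (fun u v => if nilp v then F (pst (flatten (x :: u))) else 0)).
apply: eq_big_seq => q /subseq_splits[_ q2 _].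
have q2s : subseq q.2 (atoms (val a)) by rewrite As; exact: subseq_trans q2 (subseq_cons _ _).
rewrite pst0; last exact: (@uniq_atoms a).
rewrite flatten_eq0; last exact: atomic_subseq q2s (atomic_atoms _).
by rewrite /nilp size_eq0.
Qed.

(** The terms of [pfull], arranged as cuts followed by their mirror images, the form that
    [theta_iso] expects. *)
Definition full a := if a == p0 then [:: (p0, p0)] else pcut a ++ [seq (p.2, p.1) | p <- pcut a].

Lemma sum_full (V : nmodType) (F : perm_word -> perm_word -> V) a :
  \sum_(p <- full a) F p.1 p.2 = \sum_(p <- pfull a) F p.1 p.2.
Proof.
rewrite /full; case: (eqVneq a p0) => [->|/p0_atoms[x [s As]]].
  by rewrite /pfull /= !big_seq1 /= -[p0](pst_val p0).
rewrite /pfull As (pcutE As) big_map big_cat !big_map sum_splits_cons; congr (_ + _).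
exact: (sum_splitsC s (fun u v => F (pst (flatten v)) (pst (flatten (x :: u))))).
Qed.

(** The atoms of [pshift a b] are those of [a] and the shifted ones of [b], so a split of them is a
    pair of splits; standardization undoes the shift. *)
Lemma pcut_shift (V : nmodType) (F : perm_word -> perm_word -> V) a b : a != p0 ->
  \sum_(p <- pcut (pshift a b)) F p.1 p.2 =
  \sum_(p <- pcut a) \sum_(q <- full b) F (pshift p.1 q.1) (pshift p.2 q.2).
Proof.
case/p0_atoms => x [s As].
have Aab : atoms (val (pshift a b)) = x :: (s ++ map (up (size (val a))) (atoms (val b))).
  by rewrite atoms_shift As.
rewrite (pcutE Aab) (pcutE As) !big_map.
rewrite (sum_splits_cat s _ (fun u v => F (pst (flatten (x :: u))) (pst (flatten v)))).
apply: eq_big_seq => p /subseq_splits[p1 p2 _].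
rewrite /= (sum_full (fun u v => F (pshift (pst (x ++ flatten p.1)) u)
  (pshift (pst (flatten p.2)) v))) /pfull splits_map !big_map big_seq [RHS]big_seq.
apply: eq_bigr => q /subseq_splits[q1 q2 _] /=.
have cat_pst u v : subseq u (atoms (val a)) -> subseq v (atoms (val b)) ->
    pst (flatten (u ++ map (up (size (val a))) v)) = pshift (pst (flatten u)) (pst (flatten v)).
  move=> /subseq_flatten ua /subseq_flatten vb; rewrite flatten_cat.
  have -> : flatten (map (up (size (val a))) v) = up (size (val a)) (flatten v).
    by rewrite /up map_flatten.
  rewrite flatten_atoms in ua; rewrite flatten_atoms in vb.
  have sub2 : subseq (up (size (val a)) (flatten v)) (up (size (val a)) (val b)).
    exact: map_subseq.
  rewrite pst_cat ?pst_up //.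
    by apply: subseq_uniq (cat_subseq ua sub2) (perm_uniqP (pshift a b)).
  by move=> y z /(mem_subseq ua) ya /(mem_subseq sub2); exact: shift_lt ya.
have p2a : subseq p.2 (atoms (val a)) by rewrite As; exact: subseq_trans p2 (subseq_cons _ _).
have p1a : subseq (x :: p.1) (atoms (val a)) by rewrite As /= eqxx.
by rewrite -(cat_pst _ _ p2a q2) -(cat_pst _ _ p1a q1).
Qed.

Lemma pcut_op (V : nmodType) (F : perm_word -> perm_word -> V) a b : a != p0 ->
  (forall x y, ~~ irreducible pshift p0 x -> F x y = 0) ->
  \sum_(p <- pcut (pshift a b)) F p.1 p.2 = \sum_(p <- pcut a) F p.1 (pshift p.2 b).
Proof.
move=> a0; apply: (cut_op_of_full (full := full)) => //.
- exact: pshift0r.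
- exact: pcut_neq0.
- by move=> G; exact: pcut_shift.
move=> G; rewrite /full; case: (eqVneq b p0) => [->|b0]; first by rewrite big_mkcond big_seq1 eqxx.
rewrite big_cat big_map /= pcut_full // big_seq_cond big1 ?add0r // => p /andP[/pcut_neq0].
by move/negPf => ->.
Qed.

(** Both sides deal the atoms out to three parts, with the first atom in the leftmost one. *)
Lemma pcut_assoc (V : nmodType) (F : perm_word -> perm_word -> perm_word -> V) a : a != p0 ->
  \sum_(p <- pcut a) \sum_(q <- full p.2) F p.1 q.1 q.2 =
  \sum_(p <- pcut a) \sum_(q <- pcut p.1) F q.1 q.2 p.2.
Proof.
case/p0_atoms => x [s As]; rewrite (pcutE As) !big_map /=.
have sub_a (u : seq (seq nat)) : subseq u s -> subseq u (atoms (val a)).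
  by move=> us; rewrite As; exact: subseq_trans us (subseq_cons _ _).
have ax : atomic (x :: s) by rewrite -As; exact: atomic_atoms.
transitivity (\sum_(p <- splits s) \sum_(q <- splits p.2)
    F (pst (flatten (x :: p.1))) (pst (flatten q.1)) (pst (flatten q.2))).
  apply: eq_big_seq => p /subseq_splits[_ p2 _].
  rewrite (sum_full (F _)) sum_pfull //; last exact: (@uniq_atoms a _ (sub_a _ p2)).
  exact: atomic_subseq (sub_a _ p2) (atomic_atoms _).
rewrite -(sum_splitsA s (fun u v t => F (pst (flatten (x :: u))) (pst (flatten v)) (pst (flatten t)))).
apply: eq_big_seq => p /subseq_splits[p1 _ _].
have p1s : subseq (x :: p.1) (x :: s) by rewrite /= eqxx.
rewrite (sum_pcut (fun y z => F y z _)) //; first exact: atomic_subseq ax.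
by apply: (@uniq_atoms a); rewrite As.
Qed.

Variable K : fieldType.

(** The coalgebra of [KS], with only the term of the empty matching kept in the coupling product. *)
Definition concat_hopf : hopf_data K :=
  free_hopf (fun a b => << pshift a b >> : {malg K[perm_word]}) << p0 >>
    (draw K) (deg0 K).

Lemma drawE a : draw K a = \sum_(p <- pfull a) << p.1 >> ⊗ << p.2 >>.
Proof.
rewrite /draw pureE big_map.
rewrite -(sum_sets_splits [::] (atoms (val a)) (fun u v =>
  (<< pst (flatten u) >> : {malg K[perm_word]}) ⊗ (<< pst (flatten v) >> : {malg K[perm_word]}))).
apply: eq_bigr => I _; rewrite /select.
have uI (J : {set 'I_(size (atoms (val a)))}) :
    uniq (flatten [seq nth [::] (atoms (val a)) (val i) | i <- enum J]).
  by apply: (@uniq_atoms a); rewrite map_nth_mask; exact: mask_subseq.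
by rewrite !perm_vecE ?st_perm_word.
Qed.

Lemma concat_iso : bialg_iso concat_hopf (word_hopf K (letter pshift p0)).
Proof.
apply: (@theta_iso _ pshift p0 psize pcut pshift0 pshift0r pshiftA psizeM _ psize_eq0
  pcut_size pcut_neq0 pcut_full pcut_op full) => //.
- exact: pcut_assoc.
- by move=> a a0; rewrite /full (negPf a0).
- by move=> a; rewrite drawE (sum_full (fun u v => << u >> ⊗ << v >>)).
Qed.

End ConcatenationAlgebra.

(** * The coupling product as a sum over lists *)

Section CouplingAsList.

Lemma uniq_pmap (I T : eqType) (f : I -> option T) s : uniq s ->
  reflect {in s &, forall i j, f i = f j -> f i != None -> i = j} (uniq (pmap f s)).
Proof.
elim: s => [|i s IH] /=; first by move=> _; apply: ReflectT.
case/andP=> i_s us; case fi: (f i) => [x|] /=; last first.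
  apply: (iffP (IH us)) => inj j k => [|js ks].
    rewrite !inE => /predU1P[->|js]; first by rewrite fi.
    by case/predU1P=> [->|ks]; [rewrite fi => -> | exact: inj].
  by apply: inj; rewrite inE ?js ?ks orbT.
apply: (iffP andP) => [[x_s /(IH us) inj] j k|inj].
  have fs l : l \in s -> f l != Some x.
    by move=> ls; apply: contraNneq x_s => fl; rewrite mem_pmap -fl map_f.
  rewrite !inE => /predU1P[->|js] /predU1P[->|ks] //; last exact: inj.
    by rewrite fi => /esym fk; have := fs _ ks; rewrite fk eqxx.
  by rewrite fi => fj; have := fs _ js; rewrite fj eqxx.
split; last first.
  by apply/(IH us) => j k js ks; apply: inj; rewrite inE ?js ?ks orbT.
rewrite mem_pmap; apply/mapP => -[j js fj].
have ij : i = j by apply: inj; rewrite ?inE ?eqxx ?js ?orbT // fi.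
by rewrite ij js in i_s.
Qed.

Lemma partial_injE r s (f : {ffun 'I_r -> option 'I_s}) :
  partial_inj f = matching (enum 'I_s) (codom f).
Proof.
rewrite /matching (_ : all _ _ = true) ?andbT; last first.
  by apply/allP => -[j|] //= _; rewrite mem_enum.
have -> : pmap id (codom f) = pmap f (enum 'I_r).
  by rewrite /codom /image_mem; elim: (enum _) => //= i t ->.
apply/forallP/(uniq_pmap f (enum_uniq _)) => [inj i j _ _ fij fi|inj i].
  by have /forallP/(_ j)/implyP := inj i; rewrite fij eqxx -fij fi => /(_ isT)/eqP.
by apply/forallP => j; apply/implyP => /andP[/eqP fij fi]; apply/eqP/inj; rewrite ?mem_enum.
Qed.

Lemma coupling_wordE (p q : seq (seq nat)) (f : {ffun 'I_(size p) -> option 'I_(size q)}) :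
  coupling_word f = matching_word (fun j : 'I_(size q) => nth [::] q j) p (enum 'I_(size q)) (codom f).
Proof.
rewrite /coupling_word /matching_word; congr (flatten _ ++ flatten _).
  have pE : p = [seq nth [::] p (val i) | i <- enum 'I_(size p)].
    rewrite -[LHS](mkseq_nth [::]) /mkseq -val_enum_ord -[LHS]map_comp; exact: eq_map.
  have -> : zip (codom f) p = [seq (f i, nth [::] p (val i)) | i <- enum 'I_(size p)].
    by rewrite -zip_map; congr zip.
  by rewrite -map_comp; apply: eq_map => i /=; case: (f i).
have -> : enum [set j | [forall i, f i != Some j]] =
    [seq j <- enum 'I_(size q) | Some j \notin codom f].
  rewrite [RHS](_ : _ = [seq j <- Finite.enum _ | Some j \notin codom f]); last by rewrite enumT.
  apply: eq_filter => j; rewrite [LHS]inE.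
  apply/forallP/idP => [fj|fj i].
    by apply/codomP => -[i fi]; have := fj i; rewrite -fi eqxx.
  by apply: contraNneq fj => <-; exact: codom_f.
by [].
Qed.

(** Reading a partial injection as the list of its values turns the sum over [f] into the recursion
    of [couplings], through [sum_matchings]. *)
Lemma couplingE (K : fieldType) a b : coupling K a b =
  \sum_(q <- couplings (atoms (val a)) (atoms (up (size (val a)) (val b))))
    perm_vec K (flatten q).
Proof.
rewrite /coupling; set p := atoms (val a); set q := atoms _.
transitivity (\sum_(f : {ffun 'I_(size p) -> option 'I_(size q)} |
    matching (enum 'I_(size q)) (codom f)) perm_vec K
      (matching_word (fun j : 'I_(size q) => nth [::] q j) p (enum 'I_(size q)) (codom f))).
  apply: eq_big => f; first exact: partial_injE.
  by rewrite coupling_wordE.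
rewrite (sum_ffun_seqs (size p) (matching (enum 'I_(size q)))
  (fun s => perm_vec K (matching_word (fun j : 'I_(size q) => nth [::] q j) p (enum 'I_(size q)) s))).
rewrite (sum_matchings _ _ (perm_vec K)) ?enum_uniq //.
congr (\sum_(r <- couplings _ _) _).
rewrite -[RHS](mkseq_nth [::]) /mkseq -val_enum_ord -[RHS]map_comp; exact: eq_map.
Qed.

End CouplingAsList.

Lemma perm_couplings (T : eqType) (p q r : seq (seq T)) :
  r \in couplings p q -> perm_eq (flatten r) (flatten (p ++ q)).
Proof.
elim: p q r => [|a p IH] q r /=; first by rewrite inE => /eqP ->.
rewrite mem_cat => /orP[/mapP[s /IH sp ->]|/flattenP[_ /mapP[x xq ->] /mapP[s /IH sp ->]]] /=.
  by rewrite perm_cat2l.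
have /perm_flatten E : perm_eq (p ++ x.1 :: x.2) (p ++ q) by rewrite perm_cat2l perm_picks.
rewrite -catA perm_catCA perm_cat2l -(permPr E) flatten_cat /= perm_sym perm_catCA.
by rewrite perm_cat2l -flatten_cat perm_sym.
Qed.

(** * From shifted concatenation to coupling *)

Section MergeMap.
Variable K : fieldType.
Local Notation C := (concat_hopf K).
Implicit Types (a b : perm_word).

Definition merge_map : C -> KS K :=
  mlin (fun a => \sum_(q <- merges (atoms (val a))) (<< pw (flatten q) >> : {malg K[perm_word]})).

Lemma merge_map_linear : linear merge_map. Proof. exact: mlin_linear. Qed.

Lemma merge_mapU a : merge_map << a >> =
  \sum_(q <- merges (atoms (val a))) (<< pw (flatten q) >> : KS K).
Proof. exact: mlinU. Qed.

Lemma merges_perm a q : q \in merges (atoms (val a)) ->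
  [/\ atomic q, perm_eq (flatten q) (val a), is_perm_word (flatten q)
    & size (flatten q) = size (val a)].
Proof.
move=> qa; have qa' := perm_merges qa; rewrite flatten_atoms in qa'.
split=> //; [exact: atomic_merges (atomic_atoms _) qa | | exact: perm_size].
apply: (perm_trans qa'); rewrite (perm_size qa'); exact: valP a.
Qed.

(** Unitriangular for the number of atoms, by [merges_head]: merged lists are [atomic], so their
    blocks are the atoms of the resulting words. *)
Lemma merge_map_bijective : bijective merge_map.
Proof.
apply: (@unitriangular_bijective K _ _ merge_map id (fun a => size (atoms (val a)))
  (fun a => [seq pw (flatten q) | q <- behead (merges (atoms (val a)))])).
- exact: merge_map_linear.
- by move=> a; exists a.
- move=> a; rewrite merge_mapU; have [s -> _] := merges_head (atoms (val a)).
  by rewrite big_cons big_map flatten_atoms val_pw.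
move=> a b; have [s As s_lt] := merges_head (atoms (val a)); rewrite As /= => /mapP[q qs ->].
have [aq _ pq _] : [/\ atomic q, perm_eq (flatten q) (val a), is_perm_word (flatten q)
    & size (flatten q) = size (val a)].
  by apply: merges_perm; rewrite As inE qs orbT.
by rewrite pwK // atoms_flatten // s_lt.
Qed.

Lemma merge_map_mul a b : merge_map << pshift a b >> = merge_map << a >> ∙ merge_map << b >>.
Proof.
have mL := merge_map_linear; rewrite !merge_mapU.
rewrite (linear_sums ((hm_bilinear (KS K)).1 _)) atoms_shift sum_merges_cat.
apply: eq_big_seq => p /merges_perm[ap pa pp sp].
rewrite (linear_sums ((hm_bilinear (KS K)).2 _)) merges_map big_map.
apply: eq_big_seq => q qb; have [aq _ pq sq] := merges_perm qb.
rewrite free_hm couplingE !pwK // atoms_flatten //.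
have -> : atoms (up (size (flatten p)) (flatten q)) = map (up (size (val a))) q.
  by rewrite sp /up atoms_map ?atoms_flatten //; exact: up_mono.
apply: eq_big_seq => r /perm_couplings rpq; rewrite perm_vecE //.
have r_ab : perm_eq (flatten r) (val (pshift a b)).
  apply: (perm_trans rpq); rewrite flatten_cat perm_cat // -map_flatten.
  by have [_ qb' _ _] := merges_perm qb; exact: perm_map.
by apply: (perm_trans r_ab); rewrite (perm_size r_ab); exact: (valP (pshift a b)).
Qed.

(** All the merged words have the letters of [flatten p], so one relabelling standardizes all of
    them. *)
Lemma merge_map_pst (p : seq (seq nat)) : atomic p -> uniq (flatten p) ->
  merge_map << pst (flatten p) >> = \sum_(s <- merges p) (<< pst (flatten s) >> : KS K).
Proof.
move=> ap u; rewrite merge_mapU val_pst // stE atoms_map ?atoms_flatten //; last exact: st_mono.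
rewrite merges_map big_map; apply: eq_big_seq => s /perm_merges sp.
rewrite -map_flatten /pst stE; congr << pw _ >>; apply: eq_map => x.
by rewrite (st_perm sp).
Qed.

Lemma merge_map_morphism : bialg_morphism merge_map.
Proof.
have mL := merge_map_linear.
apply: free_bialg_morphism => // [a b||a|a].
- by rewrite [in LHS]free_hm merge_map_mul.
- by rewrite !free_h1 merge_mapU /= big_seq1 perm_vecE.
- rewrite free_hd drawE merge_mapU (linear_sums (@hd_linear _ (KS K))).
  rewrite (linear_sums (tmapP mL mL)) big_map.
  pose G u v := (<< pst (flatten u) >> : KS K) ⊗ (<< pst (flatten v) >> : KS K).
  transitivity (\sum_(q <- merges (atoms (val a))) \sum_(x <- splits q) G x.1 x.2).
    apply: eq_big_seq => q /merges_perm[aq _ pq _].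
    by rewrite free_hd drawE big_map pwK // atoms_flatten.
  rewrite sum_merges_splits; apply: eq_big_seq => p /subseq_splits[p1 p2 _] /=.
  have ap q : subseq q (atoms (val a)) -> atomic q.
    by move=> qa; exact: atomic_subseq qa (atomic_atoms _).
  rewrite tmap_pure // !merge_map_pst ?ap ?(uniq_atoms p1) ?(uniq_atoms p2) //.
  rewrite (linear_sums (pure_linearl _)); apply: eq_bigr => s _.
  by rewrite (linear_sums (pure_linearr _)).
- rewrite free_he merge_mapU (linear_sums (@he_linear _ (KS K))).
  have [s As _] := merges_head (atoms (val a)).
  case: (eqVneq a p0) => [->|a0]; first by rewrite big_seq1 free_he /deg0 pwK.
  rewrite big_seq big1 => [|q /merges_perm[_ _ pq sq]].
    by rewrite /deg0 -val_eqE in a0 *; rewrite (negPf a0).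
  by rewrite free_he /deg0 pwK // -size_eq0 sq size_eq0 -val_eqE in a0 *; rewrite (negPf a0).
Qed.

Lemma concat_KS_iso : bialg_iso C (KS K).
Proof. by exists merge_map; [exact: merge_map_bijective | exact: merge_map_morphism]. Qed.

End MergeMap.

Lemma word_KS_iso (K : fieldType) : bialg_iso (word_hopf K (letter pshift p0)) (KS K).
Proof. exact: bialg_iso_trans (bialg_iso_sym (concat_iso K)) (concat_KS_iso K). Qed.

(** * Heap-ordered forests *)

Section TreeWords.
Implicit Types (x y u v w : seq nat) (cs ds : seq bool).

(* Each letter must not exceed the number of nodes that precede it, when [k]  *)
(* nodes precede the word.                                                    *)
Fixpoint tree_word k x := if x is c :: x' then (c <= k)%N && tree_word k.+1 x' else true.

(* Shifts the labels of the nodes below which a tree is not attached to the   *)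
(* root.                                                                      *)
Definition tshift n x := [seq if c == 0%N then 0%N else (c + n)%N | c <- x].

(* Colours the nodes of a forest in such a way that each tree has only one    *)
(* colour, and splits it accordingly; [cs] are the colours of the previous    *)
(* nodes.                                                                     *)
Definition colours cs c := if c == 0%N then [:: true; false] else [:: last true (take c cs)].

(** When the node [c] has colour [t], this is its label in the part of that colour: the number of
    nodes of colour [t] up to [c]. The root keeps the label [0]. *)
Definition rank (t : bool) cs c := count_mem t (take c cs).

Definition tcons (t : bool) (c : nat) (p : seq nat * seq nat) :=
  if t then (c :: p.1, p.2) else (p.1, c :: p.2).

Fixpoint tsplit cs x : seq (seq nat * seq nat) :=
  if x is c :: x' then
    flatten [seq [seq tcons t (rank t cs c) p | p <- tsplit (rcons cs t) x'] | t <- colours cs c]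
  else [:: ([::], [::])].

(* Attaches each tree to the root or to one of the [k] previous nodes ...     *)
Fixpoint fills k x : seq (seq nat) :=
  if x is c :: x' then
    flatten [seq [seq d :: w | w <- fills k.+1 x'] | d <- if c == 0%N then iota 0 k.+1 else [:: c]]
  else [:: [::]].

(* ... or only to the nodes of a forest of degree [n], on top of which [x] is *)
(* put.                                                                       *)
Fixpoint grafts n x : seq (seq nat) :=
  if x is c :: x' then
    flatten [seq [seq d :: w | w <- grafts n x'] | d <- if c == 0%N then iota 0 n.+1 else [:: (c + n)%N]]
  else [:: [::]].

Arguments tsplit : simpl never.
Arguments fills : simpl never.
Arguments grafts : simpl never.

Variable V : nmodType.

Lemma sum_tsplit0 cs (F : seq nat * seq nat -> V) : \sum_(p <- tsplit cs [::]) F p = F ([::], [::]).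
Proof. exact: big_seq1. Qed.

Lemma sum_tsplit_cons cs c x (F : seq nat * seq nat -> V) :
  \sum_(p <- tsplit cs (c :: x)) F p =
  \sum_(t <- colours cs c) \sum_(p <- tsplit (rcons cs t) x) F (tcons t (rank t cs c) p).
Proof.
by rewrite [tsplit _ _]/= big_flatten big_map; apply: eq_bigr => t _; rewrite big_map.
Qed.

Lemma sum_fills0 k (F : seq nat -> V) : \sum_(w <- fills k [::]) F w = F [::].
Proof. exact: big_seq1. Qed.

Lemma sum_fills_cons k c x (F : seq nat -> V) :
  \sum_(w <- fills k (c :: x)) F w =
  \sum_(d <- if c == 0%N then iota 0 k.+1 else [:: c]) \sum_(w <- fills k.+1 x) F (d :: w).
Proof.
by rewrite [fills _ _]/= big_flatten big_map; apply: eq_bigr => t _; rewrite big_map.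
Qed.

Lemma sum_grafts0 k (F : seq nat -> V) : \sum_(w <- grafts k [::]) F w = F [::].
Proof. exact: big_seq1. Qed.

Lemma sum_grafts_cons n c x (F : seq nat -> V) :
  \sum_(w <- grafts n (c :: x)) F w =
  \sum_(d <- if c == 0%N then iota 0 n.+1 else [:: (c + n)%N]) \sum_(w <- grafts n x) F (d :: w).
Proof.
by rewrite [grafts _ _]/= big_flatten big_map; apply: eq_bigr => t _; rewrite big_map.
Qed.

Lemma sum_colours cs c (F : bool -> V) : \sum_(t <- colours cs c) F t =
  if c == 0%N then F true + F false else F (last true (take c cs)).
Proof. by rewrite /colours; case: ifP => _; rewrite ?big_seq1 // !big_cons big_nil addr0. Qed.

Lemma rank_gt0 cs c : (0 < c <= size cs)%N -> (0 < rank (last true (take c cs)) cs c)%N.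
Proof.
case/andP=> c0 cs_c; rewrite /rank -has_count has_pred1.
have : size (take c cs) = c by rewrite size_takel.
by case/lastP: (take c cs) => [|s t]; [case: c c0 {cs_c} | rewrite last_rcons mem_rcons mem_head].
Qed.

Lemma rank0 t cs : rank t cs 0 = 0%N. Proof. by rewrite /rank take0. Qed.

(** A tree kept at the root by [fills] is then grafted on one of the nodes [0] to [n]; one attached
    to a node [d > 0] ends up on [d + n]. Together these are all the nodes available in the shifted
    forest. *)
Lemma sum_fills_grafts k n x (F : seq nat -> V) :
  \sum_(u <- fills k x) \sum_(w <- grafts n u) F w =
  \sum_(w <- fills (n + k) (tshift n x)) F w.
Proof.
elim: x k F => [|c x IH] k F; first by rewrite !sum_fills0 ?sum_grafts0.
rewrite [tshift _ _]/= !sum_fills_cons.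
transitivity (\sum_(d <- if c == 0%N then iota 0 k.+1 else [:: c])
   \sum_(e <- if d == 0%N then iota 0 n.+1 else [:: (d + n)%N])
   \sum_(w <- fills (n + k).+1 (tshift n x)) F (e :: w)).
  apply: eq_bigr => d _; under eq_bigr do rewrite sum_grafts_cons.
  by rewrite exchange_big; apply: eq_bigr => e _; rewrite IH addnS.
case: (eqVneq c 0%N) => [_|c0]; last first.
  by rewrite !big_seq1 (negPf c0) big_seq1 addn_eq0 (negPf c0) big_seq1.
rewrite eqxx [iota 0 k.+1]/= big_cons eqxx -addSn iotaD big_cat add0n; congr (_ + _).
rewrite -[in RHS]addn1 iotaDl big_map; apply: eq_big_seq => d.
by rewrite mem_iota; case: d => // d _; rewrite big_seq1 addn1 [(d.+1 + n)%N]addnC.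
Qed.

(** The root may be given either colour, and any other node has its own; [rank] numbers the nodes of
    each colour consecutively. *)
Lemma sum_ranks cs (F : bool -> nat -> V) :
  \sum_(d <- iota 0 (size cs).+1) \sum_(t <- colours cs d) F t (rank t cs d) =
  \sum_(d <- iota 0 (count_mem true cs).+1) F true d +
  \sum_(d <- iota 0 (count_mem false cs).+1) F false d.
Proof.
rewrite [iota 0 _]/= big_cons [X in X + _ = _]sum_colours /= !rank0 !big_cons -!addrA.
congr (_ + _); rewrite [RHS]addrCA; congr (_ + _).
transitivity (\sum_(d <- iota 1 (size cs)) F (last true (take d cs)) (rank (last true (take d cs)) cs d)).
  apply: eq_big_seq => d; rewrite mem_iota sum_colours.
  by case: d.
elim/last_ind: cs => [|cs t IH]; first by rewrite !big_nil addr0.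
rewrite size_rcons -[(size cs).+1]addn1 iotaD big_cat big_seq1 add1n take_oversize ?size_rcons //.
rewrite last_rcons /rank take_oversize ?size_rcons // -!cats1 !count_cat /= !addn0.
rewrite (eq_big_seq (fun d => F (last true (take d cs)) (rank (last true (take d cs)) cs d))); last first.
  by move=> d; rewrite mem_iota add1n ltnS => /andP[_ dcs]; rewrite /rank takel_cat.
rewrite IH; case: t => /=; rewrite !addn0 iotaD big_cat big_seq1 add1n addn1.
  by rewrite addrAC.
by rewrite addrA.
Qed.

(** A reattached tree takes the colour of its new parent. By [sum_ranks], choosing that parent is
    the same as choosing a colour and then a node of this colour or the root. *)
Lemma sum_fills_tsplit cs x (F : seq nat -> seq nat -> V) : tree_word (size cs) x ->
  \sum_(w <- fills (size cs) x) \sum_(p <- tsplit cs w) F p.1 p.2 =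
  \sum_(p <- tsplit cs x) \sum_(u <- fills (count_mem true cs) p.1)
    \sum_(v <- fills (count_mem false cs) p.2) F u v.
Proof.
elim: x cs F => [|c x IH] cs F; first by rewrite sum_fills0 !sum_tsplit0 !sum_fills0.
move=> /= /andP[c_cs x_cs]; rewrite sum_fills_cons sum_tsplit_cons.
(* [A t (G t d)] is the contribution of a first node of colour [t] attached to the node [d] of its
   part. *)
pose A t (G : seq nat -> seq nat -> V) :=
  \sum_(p <- tsplit (rcons cs t) x) \sum_(u <- fills (count_mem true (rcons cs t)) p.1)
    \sum_(v <- fills (count_mem false (rcons cs t)) p.2) G u v.
pose G (t : bool) d u v := if t then F (d :: u) v else F u (d :: v).
transitivity (\sum_(d <- if c == 0%N then iota 0 (size cs).+1 else [:: c])
    \sum_(t <- colours cs d) A t (G t (rank t cs d))).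
  apply: eq_bigr => d _; under eq_bigr do rewrite sum_tsplit_cons.
  rewrite exchange_big; apply: eq_bigr => t _; rewrite /A -IH size_rcons //.
  by apply: eq_bigr => w _; apply: eq_bigr => p _; case: t.
have fillsA t d : (d <= count_mem t cs)%N -> \sum_(p <- tsplit (rcons cs t) x)
    \sum_(u <- fills (count_mem true cs) (tcons t d p).1)
    \sum_(v <- fills (count_mem false cs) (tcons t d p).2) F u v =
    \sum_(e <- if d == 0%N then iota 0 (count_mem t cs).+1 else [:: d]) A t (G t e).
  move=> _; rewrite exchange_big; apply: eq_bigr => p _; rewrite -cats1 !count_cat.
  case: t => /=; rewrite !addn0 ?addn1.
    by rewrite sum_fills_cons; apply: eq_bigr => e _.
  rewrite [RHS]exchange_big; apply: eq_bigr => u _.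
  by rewrite sum_fills_cons.
have le_rank t : (rank t cs c <= count_mem t cs)%N.
  by rewrite -[in X in (_ <= X)%N](cat_take_drop c cs) count_cat leq_addr.
rewrite [RHS](eq_bigr _ (fun t _ => fillsA t _ (le_rank t))).
rewrite [RHS]sum_colours; case: (eqVneq c 0%N) => [->|c0].
  by rewrite !rank0 eqxx (sum_ranks cs (fun t d => A t (G t d))).
rewrite big_seq1 sum_colours (negPf c0).
by rewrite gtn_eqF ?big_seq1 // rank_gt0 // lt0n c0.
Qed.

Lemma rank_negb t cs c : rank t (map negb cs) c = rank (~~ t) cs c.
Proof.
rewrite /rank -map_take count_map; apply: eq_count => b /=.
by case: b; case: t.
Qed.

Lemma sum_tsplitC cs x (F : seq nat -> seq nat -> V) : tree_word (size cs) x ->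
  \sum_(p <- tsplit cs x) F p.1 p.2 = \sum_(p <- tsplit (map negb cs) x) F p.2 p.1.
Proof.
elim: x cs F => [|c x IH] cs F; first by rewrite !sum_tsplit0.
move=> /= /andP[c_cs x_cs]; rewrite !sum_tsplit_cons.
pose A t (G : seq nat -> seq nat -> V) := \sum_(p <- tsplit (rcons cs t) x) G p.1 p.2.
pose G (t : bool) d u v := if t then F (d :: u) v else F u (d :: v).
transitivity (\sum_(t <- colours cs c) A t (G t (rank t cs c))).
  by apply: eq_bigr => t _; apply: eq_bigr => p _; case: t.
have A_negb t : \sum_(p <- tsplit (rcons (map negb cs) (~~ t)) x)
    F (tcons (~~ t) (rank (~~ t) (map negb cs) c) p).2 (tcons (~~ t) (rank (~~ t) (map negb cs) c) p).1
    = A t (G t (rank t cs c)).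
  rewrite /A (IH _ (G t _)) ?size_rcons // map_rcons rank_negb negbK.
  by apply: eq_bigr => p _; case: t.
rewrite !sum_colours; case: (eqVneq c 0%N) => c0.
  by rewrite [LHS]addrC -(A_negb false) -(A_negb true).
rewrite -A_negb.
have -> : last true (take c (map negb cs)) = ~~ last true (take c cs); last by [].
rewrite -map_take; have : size (take c cs) = c by rewrite size_takel.
by case/lastP: (take c cs) => [/esym/eqP|s t _]; [rewrite (negPf c0) | rewrite map_rcons !last_rcons].
Qed.

(** A node of colour [false] makes the second part nonempty, and relabelling a forest of one colour
    changes nothing. *)
Lemma sum_tsplit_true k x (F : seq nat -> V) : tree_word k x ->
  \sum_(p <- tsplit (nseq k true) x | p.2 == [::]) F p.1 = F x.
Proof.
elim: x k F => [|c x IH] k F; first by rewrite big_mkcond sum_tsplit0.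
move=> /= /andP[ck xk]; rewrite big_mkcond sum_tsplit_cons.
have rk : rank true (nseq k true) c = c by rewrite /rank take_nseq // count_nseq mul1n.
have trueE : \sum_(p <- tsplit (rcons (nseq k true) true) x)
    (if (tcons true c p).2 == [::] then F (tcons true c p).1 else 0) = F (c :: x).
  by have /= <- := IH _ (F \o cons c) xk; rewrite [RHS]big_mkcond /= -cats1 -(nseqD k 1) addn1.
rewrite sum_colours rk; case: ifP => c0.
  by rewrite trueE big1 ?addr0.
have -> : last true (take c (nseq k true)) = true.
  by rewrite take_nseq // {c0 rk ck trueE}; elim: c.
by rewrite rk trueE.
Qed.

(** The nodes coloured by [cs] receive no children from the shifted forest; they only raise its
    labels, by their number in each colour. *)
Lemma sum_tsplit_shift cs ds x (F : seq nat -> seq nat -> V) : tree_word (size ds) x ->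
  \sum_(p <- tsplit (cs ++ ds) (tshift (size cs) x)) F p.1 p.2 =
  \sum_(p <- tsplit ds x) F (tshift (count_mem true cs) p.1) (tshift (count_mem false cs) p.2).
Proof.
elim: x ds F => [|c x IH] ds F; first by rewrite !sum_tsplit0.
move=> /= /andP[c_ds x_ds]; rewrite [tshift _ _]/= !sum_tsplit_cons.
pose A t (G : seq nat -> seq nat -> V) := \sum_(p <- tsplit (rcons ds t) x)
  G (tshift (count_mem true cs) p.1) (tshift (count_mem false cs) p.2).
pose G (t : bool) d u v := if t then F (d :: u) v else F u (d :: v).
pose e t := if rank t ds c == 0%N then 0%N else (rank t ds c + count_mem t cs)%N.
have lhs t d : \sum_(p <- tsplit (rcons (cs ++ ds) t) (tshift (size cs) x))
    F (tcons t d p).1 (tcons t d p).2 = A t (G t d).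
  by rewrite /A -(IH _ (G t d)) ?size_rcons // rcons_cat; apply: eq_bigr => p _; case: t.
have rhs t : \sum_(p <- tsplit (rcons ds t) x)
    F (tshift (count_mem true cs) (tcons t (rank t ds c) p).1)
      (tshift (count_mem false cs) (tcons t (rank t ds c) p).2) = A t (G t (e t)).
  by apply: eq_bigr => p _; case: t.
rewrite [LHS](eq_bigr _ (fun t _ => lhs t _)) [RHS](eq_bigr _ (fun t _ => rhs t)).
rewrite !sum_colours; case: (eqVneq c 0%N) => [c0|c0]; first by rewrite /e c0 !rank0 eqxx.
rewrite addn_eq0 (negPf c0).
have take_c : take (c + size cs) (cs ++ ds) = cs ++ take c ds.
  by rewrite addnC takeD take_size_cat // drop_size_cat.
have := @rank_gt0 ds c; rewrite lt0n c0 c_ds => /(_ isT).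
have -> : last true (take (c + size cs) (cs ++ ds)) = last true (take c ds).
  rewrite take_c last_cat; have : size (take c ds) = c by rewrite size_takel.
  by case: (take c ds) => [/esym/eqP|b s]; rewrite ?(negPf c0).
by rewrite /e lt0n => /negPf ->; rewrite /rank /= take_c count_cat addnC.
Qed.

(** Trees placed side by side are coloured independently, so splitting is compatible with
    juxtaposition. *)
Lemma sum_tsplit_cat cs x y (F : seq nat -> seq nat -> V) :
    tree_word (size cs) x -> tree_word 0 y ->
  \sum_(p <- tsplit cs (x ++ tshift (size cs + size x) y)) F p.1 p.2 =
  \sum_(p <- tsplit cs x) \sum_(q <- tsplit [::] y)
    F (p.1 ++ tshift (count_mem true cs + size p.1) q.1)
      (p.2 ++ tshift (count_mem false cs + size p.2) q.2).
Proof.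
move=> xP yP; elim: x cs F xP => [|c x IH] cs F.
  move=> _; rewrite sum_tsplit0 !addn0 /=.
  by have := @sum_tsplit_shift cs [::] y F yP; rewrite cats0.
move=> /= /andP[c_cs x_cs]; rewrite !sum_tsplit_cons; apply: eq_bigr => t _.
pose G (d : nat) u v := if t then F (d :: u) v else F u (d :: v).
transitivity (\sum_(p <- tsplit (rcons cs t) (x ++ tshift (size (rcons cs t) + size x) y))
   G (rank t cs c) p.1 p.2).
  rewrite size_rcons addSnnS; apply: eq_bigr => p _; by rewrite /G; case: (t).
rewrite IH ?size_rcons //; apply: eq_bigr => p _; apply: eq_bigr => q _.
rewrite -cats1 !count_cat {}/G; case: t => /=; rewrite !addn0.
  by rewrite addn1 addSnnS.
by rewrite addn1 addSnnS.
Qed.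

Definition coloured_first (o : option bool) (d : nat) (F : seq nat -> seq nat -> seq nat -> V) :=
  fun u v w => match o with
    | Some true => F (d :: u) v w | Some false => F u (d :: v) w | None => F u v (d :: w) end.

Lemma take_filter (T : eqType) (P : pred T) c (s : seq T) :
  take (count P (take c s)) (filter P s) = filter P (take c s).
Proof. by rewrite -{2}(cat_take_drop c s) filter_cat -size_filter take_size_cat. Qed.

Section Coassociativity.
Implicit Types s : seq (option bool).

(** [s] colours the nodes for three parts: [Some true], [Some false] and [None] for the first,
    second and third. [c1] and [d1] are the colours seen when the first part is separated before the
    other two, [c2] and [d2] those when the third part is. *)
Let c1 s := [seq o == Some true | o <- s].
Let d1 s := [seq o == Some false | o <- s & o != Some true].
Let c2 s := [seq o != None | o <- s].
Let d2 s := [seq o == Some true | o <- s & o != None].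

Let L s x F : V := \sum_(p <- tsplit (c1 s) x) \sum_(q <- tsplit (d1 s) p.2) F p.1 q.1 q.2.
Let R s x F : V := \sum_(p <- tsplit (c2 s) x) \sum_(q <- tsplit (d2 s) p.1) F q.1 q.2 p.2.

Let ob (t : bool) := if t then Some false else None.
Let ob' (t : bool) := if t then Some true else Some false.

Let Lcons s c x F : L s (c :: x) F =
  \sum_(t <- colours (c1 s) c) if t
    then L (rcons s (Some true)) x (coloured_first (Some true) (rank true (c1 s) c) F)
    else \sum_(t' <- colours (d1 s) (rank false (c1 s) c))
      L (rcons s (ob t')) x
        (coloured_first (ob t') (rank t' (d1 s) (rank false (c1 s) c)) F).
Proof.
rewrite /L sum_tsplit_cons; apply: eq_bigr => t _; case: t => /=.
  rewrite /c1 /d1 map_rcons filter_rcons eqxx /=; apply: eq_bigr => p _.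
  by apply: eq_bigr => q _.
under eq_bigr do rewrite sum_tsplit_cons.
rewrite exchange_big; apply: eq_bigr => t _.
have -> : c1 (rcons s (ob t)) = rcons (c1 s) false by rewrite /c1 map_rcons; case: t.
have -> : d1 (rcons s (ob t)) = rcons (d1 s) t by rewrite /d1 filter_rcons; case: t; rewrite /= map_rcons.
by apply: eq_bigr => p _; apply: eq_bigr => q _; case: t.
Qed.

Let Rcons s c x F : R s (c :: x) F =
  \sum_(t <- colours (c2 s) c) if t
    then \sum_(t' <- colours (d2 s) (rank true (c2 s) c))
      R (rcons s (ob' t')) x
        (coloured_first (ob' t') (rank t' (d2 s) (rank true (c2 s) c)) F)
    else R (rcons s None) x (coloured_first None (rank false (c2 s) c) F).
Proof.
rewrite /R sum_tsplit_cons; apply: eq_bigr => t _; case: t => /=; last first.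
  rewrite /c2 /d2 map_rcons filter_rcons eqxx /=; apply: eq_bigr => p _.
  by apply: eq_bigr => q _.
under eq_bigr do rewrite sum_tsplit_cons.
rewrite exchange_big; apply: eq_bigr => t _.
have -> : c2 (rcons s (ob' t)) = rcons (c2 s) true by rewrite /c2 map_rcons; case: t.
have -> : d2 (rcons s (ob' t)) = rcons (d2 s) t by rewrite /d2 filter_rcons; case: t; rewrite /= map_rcons.
by apply: eq_bigr => p _; apply: eq_bigr => q _; case: t.
Qed.

(** In both iterated splittings a child of the root takes any of the three colours and any other
    node the colour of its parent. *)
Lemma sum_tsplitA s x F : tree_word (size s) x -> L s x F = R s x F.
Proof.
elim: x s F => [|c x IH] s F; first by rewrite /L /R !sum_tsplit0.
move=> /= /andP[c_s x_s]; have {}IH o G : L (rcons s o) x G = R (rcons s o) x G.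
  by rewrite IH // size_rcons.
rewrite Lcons Rcons; case: (posnP c) => [->|c0].
  by rewrite !sum_colours /= !rank0 eqxx -!IH addrA.
have size_c : size (take c s) = c by rewrite size_takel.
(* The contribution of a new node that inherits the colour [o]; it will be used for the colour of
   its parent [c], which is the last entry of [take c s]. *)
pose H o := L (rcons s o) x (coloured_first o (count_mem o (take c s)) F).
have rkE (f : option bool -> bool) t :
    rank t (map f s) c = count [pred o | f o == t] (take c s).
  by rewrite /rank -map_take count_map.
have rkE' (f : option bool -> bool) (P : pred (option bool)) t :
    rank t [seq f o | o <- s & P o] (count P (take c s)) = count [pred o | f o == t & P o] (take c s).
  by rewrite /rank -map_take take_filter count_map count_filter.
have [r [o E]] : exists (r : seq (option bool)) o, take c s = rcons r o.
  by case/lastP: (take c s) size_c c0 => [<-|r o] //; exists r, o.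
have P_last (P : pred (option bool)) : P o -> (count P (take c s) == 0%N) = false.
  by move=> Po; rewrite E -cats1 count_cat /= Po addn1.
have last_f (f : option bool -> bool) (P : pred (option bool)) : P o ->
    last true (take (count P (take c s)) [seq f o | o <- s & P o]) = f o.
  by move=> Po; rewrite -map_take take_filter E filter_rcons Po map_rcons last_rcons.
transitivity (H o).
  rewrite sum_colours gtn_eqF //.
  have -> : last true (take c (c1 s)) = (o == Some true).
    by rewrite -map_take E map_rcons last_rcons.
  rewrite !rkE; case: (eqVneq o (Some true)) => [-> | o1].
    rewrite /H (_ : count [pred _ | _] _ = count_mem (Some true) (take c s)) //.
    by apply: eq_count => -[[]|].
  have -> : count [pred o | (o == Some true) == false] (take c s) =
      count (fun o => o != Some true) (take c s).
    by apply: eq_count => -[[]|].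
  rewrite sum_colours P_last // last_f //.
  have -> : ob (o == Some false) = o by case: (o) o1 => [[]|].
  rewrite /H rkE' (_ : count [pred _ | _ & _] _ = count_mem o (take c s)) //.
  by apply: eq_count => o' /=; case: (o) o1 => [[]|] //; case: o' => [[]|].
rewrite [RHS]sum_colours gtn_eqF //.
have -> : last true (take c (c2 s)) = (o != None).
  by rewrite -map_take E map_rcons last_rcons.
rewrite !rkE; case: (eqVneq o None) => [-> | o1] /=.
  rewrite /H IH (_ : count [pred _ | _] _ = count_mem None (take c s)) //.
  by apply: eq_count => -[[]|].
have -> : count [pred o | (o != None) == true] (take c s) = count (fun o => o != None) (take c s).
  by apply: eq_count => -[[]|].
rewrite sum_colours P_last // last_f //.
have -> : ob' (o == Some true) = o by case: (o) o1 => [[]|].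
rewrite /H IH rkE' (_ : count [pred _ | _ & _] _ = count_mem o (take c s)) //.
by apply: eq_count => o' /=; case: (o) o1 => [[]|] //; case: o' => [[]|].
Qed.

End Coassociativity.

Lemma sum_tsplit_assoc x (F : seq nat -> seq nat -> seq nat -> V) : tree_word 1 x ->
  \sum_(p <- tsplit [:: true] x) \sum_(q <- tsplit [::] p.2) F p.1 q.1 q.2 =
  \sum_(p <- tsplit [:: true] x) \sum_(q <- tsplit [:: true] p.1) F q.1 q.2 p.2.
Proof. exact: (@sum_tsplitA [:: Some true]). Qed.

End TreeWords.

Lemma rank_le t cs c : (rank t cs c <= count_mem t cs)%N.
Proof. by rewrite -[in X in (_ <= X)%N](cat_take_drop c cs) count_cat leq_addr. Qed.

Lemma tsplit_tree_word cs x p : p \in tsplit cs x ->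
  [/\ tree_word (count_mem true cs) p.1, tree_word (count_mem false cs) p.2
    & (size p.1 + size p.2)%N = size x].
Proof.
elim: x cs p => [|c x IH] cs p /=; first by rewrite inE => /eqP ->.
move=> /flattenP[_ /mapP[t _ ->] /mapP[q /IH[q1 q2 qs] ->]].
have := rank_le t cs c; move: q1 q2; rewrite -cats1 !count_cat /= !addn0.
by case: t => /=; rewrite ?addn0 ?addn1 => q1 q2 ->; rewrite ?addnS -?qs.
Qed.

Lemma fills_tree_word k x w : tree_word k x -> w \in fills k x ->
  tree_word k w /\ size w = size x.
Proof.
elim: x k w => [|c x IH] k w /=; first by rewrite inE => _ /eqP ->.
move=> /andP[ck xk] /flattenP[_ /mapP[d d_in ->] /mapP[u /(IH _ _ xk)[uk us] ->]] /=.
rewrite uk us andbT; split=> //; move: d_in; case: ifP => _; last by rewrite inE => /eqP ->.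
by rewrite -[_ :: _]/(iota 0 k.+1) mem_iota.
Qed.

Lemma grafts_tree_word k n x w : tree_word k x -> w \in grafts n x ->
  tree_word (n + k) w /\ size w = size x.
Proof.
elim: x k w => [|c x IH] k w /=; first by rewrite inE => _ /eqP ->.
move=> /andP[ck xk] /flattenP[_ /mapP[d d_in ->] /mapP[u /(IH _ _ xk)[uk us] ->]] /=.
rewrite -addnS uk us andbT; split=> //; move: d_in; case: ifP => _.
  by rewrite -[_ :: _]/(iota 0 n.+1) mem_iota add0n ltnS => /andP[_ dn]; exact: leq_trans dn (leq_addr _ _).
by rewrite inE => /eqP ->; rewrite addnC leq_add2l.
Qed.

Lemma tshift_tree_word k n x : tree_word k x -> tree_word (n + k) (tshift n x).
Proof.
elim: x k => [|c x IH] k //= /andP[ck xk]; rewrite -addnS IH // andbT.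
by case: ifP => // _; rewrite addnC leq_add2l.
Qed.

Lemma tree_word_cat k x y : tree_word k (x ++ y) = tree_word k x && tree_word (k + size x) y.
Proof. by elim: x k => [|c x IH] k /=; rewrite ?addn0 // IH addSnnS andbA. Qed.

(** * The free monoid of forests *)

Section TreeAlgebra.
Implicit Types (a b c : htree) (u v w : seq nat).

Lemma is_htreeE w : is_htree w = tree_word 0 w.
Proof.
suff E k : tree_word k w = all (fun i => nth 0%N w i <= k + i)%N (iota 0 (size w)) by rewrite E.
elim: w k => [|c w IH] k //=; rewrite addn0 IH (iotaDl 1 0) all_map; congr (_ && _).
by apply: eq_all => i /=; rewrite addSnnS.
Qed.

Definition t0 : htree := Sub [::] (isT : is_htree [::]).
Definition tw w : htree := insubd t0 w.

Lemma twK w : tree_word 0 w -> val (tw w) = w.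
Proof. by move=> ww; rewrite val_insubd is_htreeE ww. Qed.

Lemma val_tw a : tw (val a) = a. Proof. exact: valKd. Qed.

Lemma htreeP a : tree_word 0 (val a). Proof. by rewrite -is_htreeE; exact: valP a. Qed.

Lemma htree_vecE (K : fieldType) w : tree_word 0 w -> htree_vec K w = << tw w >>.
Proof. by rewrite -is_htreeE => ww; rewrite /htree_vec /tw /insubd insubT. Qed.

Lemma tw0 w : tree_word 0 w -> (tw w == t0) = (w == [::]).
Proof. by move=> ww; rewrite -val_eqE twK. Qed.

Lemma top_subproof a b : is_htree (val a ++ tshift (size (val a)) (val b)).
Proof.
rewrite is_htreeE tree_word_cat htreeP add0n.
by have := tshift_tree_word (size (val a)) (htreeP b); rewrite addn0.
Qed.

(* The forest [b] is put next to [a], with larger labels.                     *)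
Definition top a b : htree := Sub _ (top_subproof a b).

Lemma tw_cat u v : tree_word 0 u -> tree_word 0 v ->
  tw (u ++ tshift (size u) v) = top (tw u) (tw v).
Proof.
move=> ut vt; apply: val_inj; rewrite /= !twK // tree_word_cat ut add0n.
by have := tshift_tree_word (size u) vt; rewrite addn0.
Qed.

Definition tsize a := size (val a).

Lemma tshift0 w : tshift 0 w = w.
Proof. by rewrite -[RHS]map_id; apply: eq_map => c; case: c => // c; rewrite addn0. Qed.

Lemma tshift_tshift n m w : tshift n (tshift m w) = tshift (m + n) w.
Proof.
rewrite /tshift -map_comp; apply: eq_map => c /=; case: c => // c.
by rewrite addnA addn_eq0.
Qed.

Lemma top0 : left_id t0 top. Proof. by move=> a; apply: val_inj; rewrite /= tshift0. Qed.
Lemma top0r : right_id t0 top. Proof. by move=> a; apply: val_inj; rewrite /= cats0. Qed.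

Lemma topA : associative top.
Proof.
move=> a b c; apply: val_inj; rewrite /= size_cat size_map.
by rewrite [tshift _ (_ ++ _)]map_cat -/(tshift _ _) -/(tshift _ _) tshift_tshift catA addnC.
Qed.

Lemma tsizeM a b : tsize (top a b) = (tsize a + tsize b)%N.
Proof. by rewrite /tsize /= size_cat size_map. Qed.

Lemma tsize_eq0 a : tsize a = 0%N -> a = t0.
Proof. by move/size0nil => a0; apply: val_inj. Qed.

(** The first node, always a child of the root, is kept on the left: hence the initial colours
    [[:: true]] and the letter [0]. *)
Definition tcut a : seq (htree * htree) :=
  if val a is _ :: w then [seq (tw (0%N :: p.1), tw p.2) | p <- tsplit [:: true] w] else [::].

Definition tfull a :=
  if a == t0 then [:: (t0, t0)] else tcut a ++ [seq (p.2, p.1) | p <- tcut a].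

Lemma t0P a : a != t0 -> exists2 w, val a = 0%N :: w & tree_word 1 w.
Proof.
have := htreeP a; case Ea: (val a) => [|c w] /=; first by rewrite -val_eqE /= Ea.
by move=> /andP[]; rewrite leqn0 => /eqP -> wP _; exists w.
Qed.

Lemma tcutE a w : val a = 0%N :: w ->
  tcut a = [seq (tw (0%N :: p.1), tw p.2) | p <- tsplit [:: true] w].
Proof. by rewrite /tcut => ->. Qed.

Lemma tsplit1P w p : p \in tsplit [:: true] w ->
  [/\ tree_word 0 (0%N :: p.1), tree_word 0 p.2 & (size p.1 + size p.2)%N = size w].
Proof. by case/tsplit_tree_word. Qed.

Lemma tcut_in a p : p \in tcut a -> exists u v,
  [/\ p = (tw (0%N :: u), tw v), tree_word 0 (0%N :: u), tree_word 0 v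
    & ((size u).+1 + size v)%N = tsize a].
Proof.
rewrite /tcut /tsize; case: (val a) => // c w /mapP[q /tsplit1P[q1 q2 qs] ->].
by exists q.1, q.2; rewrite addSn qs.
Qed.

Lemma tcut_size a p : p \in tcut a -> (tsize p.1 + tsize p.2)%N = tsize a.
Proof. by case/tcut_in => u [v [-> u1 v1 <-]]; rewrite /tsize /= !twK. Qed.

Lemma tcut_neq0 a p : p \in tcut a -> p.1 != t0.
Proof. by case/tcut_in => u [v [-> u1 _ _]]; rewrite tw0. Qed.

Lemma tcut_full (V : nmodType) (F : htree -> V) a : a != t0 ->
  \sum_(p <- tcut a | p.2 == t0) F p.1 = F a.
Proof.
case/t0P => w aw wP; rewrite (tcutE aw) big_map.
have := @sum_tsplit_true _ 1 w (fun u => F (tw (0%N :: u))) wP.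
rewrite -aw val_tw => <-; rewrite big_seq_cond [RHS]big_seq_cond; apply: eq_bigl => p.
by case pw: (p \in _) => //=; have [_ p2 _] := tsplit1P pw; rewrite tw0.
Qed.

Lemma sum_tfull (V : nmodType) (F : htree -> htree -> V) a :
  \sum_(p <- tfull a) F p.1 p.2 = \sum_(p <- tsplit [::] (val a)) F (tw p.1) (tw p.2).
Proof.
rewrite /tfull; case: (eqVneq a t0) => [->|/t0P[w aw wP]].
  by rewrite big_seq1 sum_tsplit0 -[t0 in LHS]val_tw.
rewrite (tcutE aw) big_cat !big_map aw sum_tsplit_cons sum_colours /= rank0; congr (_ + _).
rewrite rank0 (@sum_tsplitC _ [:: false] w (fun u v => F (tw u) (tw (0%N :: v)))) //.
Qed.

Lemma tcut_top (V : nmodType) (F : htree -> htree -> V) a b : a != t0 ->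
  \sum_(p <- tcut (top a b)) F p.1 p.2 =
  \sum_(p <- tcut a) \sum_(q <- tfull b) F (top p.1 q.1) (top p.2 q.2).
Proof.
case/t0P => w aw wP.
have abw : val (top a b) = 0%N :: (w ++ tshift (1 + size w) (val b)) by rewrite /= aw.
rewrite (tcutE aw) (tcutE abw) !big_map /=.
rewrite (@sum_tsplit_cat _ [:: true] w (val b) (fun u v => F (tw (0%N :: u)) (tw v))) ?htreeP //.
apply: eq_big_seq => p /tsplit1P[p1 p2 _].
rewrite (sum_tfull (fun x y => F (top (tw (0%N :: p.1)) x) (top (tw p.2) y))).
apply: eq_big_seq => q /tsplit_tree_word[q1 q2 _].
by rewrite -!tw_cat.
Qed.

Lemma tcut_op (V : nmodType) (F : htree -> htree -> V) a b : a != t0 ->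
  (forall x y, ~~ irreducible top t0 x -> F x y = 0) ->
  \sum_(p <- tcut (top a b)) F p.1 p.2 = \sum_(p <- tcut a) F p.1 (top p.2 b).
Proof.
move=> a0; apply: (cut_op_of_full (full := tfull)) => //.
- exact: top0r.
- exact: tcut_neq0.
- by move=> G; exact: tcut_top.
move=> G; rewrite /tfull; case: (eqVneq b t0) => [->|b0]; first by rewrite big_mkcond big_seq1 eqxx.
rewrite big_cat big_map /= tcut_full // big_seq_cond big1 ?add0r // => p /andP[/tcut_neq0].
by move/negPf => ->.
Qed.

Lemma tcut_assoc (V : nmodType) (F : htree -> htree -> htree -> V) a : a != t0 ->
  \sum_(p <- tcut a) \sum_(q <- tfull p.2) F p.1 q.1 q.2 =
  \sum_(p <- tcut a) \sum_(q <- tcut p.1) F q.1 q.2 p.2.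
Proof.
case/t0P => w aw wP; rewrite (tcutE aw) !big_map /=.
transitivity (\sum_(p <- tsplit [:: true] w) \sum_(q <- tsplit [::] p.2)
    F (tw (0%N :: p.1)) (tw q.1) (tw q.2)).
  apply: eq_big_seq => p /tsplit1P[_ p2 _].
  by rewrite (sum_tfull (F _)) twK.
rewrite (sum_tsplit_assoc (fun u v t => F (tw (0%N :: u)) (tw v) (tw t))) //.
apply: eq_big_seq => p /tsplit1P[p1 _ _].
by rewrite (@tcutE _ p.1) ?twK // big_map.
Qed.

Variable K : fieldType.
Local Notation M := {malg K[htree]}.

Definition tree_split a : tensor M M :=
  \sum_(p <- tsplit [::] (val a)) (<< tw p.1 >> : M) ⊗ (<< tw p.2 >> : M).

(** The factors of [top] are exchanged because in the Grossman-Larson product it is the left factor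
    that is grafted on the right one and gets the larger labels. *)
Definition forest_hopf : hopf_data K :=
  free_hopf (fun a b => << top b a >> : M) << t0 >> tree_split (fun a => (val a == [::])%:R).

Lemma forest_iso : bialg_iso forest_hopf (word_hopf K (letter top t0)).
Proof.
apply: (@theta_iso_op _ top t0 tsize tcut top0 top0r topA tsizeM _ tsize_eq0
  tcut_size tcut_neq0 tcut_full tcut_op tfull) => //.
- exact: tcut_assoc.
- by move=> a a0; rewrite /tfull (negPf a0).
- by move=> a; rewrite (sum_tfull (fun x y => << x >> ⊗ << y >>)).
Qed.

End TreeAlgebra.

(** * The Grossman-Larson operations *)

Lemma index_filter_iota (P : pred nat) m n i : P i -> (m <= i < m + n)%N ->
  index i (filter P (iota m n)) = count P (iota m (i - m)).
Proof.
move=> Pi; elim: n m => [|n IH] m /=; first by lia.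
case: (eqVneq m i) => [->|mi]; first by rewrite Pi /= eqxx subnn.
move=> lt_i; rewrite (_ : (i - m)%N = (i - m.+1).+1) /=; last by lia.
by rewrite -IH; [case: ifP => //= _; rewrite (negPf mi) | lia].
Qed.

Lemma iota_rcons m n : iota m n.+1 = rcons (iota m n) (m + n)%N.
Proof. by rewrite -cats1 -addn1 iotaD. Qed.

Lemma count_iota_last (P : pred nat) c : (0 < c)%N -> P c ->
  count P (iota 1 c) = (count P (iota 1 (c - 1))).+1.
Proof.
case: c => // c _ Pc; rewrite subn1 iota_rcons -cats1 count_cat add1n.
by rewrite [count _ [:: _]]/= Pc addn1.
Qed.

Section RootChildren.
Variable x : seq nat.
Hypothesis xP : tree_word 0 x.

Lemma nth_tree_word k w i : tree_word k w -> (nth 0%N w i <= k + i)%N.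
Proof.
elim: w k i => [|c w IH] k [|i] //= /andP[ck wk]; first by rewrite addn0.
by rewrite -addSnnS; exact: IH.
Qed.

Lemma parent_lt i : (0 < i)%N -> (parent x i < i)%N.
Proof. by case: i => // i _; rewrite ltnS -[i in (_ <= i)%N]add0n; exact: nth_tree_word. Qed.

Let step j := if parent x j == 0%N then j else parent x j.

(** Parents have smaller labels, so [j] steps from [j] always reach a fixed point. *)
Let iter_step k m j : (j <= k)%N -> (j <= m)%N -> iter k step j = iter m step j.
Proof.
elim/ltn_ind: j k m => j IH k m jk jm.
case: (eqVneq (parent x j) 0%N) => [j0|j0].
  suff E n : iter n step j = j by rewrite !E.
  by elim: n => // n IHn; rewrite iterS IHn /step j0.
have jpos : (0 < j)%N by case: (j) j0.
have pj := parent_lt jpos.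
case: k jk => [|k] jk; first by lia.
case: m jm => [|m] jm; first by lia.
by rewrite !iterSr /step (negPf j0); apply: IH => //; lia.
Qed.

Lemma branchE i : branch x i = if parent x i == 0%N then i else branch x (parent x i).
Proof.
rewrite /branch -/step; case: (eqVneq (parent x i) 0%N) => [i0|i0].
  suff E n : iter n step i = i by rewrite E.
  by elim: n => // n IHn; rewrite iterS IHn /step i0.
have ipos : (0 < i)%N by case: (i) i0.
have pj := parent_lt ipos; case: i i0 ipos pj => // i i0 _ pj.
by rewrite iterSr /step (negPf i0); apply: iter_step => //; lia.
Qed.

Lemma branch_le i : (branch x i <= i)%N.
Proof.
elim/ltn_ind: i => i IH; rewrite branchE; case: ifP => // /negbT i0.
have ipos : (0 < i)%N by case: (i) i0.
by have := IH _ (parent_lt ipos); have := parent_lt ipos; lia.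
Qed.

Lemma mem_root_children i : (i \in root_children x) = (0 < i <= size x)%N && (parent x i == 0%N).
Proof. by rewrite mem_filter mem_iota add1n ltnS andbC. Qed.

Lemma branch_root_children i : (0 < i <= size x)%N -> branch x i \in root_children x.
Proof.
elim/ltn_ind: i => i IH /andP[i0 ix]; rewrite branchE; case: ifPn => pi.
  by rewrite mem_root_children i0 ix.
by apply: IH; rewrite ?lt0n ?pi ?parent_lt // (leq_trans (ltnW (parent_lt i0))).
Qed.

Definition subforest_word (S : seq nat) : seq nat :=
  let nodes := [seq i <- iota 1 (size x) | branch x i \in S] in
  [seq index (parent x i) (0%N :: nodes) | i <- nodes].

(** The parent of a selected node is the root or is selected, so its position is the number of
    selected nodes up to it. *)
Lemma subforest_wordE S : subforest_word S =
  [seq count (fun j => branch x j \in S) (iota 1 (parent x i)) |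
     i <- iota 1 (size x) & branch x i \in S].
Proof.
rewrite /subforest_word; apply/eq_in_map => i; rewrite mem_filter mem_iota add1n ltnS.
move=> /and3P[iS i0 ix] /=; have pi := parent_lt i0.
case: (eqVneq (parent x i) 0%N) => [->|p0]; first by [].
have pS : branch x (parent x i) \in S by move: iS; rewrite branchE (negPf p0).
rewrite index_filter_iota //; last by rewrite lt0n p0 /=; lia.
by rewrite -(@count_iota_last (fun j => branch x j \in S)) ?lt0n.
Qed.

Variable V : nmodType.

(** The words read off the nodes [k + 1] to [k + n] when [chi] colours the forest; their parents may
    come earlier. *)
Let W (chi : pred nat) k n : seq nat * seq nat :=
  ([seq count chi (iota 1 (parent x i)) | i <- iota k.+1 n & chi i],
   [seq count (predC chi) (iota 1 (parent x i)) | i <- iota k.+1 n & ~~ chi i]).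

Let W_cons (chi : pred nat) k n : W chi k n.+1 =
  tcons (chi k.+1) (count (if chi k.+1 then chi else predC chi) (iota 1 (parent x k.+1))) (W chi k.+1 n).
Proof. by rewrite /W /=; case: ifP. Qed.

Let rank_count (chi : pred nat) t k c : (c <= k)%N ->
  rank t (map chi (iota 1 k)) c = count (if t then chi else predC chi) (iota 1 c).
Proof.
move=> ck; rewrite /rank -map_take count_map take_iota (minn_idPl ck).
by case: t; apply: eq_count => i /=; case: (chi i).
Qed.

(** Induction along the nodes: those of [pre] are done, and [S] holds the root children chosen so
    far for the first part. A split of the later root children colours the trees that are still to
    start. *)
Lemma sum_splits_tsplit pre suf (S : seq nat) (F : seq nat * seq nat -> V) :
    x = pre ++ suf -> {in S, forall i, i <= size pre}%N ->
  \sum_(p <- splits [seq i <- iota (size pre).+1 (size suf) | parent x i == 0%N])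
     F (W [pred i | branch x i \in S ++ p.1] (size pre) (size suf)) =
  \sum_(p <- tsplit [seq branch x i \in S | i <- iota 1 (size pre)] suf) F p.
Proof.
elim: suf pre S F => [|c suf IH] pre S F xE Sle.
  by rewrite sum_tsplit0 sum_splits0.
set k := size pre; set cs := map _ _.
have pk : parent x k.+1 = c by rewrite /parent xE /= nth_cat ltnn subnn.
have xE' : x = rcons pre c ++ suf by rewrite cat_rcons.
have ck : (c <= k)%N by rewrite -ltnS -pk parent_lt.
(* Choices among later root children do not affect the nodes up to [k], since [branch x i <= i]. *)
have csE (r : seq nat) : {in r, forall i, k < i}%N ->
    cs = map [pred i | branch x i \in S ++ r] (iota 1 k).
  move=> r_gt; apply/eq_in_map => i; rewrite mem_iota add1n ltnS => /andP[_ ik] /=.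
  rewrite mem_cat; case: (boolP (branch x i \in r)) => [/r_gt|]; last by rewrite orbF.
  by have := branch_le i; lia.
have step_ t (r : seq nat) : {in r, forall i, k < i}%N -> (branch x k.+1 \in S ++ r) = t ->
    forall G, G (W [pred i | branch x i \in S ++ r] k (size suf).+1) =
    G (tcons t (rank t cs c) (W [pred i | branch x i \in S ++ r] k.+1 (size suf))) :> V.
  move=> r_gt kt G; rewrite W_cons /= kt pk (csE _ r_gt) rank_count //.
have suf_gt (r : seq nat * seq nat) : r \in splits [seq i <- iota k.+2 (size suf) | parent x i == 0%N] ->
    {in r.1, forall i, k.+1 < i}%N.
  case/subseq_splits => r1 _ _ i /(mem_subseq r1); rewrite mem_filter mem_iota.
  by case/and3P.
rewrite [size (c :: suf)]/= [iota k.+1 _]/= [filter _ _]/= pk sum_tsplit_cons sum_colours.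
have IHt S' t G : {in S', forall i, i <= k.+1}%N ->
    [seq branch x i \in S' | i <- iota 1 k.+1] = rcons cs t ->
    \sum_(p <- splits [seq i <- iota k.+2 (size suf) | parent x i == 0%N])
      G (W [pred i | branch x i \in S' ++ p.1] k.+1 (size suf)) =
    \sum_(p <- tsplit (rcons cs t) suf) G p :> V.
  move=> S'_le <-; have := IH (rcons pre c) S' G xE'; rewrite size_rcons -/k; exact.
have iota_k S' : [seq branch x i \in S' | i <- iota 1 k.+1] =
    rcons [seq branch x i \in S' | i <- iota 1 k] (branch x k.+1 \in S').
  by rewrite iota_rcons map_rcons add1n.
case: (eqVneq c 0%N) => [c0|c0].
  have bk : branch x k.+1 = k.+1 by rewrite branchE pk c0.
  have kS : k.+1 \notin S by apply/negP => /Sle; rewrite ltnn.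
  rewrite sum_splits_cons /=; congr (_ + _).
    rewrite -(IHt (rcons S k.+1)) => [||].
    - apply: eq_big_seq => p /suf_gt p_gt.
      rewrite (step_ true (k.+1 :: p.1)) ?cat_rcons // => [i|].
        by rewrite inE => /predU1P[->|/p_gt/ltnW].
      by rewrite bk mem_cat mem_head orbT.
    - by move=> i; rewrite mem_rcons inE => /predU1P[->|/Sle/leqW].
    rewrite iota_k bk mem_rcons mem_head; congr rcons.
    by rewrite -cats1 -csE // => i; rewrite inE => /eqP ->.
  rewrite -(IHt S) => [||].
  - apply: eq_big_seq => p /suf_gt p_gt.
    rewrite (step_ false p.1) // => [i /p_gt/ltnW //|].
    by rewrite bk mem_cat (negPf kS); apply/negP => /p_gt; rewrite ltnn.
  - by move=> i /Sle/leqW.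
  by rewrite iota_k bk (negPf kS).
have bk : branch x k.+1 = branch x c by rewrite branchE pk (negPf c0).
have -> : last true (take c cs) = (branch x c \in S).
  rewrite /cs -map_take take_iota (minn_idPl ck); case: (c) c0 => // c' _.
  by rewrite iota_rcons map_rcons last_rcons add1n.
rewrite -(IHt S) => [||].
- apply: eq_big_seq => p /suf_gt p_gt.
  rewrite (step_ (branch x c \in S) p.1) // => [i /p_gt/ltnW //|].
  rewrite bk mem_cat; case: (boolP (branch x c \in p.1)) => [/p_gt|]; last by rewrite orbF.
  by have := branch_le c; lia.
- by move=> i /Sle/leqW.
by rewrite iota_k bk.
Qed.

Lemma sum_subforests (F : seq nat -> seq nat -> V) :
  \sum_(I : {set 'I_(size (root_children x))}) F (subforest I) (subforest (~: I)) =
  \sum_(p <- tsplit [::] x) F p.1 p.2.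
Proof.
rewrite -(sum_splits_tsplit (pre := [::]) (S := [::]) (fun p => F p.1 p.2)) //=.
rewrite [LHS](sum_sets_splits 0%N (root_children x) (fun u v => F (subforest_word u) (subforest_word v))).
apply: eq_big_seq => p /subseq_splits[p1 p2 pp].
(* [p.1] and [p.2] are complementary lists of root children, and each node belongs to the tree of
   just one of them. *)
have compl i : (0 < i <= size x)%N -> (branch x i \in p.2) = (branch x i \notin p.1).
  move=> /branch_root_children; rewrite -(perm_mem pp) mem_cat.
  have : uniq (p.1 ++ p.2) by rewrite (perm_uniq pp) filter_uniq ?iota_uniq.
  rewrite cat_uniq => /and3P[_ /hasPn p12 _]; case: (boolP (_ \in p.1)) => //= i1 _.
  by apply/negP => /p12; rewrite /= i1.
rewrite !subforest_wordE; congr F.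
have -> : [seq i <- iota 1 (size x) | branch x i \in p.2] =
    [seq i <- iota 1 (size x) | branch x i \notin p.1].
  by apply: eq_in_filter => i; rewrite mem_iota add1n ltnS => /compl.
apply/eq_in_map => i; rewrite mem_filter mem_iota add1n ltnS => /and3P[_ i0 ix].
apply: eq_in_count => j; rewrite mem_iota add1n ltnS => /andP[j0 jp]; apply: compl.
by rewrite j0 (leq_trans jp) // (leq_trans _ ix) // ltnW // parent_lt.
Qed.

End RootChildren.

Section Grafts.
Variable V : nmodType.

Lemma seqs_map (X Y : Type) (h : X -> Y) n r : seqs n (map h r) = [seq map h s | s <- seqs n r].
Proof.
elim: n => [|n IH] //=; rewrite IH allpairs_mapl allpairs_mapr map_allpairs.
by [].
Qed.

(** [s] lists the new parents of the root children in order; the number of letters [0] before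
    position [j] tells which of them is at [j]. *)
Definition graft_word n x (s : seq nat) : seq nat :=
  mkseq (fun j => let c := nth 0%N x j in
     if c == 0%N then nth 0%N s (count_mem 0%N (take j x)) else (c + n)%N) (size x).

Lemma sum_graft_words n x (F : seq nat -> V) :
  \sum_(s <- seqs (count_mem 0%N x) (iota 0 n.+1)) F (graft_word n x s) =
  \sum_(w <- grafts n x) F w.
Proof.
elim: x F => [|c x IH] F; first by rewrite !big_seq1.
have mk s : graft_word n (c :: x) s =
    (if c == 0%N then nth 0%N s 0 else (c + n)%N) :: graft_word n x (if c == 0%N then behead s else s).
  rewrite /graft_word /mkseq /= -[1%N]/(1 + 0)%N iotaDl -map_comp; congr (_ :: _).
  apply: eq_map => j /=; case: eqP => // _; case: (c == 0%N); rewrite ?add0n ?add1n //=.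
  by case: s => //=; rewrite !nth_nil.
rewrite sum_grafts_cons -[count_mem _ _]/((c == 0%N) + count_mem 0%N x)%N.
case: (eqVneq c 0%N) mk => [_|c0] mk.
  rewrite add1n sum_seqsS; apply: eq_bigr => d _; rewrite -(IH (F \o cons d)).
  by apply: eq_bigr => s _; rewrite mk.
by rewrite add0n big_seq1 -(IH (F \o cons _)); apply: eq_bigr => s _; rewrite mk.
Qed.

Lemma size_root_children x : size (root_children x) = count_mem 0%N x.
Proof.
rewrite size_filter.
rewrite -[x in RHS](mkseq_nth 0%N) /mkseq count_map (iotaDl 1 0) count_map.
by apply: eq_count => j.
Qed.

Lemma graftE x y (f : {ffun 'I_(size (root_children x)) -> 'I_(size y).+1}) :
  graft f = y ++ graft_word (size y) x (map val (codom f)).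
Proof.
rewrite /graft; congr (_ ++ _); rewrite /graft_word /mkseq (iotaDl 1 0) -map_comp.
apply/eq_in_map => j; rewrite mem_iota add0n => /andP[_ jx] /=.
rewrite -[parent x (1 + j)]/(nth 0%N x j); case: ifP => // j0; congr nth.
  by rewrite /codom /image_mem -map_comp.
rewrite /root_children index_filter_iota; [|exact: j0|by rewrite !add1n !ltnS].
rewrite addnC addnK (iotaDl 1 0) count_map -[x in RHS](mkseq_nth 0%N) /mkseq -map_take take_iota.
by rewrite (minn_idPl (ltnW jx)) count_map; apply: eq_count.
Qed.

Lemma sum_gl_prod x n (F : seq nat -> V) y : size y = n ->
  \sum_(f : {ffun 'I_(size (root_children x)) -> 'I_(size y).+1}) F (graft f) =
  \sum_(w <- grafts n x) F (y ++ w).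
Proof.
move=> <-; rewrite -(sum_graft_words _ _ (fun w => F (y ++ w))) -size_root_children.
rewrite -val_enum_ord seqs_map big_map.
rewrite -(sum_ffun_seqs _ xpredT (fun s => F (y ++ graft_word (size y) x (map val s)))).
by apply: eq_bigr => f _; rewrite graftE.
Qed.

Lemma sum_fills_cat k u v (F : seq nat -> V) :
  \sum_(w <- fills k (u ++ v)) F w =
  \sum_(u' <- fills k u) \sum_(v' <- fills (k + size u) v) F (u' ++ v').
Proof.
elim: u k F => [|c u IH] k F; first by rewrite sum_fills0 addn0.
rewrite cat_cons !sum_fills_cons; apply: eq_bigr => d _.
by rewrite (IH k.+1 (F \o cons d)) /= addSnnS.
Qed.

(** The first term leaves every tree at the root; any other one has fewer root children. This makes
    reattachment unitriangular. *)
Lemma fills_head k x : exists2 s, fills k x = x :: s &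
  {in s, forall w, count_mem 0%N w < count_mem 0%N x}%N.
Proof.
elim: x k => [|c x IH] k; first by exists [::].
have [s E s_lt] := IH k.+1; rewrite /= E.
have le_x w : w \in x :: s -> (count_mem 0%N w <= count_mem 0%N x)%N.
  by rewrite inE => /predU1P[-> //|/s_lt/ltnW].
case: (eqVneq c 0%N) => [->|c0].
  exists ([seq 0%N :: w | w <- s] ++ flatten [seq [seq d :: w | w <- x :: s] | d <- iota 1 k]) => // w.
  rewrite mem_cat => /orP[/mapP[u /s_lt us ->]|]; first by rewrite /= ltn_add2l.
  case/flattenP => _ /mapP[d + ->] /mapP[u /le_x us ->]; rewrite mem_iota.
  by case: d => //= d _; rewrite add0n add1n ltnS.
rewrite /= cats0; exists [seq c :: w | w <- s] => // w /mapP[u /s_lt us ->] /=.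
by rewrite (negPf c0) !add0n us.
Qed.

End Grafts.

(** * From juxtaposition to the Grossman-Larson product *)

Section FillMap.
Variable K : fieldType.
Local Notation C := (forest_hopf K).
Local Notation G := (grossman_larson K).
Implicit Types (a b : htree).

Lemma gl_hm a b : (<< a >> : G) ∙ << b >> =
  \sum_(w <- grafts (size (val b)) (val a)) htree_vec K (val b ++ w).
Proof. by rewrite free_hm -(sum_gl_prod _ (htree_vec K) (erefl (size (val b)))). Qed.

Lemma gl_hd a : hd (<< a >> : G) = tree_split K a.
Proof.
rewrite free_hd /gl_coprod pureE.
rewrite (sum_subforests (htreeP a) (fun u v => (htree_vec K u : G) ⊗ (htree_vec K v : G))).
apply: eq_big_seq => p /tsplit_tree_word[p1 p2 _].
by rewrite !htree_vecE.
Qed.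

Definition fill_map : C -> G :=
  mlin (fun a => \sum_(w <- fills 0 (val a)) (<< tw w >> : {malg K[htree]})).

Lemma fill_map_linear : linear fill_map. Proof. exact: mlin_linear. Qed.

Lemma fill_mapU a : fill_map << a >> = \sum_(w <- fills 0 (val a)) (<< tw w >> : G).
Proof. exact: mlinU. Qed.

Lemma fill_map_bijective : bijective fill_map.
Proof.
apply: (@unitriangular_bijective K _ _ fill_map id (fun a => count_mem 0%N (val a))
  (fun a => map tw (behead (fills 0 (val a))))).
- exact: fill_map_linear.
- by move=> a; exists a.
- move=> a; rewrite fill_mapU; have [s -> _] := fills_head 0 (val a).
  by rewrite big_cons big_map val_tw.
move=> a b; have [s As s_lt] := fills_head 0 (val a); rewrite As /= => /mapP[w ws ->].
have [wP _] : tree_word 0 w /\ size w = size (val a).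
  by apply: fills_tree_word (htreeP a) _; rewrite As inE ws orbT.
by rewrite twK // s_lt.
Qed.

Lemma fill_map_morphism : bialg_morphism fill_map.
Proof.
have fL := fill_map_linear.
apply: free_bialg_morphism => // [a b||a|a].
- rewrite [in LHS]free_hm !fill_mapU /= sum_fills_cat.
  rewrite (linear_sums ((hm_bilinear G).1 _)).
  under [RHS]eq_bigr do rewrite (linear_sums ((hm_bilinear G).2 _)).
  rewrite [RHS]exchange_big; apply: eq_big_seq => v v_in.
  have [vP vs] := fills_tree_word (htreeP b) v_in.
  (* Reattaching the trees of [a] within the whole forest is reattaching them inside [a] and then
     grafting the remaining root children on the forest of [b]. *)
  have := @sum_fills_grafts _ 0 (size (val b)) (val a) (fun w => << tw (v ++ w) >> : G).
  rewrite addn0 add0n => <-; apply: eq_big_seq => u u_in.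
  have [uP us] := fills_tree_word (htreeP a) u_in.
  rewrite gl_hm !twK // vs; apply: eq_big_seq => w w_in.
  have [wP _] := grafts_tree_word uP w_in.
  by rewrite htree_vecE // tree_word_cat vP add0n vs; rewrite addn0 in wP.
- rewrite [in LHS]free_h1 [in RHS]free_h1 [LHS]fill_mapU.
  by rewrite (_ : fills 0 (val t0) = [:: [::]]) // big_seq1 htree_vecE.
- rewrite [in RHS]free_hd [in LHS]fill_mapU [LHS](linear_sums (@hd_linear _ G)).
  rewrite [RHS](linear_sums (tmapP fL fL)).
  transitivity (\sum_(w <- fills 0 (val a)) \sum_(p <- tsplit [::] w)
      ((<< tw p.1 >> : G) ⊗ (<< tw p.2 >> : G))).
    apply: eq_big_seq => w /(fills_tree_word (htreeP a))[wP _].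
    by rewrite gl_hd /tree_split twK.
  rewrite (@sum_fills_tsplit _ [::] (val a) (fun u v => (<< tw u >> : G) ⊗ (<< tw v >> : G))); last exact: htreeP.
  apply: eq_big_seq => p /tsplit_tree_word[p1 p2 _].
  rewrite tmap_pure // !fill_mapU !twK //.
  rewrite (linear_sums (pure_linearl _)); apply: eq_bigr => u _.
  by rewrite (linear_sums (pure_linearr _)).
- rewrite [in RHS]free_he [in LHS]fill_mapU [LHS](linear_sums (@he_linear _ G)).
  case: (eqVneq (val a) [::]) => [->|a0]; first by rewrite big_seq1 free_he twK.
  rewrite big_seq big1 // => w /(fills_tree_word (htreeP a))[wP ws].
  by rewrite free_he twK // -size_eq0 ws size_eq0 (negPf a0).
Qed.

Lemma word_GL_iso : bialg_iso (word_hopf K (letter top t0)) G.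
Proof.
apply: bialg_iso_trans (bialg_iso_sym (forest_iso K)) _.
by exists fill_map; [exact: fill_map_bijective | exact: fill_map_morphism].
Qed.

End FillMap.

(** * Change of alphabet *)

Section AlphabetChange.
Variables (K : fieldType) (A B : choiceType) (g : A -> B).
Local Notation WA := (word_hopf K A).
Local Notation WB := (word_hopf K B).

Definition relabel : WA -> WB := mlin (fun w => << map g w >> : WB).

Lemma relabelU w : relabel << w >> = << map g w >>. Proof. exact: mlinU. Qed.

Lemma relabel_linear : linear relabel. Proof. exact: mlin_linear. Qed.

Lemma relabel_morphism : bialg_morphism relabel.
Proof.
have rL := relabel_linear.
apply: free_bialg_morphism => // [u v||w|w].
- by rewrite [in LHS]word_hm !relabelU word_hm map_cat.
- by rewrite [in LHS]word_h1 [in RHS]word_h1 relabelU.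
- rewrite relabelU [in LHS]word_hd [in RHS]word_hd [RHS](linear_sums (tmapP rL rL)).
  rewrite splits_map big_map; apply: eq_bigr => p _.
  by rewrite tmap_pure // !relabelU.
- by rewrite relabelU word_he [RHS]word_he; case: w.
Qed.

End AlphabetChange.

Lemma word_hopf_bij (K : fieldType) (A B : choiceType) (g : A -> B) :
  bijective g -> bialg_iso (word_hopf K A) (word_hopf K B).
Proof.
case=> h gK hK; exists (@relabel K _ _ g); last exact: relabel_morphism.
exists (@relabel K _ _ h); apply: malg_ext.
- exact: (linear_comp (@relabel_linear K _ _ g) (@relabel_linear K _ _ h)).
- by [].
- by move=> w; rewrite !relabelU mapK.
- exact: (linear_comp (@relabel_linear K _ _ h) (@relabel_linear K _ _ g)).
- by [].
- by move=> w; rewrite !relabelU mapK.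
Qed.

(** Cantor-Bernstein, applied to the injections obtained by passing through [nat] in both
    directions. *)
Lemma denumerable_bij (A B : choiceType) (a : A -> nat) (a' : nat -> A) (b : B -> nat) (b' : nat -> B) :
  injective a -> injective a' -> injective b -> injective b' -> exists g : A -> B, bijective g.
Proof.
have key (X Y : Type) (x : X -> nat) (y : nat -> Y) : injective x -> injective y ->
    (@classical_sets.setT X #<= @classical_sets.setT Y)%card.
  move=> xI yI.
  have yxI : injective (y \o x) by exact: inj_comp.
  have := @inj_card_eq _ _ (@classical_sets.setT X) (y \o x) (in2W yxI).
  rewrite card_eq_le => /andP[_ le]; apply: card_le_trans le _.
  exact: subset_card_le.
move=> aI a'I bI b'I; have := Cantor_Bernstein (key _ _ _ _ aI b'I) (key _ _ _ _ bI a'I).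
case/card_bijP => f [f' fK f'K].
exists (fun x => val (f (to_setT x))); exists (fun y => val (f' (to_setT y))) => x.
  by rewrite (_ : to_setT _ = f (to_setT x)) ?fK //; exact: val_inj.
by rewrite (_ : to_setT _ = f' (to_setT x)) ?f'K //; exact: val_inj.
Qed.

Lemma rev_iota_perm n : is_perm_word (rev (iota 1 n)).
Proof. by rewrite /is_perm_word size_rev size_iota perm_rev. Qed.

(** In a nontrivial shifted concatenation some letter precedes a larger one, whereas this word is
    decreasing. *)
Lemma rev_iota_irreducible n : irreducible pshift p0 (pw (rev (iota 1 n.+1))).
Proof.
have E0 := pwK (rev_iota_perm n.+1); apply/andP; split.
  by rewrite -val_eqE E0 -size_eq0 size_rev.
apply/asboolP => b c /(congr1 val); rewrite E0 => E.
case Eb: (val b) => [|x s]; first by left; apply: val_inj.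
case Ec: (val c) => [|y t]; [by right; apply: val_inj | exfalso].
have : sorted gtn (rev (iota 1 n.+1)) by rewrite rev_sorted; exact: iota_ltn_sorted.
rewrite E sorted_pairwise; last by move=> ? ? ? /= ab bc; exact: ltn_trans bc ab.
rewrite pairwise_cat => /andP[/allrelP/(_ x (y + size (val b))%N) gt_xy _].
have xb : x \in val b by rewrite Eb mem_head.
have yc : (y + size (val b))%N \in up (size (val b)) (val c) by rewrite Ec mem_head.
by have := gt_xy xb yc; rewrite /= ltnNge (ltnW (shift_lt xb yc)).
Qed.

Lemma iota_tree_word n k : tree_word k (iota k n).
Proof. by elim: n k => [|n IH] k //=; rewrite leqnn IH. Qed.

(** The word encodes a path, hence a single tree. In a nontrivial juxtaposition the first letter of
    the second forest is a further [0]. *)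
Lemma iota_irreducible n : irreducible top t0 (tw (iota 0 n.+1)).
Proof.
have E0 := twK (iota_tree_word n.+1 0); apply/andP; split.
  by rewrite -val_eqE E0.
apply/asboolP => b c /(congr1 val); rewrite E0 => E.
case Eb: (val b) => [|x s]; first by left; apply: val_inj.
have cP := htreeP c; case Ec: (val c) cP => [|y t]; first by right; apply: val_inj.
rewrite /= leqn0 => /andP[/eqP y0 _]; exfalso.
have lt_b : (size (val b) < n.+1)%N.
  by move/(congr1 size): E; rewrite size_iota size_cat size_map Ec /= => ->; rewrite addnS ltnS leq_addr.
move/(congr1 (fun w => nth 0%N w (size (val b)))): E.
by rewrite nth_iota // nth_cat ltnn subnn Ec /= y0 Eb.
Qed.

Lemma letters_bij : exists g : letter pshift p0 -> letter top t0, bijective g.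
Proof.
have sizeK (T : Type) (f : nat -> seq T) : (forall n, size (f n) = n.+1) -> injective f.
  by move=> fs i j /(congr1 size); rewrite !fs => -[].
pose a n : letter pshift p0 := Sub _ (rev_iota_irreducible n).
pose b n : letter top t0 := Sub _ (iota_irreducible n).
apply: (@denumerable_bij _ _ (fun v : letter pshift p0 => choice.pickle (val (val v))) a
  (fun v : letter top t0 => choice.pickle (val (val v))) b).
- by move=> u v /(pcan_inj choice.pickleK)/val_inj/val_inj.
- move=> i j /(congr1 val)/(congr1 val).
  rewrite [LHS](pwK (rev_iota_perm _)) [RHS](pwK (rev_iota_perm _)).
  by apply: (sizeK _ (fun n => rev (iota 1 n.+1))) => n; rewrite size_rev size_iota.
- by move=> u v /(pcan_inj choice.pickleK)/val_inj/val_inj.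
- move=> i j /(congr1 val)/(congr1 val).
  rewrite [LHS](twK (iota_tree_word _ _)) [RHS](twK (iota_tree_word _ _)).
  by apply: (sizeK _ (fun n => iota 0 n.+1)) => n; rewrite size_iota.
Qed.

Lemma KS_grossman_larson (K : fieldType) : hopf_isomorphic (KS K) (grossman_larson K).
Proof.
apply: hopf_isomorphic_of; first exact: is_hopf_algebra_iso (word_KS_iso K) (word_hopfP _ _).
have [g gbij] := letters_bij.
apply: bialg_iso_trans (bialg_iso_sym (word_KS_iso K)) _.
exact: bialg_iso_trans (word_hopf_bij K gbij) (word_GL_iso K).
Qed.

(** * The Malvenuto-Reutenauer algebra *)

Lemma cuts_head (T : Type) (s : seq T) : cuts s = ([::], s) :: behead (cuts s).
Proof. by case: s. Qed.

Section Cuts.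
Variables (T : Type) (V : nmodType).
Implicit Types (s t : seq T).

Lemma sum_cuts_cons x s (F : seq T -> seq T -> V) :
  \sum_(q <- cuts (x :: s)) F q.1 q.2 = F [::] (x :: s) + \sum_(q <- cuts s) F (x :: q.1) q.2.
Proof. by rewrite /= big_cons big_map. Qed.

Lemma sum_cuts_take s (F : seq T -> seq T -> V) :
  \sum_(i < (size s).+1) F (take i s) (drop i s) = \sum_(q <- cuts s) F q.1 q.2.
Proof.
elim: s F => [|x s IH] F; first by rewrite big_ord1 big_seq1.
by rewrite big_ord_recl sum_cuts_cons -(IH (fun u v => F (x :: u) v)).
Qed.

Lemma sum_cuts_cat s t (F : seq T -> seq T -> V) :
  \sum_(q <- cuts (s ++ t)) F q.1 q.2 =
  \sum_(q <- cuts s) F q.1 (q.2 ++ t) + \sum_(q <- behead (cuts t)) F (s ++ q.1) q.2.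
Proof.
elim: s F => [|x s IH] F; first by rewrite big_seq1 [in LHS]cuts_head big_cons.
rewrite cat_cons sum_cuts_cons (IH (fun u v => F (x :: u) v)) addrA.
by rewrite (sum_cuts_cons x s (fun u v => F u (v ++ t))).
Qed.

Lemma sum_cutsA s (F : seq T -> seq T -> seq T -> V) :
  \sum_(p <- cuts s) \sum_(q <- cuts p.2) F p.1 q.1 q.2 =
  \sum_(p <- cuts s) \sum_(q <- cuts p.1) F q.1 q.2 p.2.
Proof.
elim: s F => [|x s IH] F; first by rewrite !big_seq1.
rewrite (sum_cuts_cons x s (fun u v => \sum_(q <- cuts v) F u q.1 q.2)).
rewrite (sum_cuts_cons x s (fun u v => \sum_(q <- cuts u) F q.1 q.2 v)) big_seq1.
rewrite (sum_cuts_cons x s (F [::])) (IH (fun u => F (x :: u))) -addrA; congr (_ + _).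
rewrite -big_split; apply: eq_bigr => p _.
by rewrite (sum_cuts_cons x p.1 (fun u v => F u v p.2)).
Qed.

Lemma sum_cuts_full s (F : seq T -> V) : \sum_(q <- cuts s | nilp q.2) F q.1 = F s.
Proof.
elim: s F => [|x s IH] F; first by rewrite big_mkcond big_seq1.
by rewrite /= big_cons big_map (IH (F \o cons x)).
Qed.

End Cuts.

Lemma cuts_map (T U : Type) (f : T -> U) s :
  cuts (map f s) = [seq (map f q.1, map f q.2) | q <- cuts s].
Proof. by elim: s => [|x s IH] //=; rewrite IH -!map_comp. Qed.

Lemma cuts_cat (T : eqType) (s : seq T) q : q \in cuts s -> s = q.1 ++ q.2.
Proof.
elim: s q => [|x s IH] q /=; first by rewrite inE => /eqP ->.
by rewrite inE => /predU1P[-> //|/mapP[r /IH -> ->]].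
Qed.

Lemma behead_cuts (T : eqType) (s : seq T) q : q \in behead (cuts s) ->
  s = q.1 ++ q.2 /\ q.1 != [::].
Proof.
case: s => [|x s] //= /mapP[r /cuts_cat -> ->].
by [].
Qed.

Section Shuffles.
Variable V : nmodType.
Implicit Types (u v w : seq nat).

Lemma shuffles0 v : shuffles [::] v = [:: v]. Proof. by case: v. Qed.
Lemma shuffles0r u : shuffles u [::] = [:: u]. Proof. by case: u. Qed.

Lemma sum_shuffles_cons x u v (F : seq nat -> V) :
  \sum_(w <- shuffles (x :: u) v) F w =
  \sum_(w <- shuffles u v) F (x :: w) +
  (if v is y :: v' then \sum_(w <- shuffles (x :: u) v') F (y :: w) else 0).
Proof.
case: v => [|y v]; first by rewrite !shuffles0r !big_seq1 addr0.
by rewrite [shuffles _ _]/= big_cat !big_map.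
Qed.

Lemma shuffles_map (f : nat -> nat) u v :
  shuffles (map f u) (map f v) = [seq map f w | w <- shuffles u v].
Proof.
elim: u v => [|x u IHu] v; first by rewrite !shuffles0.
elim: v => [|y v IHv] //=; rewrite map_cat -!map_comp /= in IHv *.
rewrite IHv -[f y :: _]/(map f (y :: v)) IHu -!map_comp.
by congr (_ ++ _); apply: eq_map.
Qed.

Lemma shuffles_perm u v w : w \in shuffles u v -> perm_eq w (u ++ v).
Proof.
elim: u v w => [|x u IHu] v w; first by rewrite shuffles0 inE => /eqP ->.
elim: v w => [|y v IHv] w; first by rewrite shuffles0r inE cats0 => /eqP ->.
rewrite /= mem_cat => /orP[] /mapP[z + ->].
  by move/IHu => zP; rewrite perm_cons.
move/IHv => zP; rewrite -[x :: _]/((x :: u) ++ [:: y] ++ v) perm_sym perm_catCA /=.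
by rewrite perm_cons perm_sym.
Qed.

(** A prefix of a shuffle is a shuffle of a prefix of [u] with a prefix of [v], and the rest
    shuffles what remains. *)
Lemma sum_shuffles_cuts u v (F : seq nat -> seq nat -> V) :
  \sum_(w <- shuffles u v) \sum_(q <- cuts w) F q.1 q.2 =
  \sum_(p <- cuts u) \sum_(q <- cuts v)
    \sum_(w <- shuffles p.1 q.1) \sum_(w' <- shuffles p.2 q.2) F w w'.
Proof.
elim: u v F => [|x u IHu] v F.
  rewrite shuffles0 !big_seq1; apply: eq_bigr => q _.
  by rewrite !shuffles0 !big_seq1.
elim: v F => [|y v IHv] F.
  rewrite shuffles0r big_seq1; apply: eq_bigr => q _.
  by rewrite big_seq1 !shuffles0r !big_seq1.
pose G p1 p2 q1 q2 := \sum_(w <- shuffles p1 q1) \sum_(w' <- shuffles p2 q2) F w w'.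
rewrite sum_shuffles_cons.
under eq_bigr do rewrite sum_cuts_cons.
under [X in _ + X = _]eq_bigr do rewrite sum_cuts_cons.
rewrite !big_split /= (IHu (y :: v) (fun w w' => F (x :: w) w')) (IHv (fun w w' => F (y :: w) w')).
rewrite -[RHS]/(\sum_(p <- cuts (x :: u)) \sum_(q <- cuts (y :: v)) G p.1 p.2 q.1 q.2).
rewrite (sum_cuts_cons x u (fun p1 p2 => \sum_(q <- cuts (y :: v)) G p1 p2 q.1 q.2)).
rewrite (sum_cuts_cons y v (G [::] (x :: u))).
have G0 : G [::] (x :: u) [::] (y :: v) = \sum_(w <- shuffles u (y :: v)) F [::] (x :: w) +
    \sum_(w <- shuffles (x :: u) v) F [::] (y :: w).
  by rewrite /G big_seq1 sum_shuffles_cons.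
rewrite G0 addrACA -!addrA; congr (_ + (_ + _)).
rewrite (sum_cuts_cons x u (fun p1 p2 => \sum_(q <- cuts v) \sum_(w <- shuffles p1 q.1)
  \sum_(w' <- shuffles p2 q.2) F (y :: w) w')).
rewrite addrCA; congr (_ + _).
  by apply: eq_bigr => q _; rewrite /G !shuffles0 !big_seq1.
rewrite -big_split; apply: eq_bigr => p _ /=.
rewrite (sum_cuts_cons y v (fun q1 q2 => \sum_(w <- shuffles p.1 q1) \sum_(w' <- shuffles p.2 q2) F (x :: w) w')).
rewrite (sum_cuts_cons y v (fun q1 q2 => G (x :: p.1) p.2 q1 q2)) -addrA; congr (_ + _).
  by rewrite /G !shuffles0r !big_seq1.
rewrite -big_split; apply: eq_bigr => q _ /=.
by rewrite /G [RHS]sum_shuffles_cons.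
Qed.

Lemma st_shuffles u v : uniq (u ++ v) -> {in u & v, forall x y, (x < y)%N} ->
  map st (shuffles u v) = shuffles (st u) (up (size u) (st v)).
Proof.
move=> uuv uv; pose f x := (below (u ++ v) x).+1.
have [Eu Ev] : map f u = st u /\ map f v = up (size u) (st v).
  have := st_cat uv; rewrite stE map_cat => /eqP; rewrite eqseq_cat ?size_map ?size_st //.
  by case/andP => /eqP-> /eqP->.
rewrite -Eu -Ev shuffles_map; apply/eq_in_map => w /shuffles_perm wP.
by rewrite stE; apply: eq_map => x; rewrite (st_perm wP).
Qed.

End Shuffles.

Section MalvenutoReutenauer.
Implicit Types (a b c : perm_word).

Definition mr_full a := [seq (pst q.1, pst q.2) | q <- cuts (val a)].
(** Only the cut with empty left part is dropped, so that left factors are nontrivial. *)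
Definition mr_cut a := [seq (pst q.1, pst q.2) | q <- behead (cuts (val a))].

Lemma pst_nil : pst [::] = p0. Proof. exact: (pst_val p0). Qed.

Lemma mr_full0 : mr_full p0 = [:: (p0, p0)].
Proof. by rewrite /mr_full /= pst_nil. Qed.

Lemma mr_fullE a : a != p0 -> mr_full a = (p0, a) :: mr_cut a.
Proof. by rewrite /mr_full cuts_head /= pst_nil pst_val. Qed.

Lemma mr_cut_in a p : p \in mr_cut a -> exists u v, [/\ val a = u ++ v,
  u != [::], uniq u && uniq v & p = (pst u, pst v)].
Proof.
case/mapP => q /behead_cuts[aq q0] ->; exists q.1, q.2; split=> //.
by have := perm_uniqP a; rewrite aq cat_uniq => /and3P[-> _ ->].
Qed.

Lemma mr_cut_size a p : p \in mr_cut a -> (psize p.1 + psize p.2)%N = psize a.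
Proof.
case/mr_cut_in => u [v [auv _ /andP[uu uv] ->]].
by rewrite /psize /= !val_pst // !size_st auv size_cat.
Qed.

Lemma mr_cut_neq0 a p : p \in mr_cut a -> p.1 != p0.
Proof. by case/mr_cut_in => u [v [_ u0 /andP[uu _] ->]]; rewrite pst0. Qed.

Lemma mr_cut_full (V : nmodType) (F : perm_word -> V) a : a != p0 ->
  \sum_(p <- mr_cut a | p.2 == p0) F p.1 = F a.
Proof.
move=> a0; rewrite big_map -[in RHS](pst_val a) -[RHS](sum_cuts_full (val a) (fun w => F (pst w))).
rewrite [in RHS]cuts_head big_cons /nilp size_eq0 (negPf (a0 : val a != [::])).
rewrite big_seq_cond [RHS]big_seq_cond; apply: eq_bigl => q /=.
case qa: (q \in _) => //=; have [aq _] : val a = q.1 ++ q.2 /\ _ := behead_cuts qa.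
by rewrite pst0 ?size_eq0 //; have := perm_uniqP a; rewrite aq cat_uniq => /and3P[].
Qed.

(** A cut beyond [a] has a left factor of the form [pst (val a ++ q.1)] with [q.1] nonempty, the
    product of [a] and [pst q.1], which is reducible. *)
Lemma mr_cut_op (V : nmodType) (F : perm_word -> perm_word -> V) a b : a != p0 ->
  (forall x y, ~~ irreducible pshift p0 x -> F x y = 0) ->
  \sum_(p <- mr_cut (pshift a b)) F p.1 p.2 = \sum_(p <- mr_cut a) F p.1 (pshift p.2 b).
Proof.
move=> a0 F0; rewrite !big_map; pose n := size (val a).
have a0' : val a != [::] := a0; have cat0 q : q \in behead (cuts (up n (val b))) ->
    F (pst (val a ++ q.1)) (pst q.2) = 0.
  case/behead_cuts => bq q0; apply/F0.
  have sq : {subset q.1 <= up n (val b)} by rewrite bq => x xq; rewrite mem_cat xq.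
  have uaq : uniq (val a ++ q.1).
    by have := perm_uniqP (pshift a b); rewrite /= -/n bq catA cat_uniq => /andP[].
  rewrite pst_cat // ?pst_val; last by move=> x y xa /sq; exact: shift_lt.
  apply: irreducible_op; rewrite // pst0 //.
  by move: uaq; rewrite cat_uniq => /and3P[].
have := sum_cuts_cat (val a) (up n (val b)) (fun u v => F (pst u) (pst v)).
rewrite [X in _ = _ + X]big_seq [X in _ = _ + X]big1 ?addr0; last exact: cat0.
rewrite [in X in X = _ -> _]cuts_head [in X in _ = X -> _]cuts_head !big_cons /= pst_nil.
rewrite (F0 p0) ?(F0 p0) ?add0r; try by rewrite /irreducible eqxx.
move=> ->; apply: eq_big_seq => q qa.
have [aq _] : val a = q.1 ++ q.2 /\ _ := behead_cuts qa.
congr (F _ _); have sq : {subset q.2 <= val a} by rewrite aq => x xq; rewrite mem_cat xq orbT.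
rewrite pst_cat ?pst_up ?pst_val //; last by move=> x y /sq; exact: shift_lt.
by have := perm_uniqP (pshift a b); rewrite /= -/n aq -catA cat_uniq => /and3P[].
Qed.

Lemma mr_full_pst w : uniq w -> mr_full (pst w) = [seq (pst q.1, pst q.2) | q <- cuts w].
Proof.
move=> uw; rewrite /mr_full val_pst // stE cuts_map -map_comp.
apply/eq_in_map => q /cuts_cat wq /=; congr pair; rewrite /pst st_map //;
  apply: mono_onS (@st_mono _) => x xq; by rewrite wq mem_cat xq ?orbT.
Qed.

Lemma mr_cut_pst w : uniq w -> mr_cut (pst w) = [seq (pst q.1, pst q.2) | q <- behead (cuts w)].
Proof.
by move=> uw; rewrite /mr_cut -behead_map [map _ _](mr_full_pst uw) behead_map.
Qed.

Lemma mr_cut_assoc (V : nmodType) (F : perm_word -> perm_word -> perm_word -> V) a : a != p0 ->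
  \sum_(p <- mr_cut a) \sum_(q <- mr_full p.2) F p.1 q.1 q.2 =
  \sum_(p <- mr_cut a) \sum_(q <- mr_cut p.1) F q.1 q.2 p.2.
Proof.
move=> a0; rewrite !big_map; have ua := perm_uniqP a.
case Ea: (val a) => [|x s]; first by rewrite !big_nil.
rewrite /= !big_map /=.
transitivity (\sum_(p <- cuts s) \sum_(q <- cuts p.2) F (pst (x :: p.1)) (pst q.1) (pst q.2)).
  apply: eq_big_seq => p /cuts_cat sp.
  rewrite mr_full_pst ?big_map //.
  by move: ua; rewrite Ea sp -cat_cons cat_uniq => /and3P[].
rewrite (sum_cutsA s (fun u v t => F (pst (x :: u)) (pst v) (pst t))).
apply: eq_big_seq => p /cuts_cat sp.
have up : uniq (x :: p.1) by move: ua; rewrite Ea sp -cat_cons cat_uniq => /and3P[].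
by rewrite mr_cut_pst //= !big_map.
Qed.

End MalvenutoReutenauer.

(** * The coradical filtration of a cofree coalgebra *)

Section Span.
Variables (K : fieldType) (U : lmodType K).

Lemma mem_span (P : U -> Prop) x : P x -> x \in span P.
Proof. by move=> Px; apply/asboolP => S; exact. Qed.

Lemma span_sub (P : U -> Prop) (S : subspace U) x :
  (forall y, P y -> y \in S) -> x \in span P -> x \in S.
Proof. by move=> PS /asboolP; exact. Qed.

Lemma kernel_closed (X : lmodType K) (f : U -> X) : linear f -> submod_closed [pred x | f x == 0].
Proof.
move=> fL; split=> [|a u v]; rewrite !inE ?(linear_0 fL) //.
by move=> /eqP fu /eqP fv; rewrite fL fu fv scaler0 addr0.
Qed.

Lemma span_kernel (X : lmodType K) (P : U -> Prop) (f : U -> X) x : linear f ->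
  (forall y, P y -> f y = 0) -> x \in span P -> f x = 0.
Proof.
move=> fL fP; move/(span_sub (S := Subspace (kernel_closed fL))) => xS.
by apply/eqP/xS => y /fP /eqP.
Qed.

End Span.

Section MalgTensors.
Variables (K : fieldType) (A B : choiceType).

Lemma coef_linear (T : choiceType) (a : T) : linear (fun z : {malg K[T]} => z@_a : K^o).
Proof. by move=> c u v /=; rewrite mcoeffD mcoeffZ. Qed.

Lemma mul_bilinear (U V : lmodType K) (f : U -> K^o) (g : V -> K^o) :
  linear f -> linear g -> is_bilinear (fun x y => f x * g y : K^o).
Proof.
move=> fL gL; split=> z c u v; first by rewrite fL mulrDl scalerAl.
by rewrite gL mulrDr scalerAr.
Qed.

Definition coef2 (a : A) (b : B) : tensor {malg K[A]} {malg K[B]} -> K^o :=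
  tlft (fun (x : {malg K[A]}) (y : {malg K[B]}) => x@_a * y@_b : K^o).

Lemma coef2P a b : linear (coef2 a b).
Proof. exact: tliftP (mul_bilinear (@coef_linear _ a) (@coef_linear _ b)). Qed.

Lemma coef2_pure a b x y : coef2 a b (x ⊗ y) = x@_a * y@_b.
Proof. exact: (tliftE (mul_bilinear (@coef_linear _ a) (@coef_linear _ b))). Qed.

(** [e] induces a map from the tensor product to the space with basis the pairs, and [f] is a left
    inverse of it; so a tensor is determined by its coefficients. *)
Lemma coef2_ext s t : (forall a b, coef2 a b s = coef2 a b t) -> s = t.
Proof.
pose T := {malg K[(A * B)%type]}.
have [e [eP eU]] : exists e : {malg K[A]} -> {malg K[B]} -> T,
    is_bilinear e /\ forall a b, e << a >> << b >> = << (a, b) >>.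
  exists (fun x y => mlin (fun a => mlin (fun b => << (a, b) >> : T) y) x).
  split=> [|a b]; last by rewrite !mlinU.
  split=> z c u v; first exact: mlin_linear.
  rewrite /mlin scaler_sumr -big_split; apply: eq_bigr => a _ /=.
  by rewrite -!/(mlin _ _) mlin_linear scalerDr !scalerA mulrC.
have [f [fL fU]] : exists f : T -> tensor {malg K[A]} {malg K[B]},
    linear f /\ forall a b, f << (a, b) >> = << a >> ⊗ << b >>.
  exists (mlin (fun p => << p.1 >> ⊗ << p.2 >>)).
  by split=> [|a b]; [exact: mlin_linear | rewrite mlinU].
have feK z : f (tlft e z) = z.
  move: z; apply: tensor_ext; [exact: linear_comp (tliftP eP) fL | by [] |].
  move=> x y; rewrite (tliftE eP); move: x; apply: malg_ext => [||a].
  - exact: linear_comp (eP.1 y) fL.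
  - exact: pure_linearl.
  move: y; apply: malg_ext => [||b].
  - exact: linear_comp (eP.2 _) fL.
  - exact: pure_linearr.
  by rewrite eU fU.
have coefE a b z : (tlft e z)@_(a, b) = coef2 a b z.
  have abL := @coef_linear _ (a, b); have bilP := mul_bilinear (@coef_linear _ a) (@coef_linear _ b).
  apply: (@tensor_ext _ _ _ K^o (fun z => (tlft e z)@_(a, b)) (coef2 a b)).
  - exact: linear_comp (tliftP eP) abL.
  - exact: coef2P.
  move=> x y; rewrite (tliftE eP) coef2_pure.
  apply: (@malg_ext _ _ K^o (fun x => (e x y)@_(a, b)) (fun x => x@_a * y@_b)) => [||a'].
  - exact: linear_comp (eP.1 y) abL.
  - exact: bilP.1.
  apply: (@malg_ext _ _ K^o (fun y => (e _ y)@_(a, b)) (fun y => _ * y@_b)) => [||b'].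
  - exact: linear_comp (eP.2 _) abL.
  - exact: bilP.2.
  rewrite eU !mcoeffU xpair_eqE.
  by case: eqP; case: eqP; rewrite ?mulr1 ?mulr0.
move=> st; rewrite -[s]feK -[t]feK; congr f; apply/malgP => -[a b].
by rewrite !coefE.
Qed.

End MalgTensors.

Section WordCounts.
Variables (R : nzSemiRingType) (V : eqType).
Implicit Types (u v w : seq V).

(* The multiplicity of [w] in the shuffle of [u] and [v].                     *)
Definition shuffle_count u v w : R := \sum_(p <- splits w) (p.1 == u)%:R * (p.2 == v)%:R.

Lemma shuffle_count_size u v w : (size u + size v)%N != size w -> shuffle_count u v w = 0.
Proof.
move=> uvw; rewrite /shuffle_count big_seq big1 // => p /subseq_splits[_ _ /perm_size].
rewrite size_cat => pw; case: eqP => [pu|_]; last by rewrite mul0r.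
by case: eqP => [pv|_]; [rewrite -pu -pv pw eqxx in uvw | rewrite mulr0].
Qed.

Lemma shuffle_count_cons u v c w : shuffle_count u v (c :: w) =
  (if u is d :: u' then (c == d)%:R * shuffle_count u' v w else 0) +
  (if v is d :: v' then (c == d)%:R * shuffle_count u v' w else 0).
Proof.
rewrite /shuffle_count sum_splits_cons /=; congr (_ + _).
  case: u => [|d u]; first by rewrite big1 // => p _; rewrite mul0r.
  rewrite big_distrr; apply: eq_bigr => p _ /=; rewrite eqseq_cons mulrA.
  by case: eqP; rewrite ?mul0r ?mul1r.
case: v => [|d v]; first by rewrite big1 // => p _; rewrite mulr0.
rewrite big_distrr; apply: eq_bigr => p _ /=; rewrite eqseq_cons.
by case: (c == d); rewrite ?mul0r ?mul1r ?mulr0.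
Qed.

Lemma sum_cuts_eq u v w :
  \sum_(q <- cuts w) (q.1 == u)%:R * (q.2 == v)%:R = (w == u ++ v)%:R :> R.
Proof.
elim: w u => [|c w IH] u; first by rewrite big_seq1; case: u => [|d u]; rewrite ?mul1r ?mul0r.
rewrite (sum_cuts_cons c w (fun x y => (x == u)%:R * (y == v)%:R)).
case: u => [|d u].
  by rewrite eqxx mul1r big1 ?addr0 // => q _; rewrite mul0r.
rewrite [_ == d :: u]/= mul0r add0r cat_cons eqseq_cons.
under eq_bigr do rewrite eqseq_cons; case: eqP => [_|_] /=; first exact: IH.
by rewrite big1 // => q _; rewrite mul0r.
Qed.

Lemma sum_cuts_nil w (F : seq V -> R) : \sum_(q <- cuts w) (q.1 == [::])%:R * F q.2 = F w.
Proof.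
case: w => [|c w]; first by rewrite big_seq1 mul1r.
rewrite (sum_cuts_cons c w (fun x y => (x == [::])%:R * F y)) mul1r big1 ?addr0 // => q _.
by rewrite mul0r.
Qed.

Lemma sum_cuts_letter c w (F : seq V -> R) :
  \sum_(q <- cuts w) (q.1 == [:: c])%:R * F q.2 =
  if w is d :: w' then (c == d)%:R * F w' else 0.
Proof.
case: w => [|d w]; first by rewrite big_seq1 mul0r.
rewrite (sum_cuts_cons d w (fun x y => (x == [:: c])%:R * F y)) mul0r add0r.
rewrite -(sum_cuts_nil w (fun z => (c == d)%:R * F z)); apply: eq_bigr => q _.
by rewrite eqseq_cons [d == c]eq_sym; case: (c == d); case: (q.1 == [::]); rewrite ?mul1r ?mul0r.
Qed.

End WordCounts.

Section Deconcatenation.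
Variables (K : fieldType) (V : choiceType).
Local Notation W := {malg K[seq V]}.

Definition word_cuts : W -> tensor W W :=
  mlin (fun w => \sum_(q <- cuts w) (<< q.1 >> : W) ⊗ (<< q.2 >> : W)).

Lemma word_cuts_linear : linear word_cuts. Proof. exact: mlin_linear. Qed.

Lemma word_cutsU w :
  word_cuts << w >> = \sum_(q <- cuts w) (<< q.1 >> : W) ⊗ (<< q.2 >> : W).
Proof. exact: mlinU. Qed.

Lemma coef2_word_cuts u v z : coef2 u v (word_cuts z) = z@_(u ++ v).
Proof.
apply: (@malg_ext _ _ K^o (fun z => coef2 u v (word_cuts z)) (fun z => z@_(u ++ v))) => [||w].
- exact: linear_comp word_cuts_linear (coef2P _ _).
- exact: coef_linear.
rewrite word_cutsU (linear_sums (coef2P _ _)) mcoeffU.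
rewrite -[RHS](sum_cuts_eq K u v w); apply: eq_bigr => q _.
by rewrite coef2_pure !mcoeffU.
Qed.

End Deconcatenation.

Section CofreeFiltration.
Variables (K : fieldType) (H : hopf_data K) (V : choiceType).
Local Notation W := {malg K[seq V]}.
Variables (L : H -> W) (Li : W -> H).
Hypotheses (LL : linear L) (LK : cancel L Li) (LiK : cancel Li L).
Hypothesis L1 : L h1 = << [::] >>.
Hypothesis Lhd : forall x, tmap L L (hd x) = word_cuts (L x).
Hypotheses (m1l : forall x : H, h1 ∙ x = x) (m1r : forall x : H, x ∙ h1 = x).
Hypothesis hdM : forall x y : H, hd (x ∙ y) =
  tlft (fun x1 x2 => tlft (fun y1 y2 => (x1 ∙ y1) ⊗ (x2 ∙ y2)) (hd y)) (hd x).
Implicit Types (x y : H) (u v w : seq V).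

Let LiL : linear Li.
Proof. exact: (@can_linear _ _ _ (linear_of LL)). Qed.

Definition wcoef w x : K^o := (L x)@_w.
Definition wvec w : H := Li << w >>.

Lemma wcoef_linear w : linear (wcoef w).
Proof. exact: linear_comp LL (@coef_linear _ _ w). Qed.

Lemma wcoef_wvec u w : wcoef u (wvec w) = (w == u)%:R.
Proof. by rewrite /wcoef /wvec LiK mcoeffU. Qed.

Lemma wvec0 : wvec [::] = h1. Proof. by rewrite /wvec -L1 LK. Qed.

Lemma wvec_sum x : x = \sum_(w <- msupp (L x)) wcoef w x *: wvec w.
Proof.
rewrite -[LHS]LK [L x in LHS]malg_sumU (linear_sums LiL).
by apply: eq_bigr => w _; rewrite (linear_Z LiL).
Qed.

Lemma wcoef_ext x y : (forall w, wcoef w x = wcoef w y) -> x = y.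
Proof. by move=> xy; rewrite -[x]LK -[y]LK; congr Li; apply/malgP. Qed.

Lemma wcoef2_bilinear u v : is_bilinear (fun x y => wcoef u x * wcoef v y : K^o).
Proof. exact: mul_bilinear (wcoef_linear _) (wcoef_linear _). Qed.

(** Among all words only [u ++ v] has the cut [(u, v)], so its coefficient can be read on the
    coproduct. *)
Lemma wcoef_cat u v x : wcoef (u ++ v) x =
  tlft (fun x1 x2 => wcoef u x1 * wcoef v x2 : K^o) (hd x).
Proof.
rewrite /wcoef -coef2_word_cuts -Lhd /coef2 [LHS](tlift_tmap LL LL) //.
exact: mul_bilinear (@coef_linear _ _ u) (@coef_linear _ _ v).
Qed.

Lemma hd_wvec w : hd (wvec w) = \sum_(q <- cuts w) wvec q.1 ⊗ wvec q.2.
Proof.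
rewrite -[LHS](tmapK LL LiL LL LiL LK LK) Lhd /wvec LiK word_cutsU (linear_sums (tmapP LiL LiL)).
by apply: eq_bigr => q _; rewrite tmap_pure.
Qed.

Lemma tlft_hd_wvec (X : lmodType K) (b : H -> H -> X) w : is_bilinear b ->
  tlft b (hd (wvec w)) = \sum_(q <- cuts w) b (wvec q.1) (wvec q.2).
Proof.
move=> bP; rewrite hd_wvec (linear_sums (tliftP bP)).
by apply: eq_bigr => q _; rewrite (tliftE bP).
Qed.

Lemma wcoef_cat_mul u v s t : wcoef (u ++ v) (wvec s ∙ wvec t) =
  \sum_(p <- cuts s) \sum_(q <- cuts t)
    wcoef u (wvec p.1 ∙ wvec q.1) * wcoef v (wvec p.2 ∙ wvec q.2).
Proof.
have bP := wcoef2_bilinear u v.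
rewrite wcoef_cat hdM [LHS](linear_tlift _ _ (tliftP bP)).
have xP : is_bilinear (fun x1 x2 => tlft (fun x y => wcoef u x * wcoef v y : K^o)
    (tlft (fun y1 y2 => (x1 ∙ y1) ⊗ (x2 ∙ y2)) (hd (wvec t)))).
  exact: is_bilinear_post (comulM_bilinear _) (tliftP bP).
rewrite [LHS](tlft_hd_wvec _ xP); apply: eq_bigr => p _.
rewrite [LHS](linear_tlift _ _ (tliftP bP)).
have yP : is_bilinear (fun y1 y2 => tlft (fun x y => wcoef u x * wcoef v y : K^o)
    ((wvec p.1 ∙ y1) ⊗ (wvec p.2 ∙ y2))).
  exact: is_bilinear_post (comulM_bilinearr _ _) (tliftP bP).
by rewrite [LHS](tlft_hd_wvec _ yP); apply: eq_bigr => q _; rewrite (tliftE bP).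
Qed.

(* In top degree the product is the shuffle product; the induction compares   *)
(* the coefficients of [c :: w] by cutting after the first letter, and only   *)
(* the cuts of [u] and [v] whose left parts have total length 1 contribute.   *)
Lemma wcoef_mul_wvec u v w : (size u + size v <= size w)%N ->
  wcoef w (wvec u ∙ wvec v) = shuffle_count K u v w.
Proof.
elim: w u v => [|c w IH] u v.
  rewrite leqn0 addn_eq0 !size_eq0 => /andP[/eqP-> /eqP->].
  by rewrite wvec0 m1l -wvec0 wcoef_wvec /shuffle_count big_seq1 mulr1.
move=> uvw; rewrite -[c :: w]/([:: c] ++ w) wcoef_cat_mul [RHS]shuffle_count_cons.
have <- : \sum_(p <- cuts u) (p.1 == [:: c])%:R * (\sum_(q <- cuts v) (q.1 == [::])%:R *
      shuffle_count K p.2 q.2 w) =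
    (if u is d :: u' then (c == d)%:R * shuffle_count K u' v w else 0).
  under eq_bigr do rewrite (sum_cuts_nil v (fun v' => shuffle_count K _ v' w)).
  exact: (sum_cuts_letter c u (fun u' => shuffle_count K u' v w)).
have <- : \sum_(p <- cuts u) (p.1 == [::])%:R * (\sum_(q <- cuts v) (q.1 == [:: c])%:R *
      shuffle_count K p.2 q.2 w) =
    (if v is d :: v' then (c == d)%:R * shuffle_count K u v' w else 0).
  rewrite (sum_cuts_nil u (fun u' => \sum_(q <- cuts v) (q.1 == [:: c])%:R * shuffle_count K u' q.2 w)).
  exact: (sum_cuts_letter c v (fun v' => shuffle_count K u v' w)).
rewrite -big_split; apply: eq_big_seq => p /cuts_cat up /=.
rewrite !big_distrr -big_split; apply: eq_big_seq => q /cuts_cat vq /=.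
have us : size u = (size p.1 + size p.2)%N by rewrite up size_cat.
have vs : size v = (size q.1 + size q.2)%N by rewrite vq size_cat.
move: uvw; rewrite us vs; case: p {up us} => -[|a p1] p2; case: q {vq vs} => -[|b q1] q2 /= le_w.
- by rewrite wvec0 m1l -wvec0 wcoef_wvec /= !mul0r !mulr0 addr0.
- rewrite wvec0 m1l wcoef_wvec mul0r add0r mul1r.
  by case: eqP => [[_ q10]|_]; rewrite ?mul0r // mul1r IH ?mul1r //; move: le_w; rewrite q10 /=; lia.
- rewrite wvec0 m1r wcoef_wvec mul1r mul0r addr0.
  by case: eqP => [[_ p10]|_]; rewrite ?mul0r // IH ?mul1r //; move: le_w; rewrite p10 /=; lia.
rewrite IH; last by lia.
have n0 : (size p2 + size q2 != size w)%N.
  move: le_w; rewrite !addSn ltnS addnS addnACA neq_ltn => le_w.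
  by apply/orP; left; apply: leq_ltn_trans le_w; exact: leq_addl.
by rewrite !(shuffle_count_size _ n0) !(mulr0, mul0r) addr0.
Qed.

Definition length_le k x := forall w, (k < size w)%N -> wcoef w x = 0.

Lemma length_leP k x w : length_le k x -> w \in msupp (L x) -> (size w <= k)%N.
Proof. by move=> xk; rewrite -mcoeff_neq0 leqNgt; apply: contra => /xk/eqP. Qed.

Lemma wcoef_sum u x : wcoef u x = \sum_(w <- msupp (L x)) wcoef w x * (w == u)%:R.
Proof.
rewrite {1}[x]wvec_sum (linear_sums (wcoef_linear u)); apply: eq_bigr => w _.
by rewrite (linear_Z (wcoef_linear u)) wcoef_wvec.
Qed.

(** The bilinear extension of [wcoef_mul_wvec]: the words of [x] and [y] are short enough for it to
    apply to each pair. *)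
Lemma wcoef_mul i j x y w : length_le i x -> length_le j y -> (i + j <= size w)%N ->
  wcoef w (x ∙ y) = \sum_(p <- splits w) wcoef p.1 x * wcoef p.2 y.
Proof.
move=> xi yj ijw.
transitivity (\sum_(u <- msupp (L x)) \sum_(v <- msupp (L y))
    wcoef u x * (wcoef v y * shuffle_count K u v w)).
  rewrite {1}[x]wvec_sum (linear_sums (hmr_linear y)) (linear_sums (wcoef_linear w)).
  apply: eq_big_seq => u /(length_leP xi) ui.
  rewrite {1}[y]wvec_sum.
  rewrite (linear_sums (hml_linear _)) (linear_sums (wcoef_linear w)).
  apply: eq_big_seq => v /(length_leP yj) vj.
  rewrite (linear_Z (hmr_linear _)) (linear_Z (hml_linear _)) !(linear_Z (wcoef_linear _)).
  by rewrite wcoef_mul_wvec // (leq_trans _ ijw) // leq_add.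
under eq_bigr do under eq_bigr do rewrite /shuffle_count !big_distrr.
under eq_bigr do rewrite exchange_big.
rewrite exchange_big; apply: eq_bigr => p _ /=.
rewrite [wcoef p.1 x]wcoef_sum [wcoef p.2 y]wcoef_sum big_distrl; apply: eq_bigr => u _ /=.
rewrite big_distrr; apply: eq_bigr => v _ /=.
by rewrite [u == _]eq_sym [v == _]eq_sym mulrACA mulrA.
Qed.

Lemma length_le_mul i j x y : length_le i x -> length_le j y -> length_le (i + j) (x ∙ y).
Proof.
move=> xi yj w ijw; rewrite (wcoef_mul xi yj (ltnW ijw)) big_seq big1 // => p.
case/subseq_splits => _ _ /perm_size; rewrite size_cat => pw.
have [ip|pi] := ltnP i (size p.1); first by rewrite xi ?mul0r.
rewrite yj ?mulr0 // -(ltn_add2l i); apply: leq_trans ijw _.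
by rewrite -pw leq_add2r.
Qed.

(** The coefficient at [c :: w] is the functional given by [[:: c]] and [w] on the coproduct. If [w]
    is longer than [k], it kills the wedge, since [[:: c]] kills the unit and [w] kills [corad H k].
    Conversely, a cut of a word of length at most [k + 1] is empty on the left or has a right part
    of length at most [k]. *)
Lemma coradP k x : x \in corad H k <-> length_le k x.
Proof.
elim: k x => [|k IH] x; split.
- move=> x0 w w0; apply: (span_kernel (wcoef_linear w)) x0 => _ <-.
  rewrite h1E -wvec0 wcoef_wvec; by case: w w0.
- move=> x0; have -> : x = wcoef [::] x *: hone H.
    apply: wcoef_ext => w; rewrite (linear_Z (wcoef_linear w)) h1E -wvec0 wcoef_wvec.
    case: w => [|c w]; first exact: esym (mulr1 _).
    by rewrite scaler0 x0.
  by apply: rpredZ; apply: mem_span.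
- move=> xk; have {}xk : hcomul H x \in wedge (corad H k) (span (eq (hone H))) := xk.
  move=> w kw; case: w kw => [|c w] // kw.
  rewrite -[c :: w]/([:: c] ++ w) wcoef_cat -hdE.
  have bP := wcoef2_bilinear [:: c] w.
  apply: (span_kernel (tliftP bP)) xk => _ [y [z [yz ->]]].
  rewrite pureE (tliftE bP); case: yz => [/IH zk|y1]; first by rewrite zk ?mulr0.
  rewrite (span_kernel (wcoef_linear _) _ y1) ?mul0r // => _ <-.
  by rewrite h1E -wvec0 wcoef_wvec.
move=> xk; rewrite -[_ \in _]/(hcomul H x \in wedge (corad H k) (span (eq (hone H)))).
rewrite hdE [x]wvec_sum (linear_sums (@hd_linear _ H)).
rewrite big_seq; apply: rpred_sum => w /(length_leP xk) wk.
rewrite (linear_Z (@hd_linear _ H)); apply: rpredZ; rewrite hd_wvec big_seq.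
apply: rpred_sum => q /cuts_cat wq; apply: mem_span; rewrite -pureE.
exists (wvec q.1), (wvec q.2); split=> //.
case Eq: q.1 => [|c u]; first by right; rewrite wvec0 -h1E; exact: mem_span.
left; apply/IH => v qv; rewrite wcoef_wvec; case: eqP qv => // <-.
by move: wk; rewrite wq Eq size_cat /=; lia.
Qed.

End CofreeFiltration.

(** * The associated graded algebra and its dual *)

(** To know that an operation defined by description has its property, it is enough to exhibit one
    linear map that has it. *)
Lemma the_linearP (K : fieldType) (U X : lmodType K) (Q : {linear U -> X} -> Prop) (f : U -> X)
  (fL : linear f) : Q (linear_of fL) -> Q (the_linear Q).
Proof. by move=> Qf; rewrite /the_linear; case: pselect => [e|[]]; [case: cid | exists (linear_of fL)]. Qed.

Section AssociatedGraded.
Variables (K : fieldType) (H : hopf_data K) (V : choiceType).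
Local Notation W := {malg K[seq V]}.
Variables (P : seq V -> H -> K^o) (M : seq V -> H).
Hypothesis PL : forall w, linear (P w).
Hypothesis PM : forall u w, P u (M w) = (w == u)%:R.
Hypothesis P_ext : forall x y, (forall w, P w x = P w y) -> x = y.
Hypothesis P_fin : forall x, exists s : seq (seq V), forall w, w \notin s -> P w x = 0.
Hypothesis coradP : forall k x, x \in corad H k <-> (forall w, (k < size w)%N -> P w x = 0).
Hypothesis P_mul : forall i j x y w, x \in corad H i -> y \in corad H j -> (i + j <= size w)%N ->
  P w (x ∙ y) = \sum_(p <- splits w) P p.1 x * P p.2 y.
Hypothesis corad_mul : forall i j x y, x \in corad H i -> y \in corad H j ->
  x ∙ y \in corad H (i + j).
Hypothesis hd_M : forall w, hd (M w) = \sum_(q <- cuts w) M q.1 ⊗ M q.2.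
Hypothesis P_cat : forall u v x, P (u ++ v) x =
  tlft (fun x1 x2 => P u x1 * P v x2 : K^o) (hd x).
Hypothesis M0 : M [::] = h1.
Hypothesis P0 : forall x, P [::] x = he x.

Local Notation G := (gr_hopf H).
Local Notation cls := (gr_cls (corad H)).
Implicit Types (x y : H) (u v w : seq V) (g h : G).

Lemma corad_M w : M w \in corad H (size w).
Proof. by apply/coradP => u wu; rewrite PM; case: eqP wu => // ->; rewrite ltnn. Qed.

(** Read on a representative. The choice is immaterial by [kappa_qcls]: at index [size w] two
    representatives differ by an element of the previous filtration step (by zero at index [0]), and
    [P w] vanishes there. *)
Definition kappa w g : K^o := P w (val (qrepr g) (size w)).

Lemma kappa_qcls w f : kappa w (qcls (Subspace (fam_prev_closed (corad H))) f) = P w (val f (size w)).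
Proof.
rewrite /kappa; have : qrepr (qcls (Subspace (fam_prev_closed (corad H))) f) - f \in
    Subspace (fam_prev_closed (corad H)) by apply/qclsP; rewrite qreprK.
set f' := qrepr _; case/andP => /eqP f0 /asboolP fS.
have E k : val (f' - f) k = val f' k - val f k by [].
apply/eqP; rewrite -subr_eq0 -scaleN1r -(linear_Z (PL w)) -(linear_D (PL w)) scaleN1r; apply/eqP.
rewrite -E; case Ew: (size w) => [|k]; first by rewrite f0 (linear_0 (PL w)).
by have /coradP := fS k; apply; rewrite Ew.
Qed.

Lemma kappa_linear w : linear (kappa w).
Proof.
move=> a g h; rewrite -[in LHS](qreprK g) -[in LHS](qreprK h) -(qcls_linear _ a) kappa_qcls.
exact: PL.
Qed.

Lemma fam_single k x : x \in corad H k ->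
  (fun j => if j == k then x else 0) \in Subspace (fam_closed (corad H)).
Proof.
move=> xk; apply/asboolP; split=> [|j]; last by case: eqP => [->|_] //; exact: rpred0.
by exists k.+1 => j kj; case: eqP kj => // ->; rewrite ltnn.
Qed.

Lemma kappa_cls w k x : x \in corad H k ->
  kappa w (cls k x) = if size w == k then P w x else 0.
Proof.
move=> xk; rewrite /gr_cls kappa_qcls val_insubd fam_single //.
by case: eqP => // _; exact: linear_0.
Qed.

(** When these coordinates vanish, the component at index [k] has no word of length [k] or more, so
    it lies in the previous filtration step. *)
Lemma kappa_eq0 g : (forall w, kappa w g = 0) -> g = 0.
Proof.
rewrite -[g]qreprK; move: (qrepr g) => f g0.
rewrite -(linear_0 (@qcls_linear _ _ (Subspace (fam_prev_closed (corad H))))); apply/qclsP.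
rewrite subr0; have /asboolP[_ fk] := valP f.
apply/andP; split.
  apply/eqP/P_ext => w; rewrite (linear_0 (PL w)).
  case: (posnP (size w)) => [/size0nil ->|w0].
    by have := g0 [::]; rewrite kappa_qcls.
  by have /coradP := fk 0%N; apply.
apply/asboolP => k; apply/coradP => w; rewrite leq_eqVlt => /predU1P[kw|].
  by have := g0 w; rewrite kappa_qcls -kw.
by have /coradP := fk k.+1; apply.
Qed.

Lemma kappa_ext g h : (forall w, kappa w g = kappa w h) -> g = h.
Proof.
move=> gh; apply/eqP; rewrite -subr_eq0; apply/eqP/kappa_eq0 => w.
by rewrite (linear_D (kappa_linear w)) -scaleN1r (linear_Z (kappa_linear w)) scaleN1r gh subrr.
Qed.

Definition gvec : W -> G := mlin (fun w => cls (size w) (M w) : G).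

Lemma gvec_linear : linear gvec. Proof. exact: mlin_linear. Qed.

Lemma gvecU w : gvec << w >> = cls (size w) (M w). Proof. exact: mlinU. Qed.

Lemma kappa_gvec w z : kappa w (gvec z) = z@_w.
Proof.
apply: (@malg_ext _ _ K^o (fun z => kappa w (gvec z)) (fun z => z@_w)) => [||u].
- exact: linear_comp gvec_linear (kappa_linear w).
- exact: coef_linear.
rewrite gvecU kappa_cls ?corad_M // PM mcoeffU.
by case: (eqVneq u w) => [->|]; [rewrite eqxx | case: ifP].
Qed.

Lemma kappa_fin g : exists s : seq (seq V), forall w, w \notin s -> kappa w g = 0.
Proof.
have /asboolP[[N fN] fk] := valP (qrepr g).
pose s k := projT1 (cid (P_fin (val (qrepr g) k))).
exists (flatten [seq s k | k <- iota 0 N]) => w ws.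
have [Nw|wN] := leqP N (size w); first by rewrite /kappa fN // (linear_0 (PL w)).
apply: (projT2 (cid (P_fin (val (qrepr g) (size w))))); apply: contra ws => ws.
by apply/flattenP; exists (s (size w)) => //; apply: map_f; rewrite mem_iota.
Qed.

Lemma gcoef_exists g : exists z : W, forall w, z@_w = kappa w g.
Proof.
have [s sP] := kappa_fin g; exists (\sum_(u <- undup s) kappa u g *: << u >>) => w.
rewrite raddf_sum /=; under eq_bigr do rewrite mcoeffZ mcoeffU.
case ws: (w \in s); last first.
  rewrite sP ?ws // big_seq big1 // => u; rewrite mem_undup.
  by case: eqP => [->|_]; rewrite ?ws // mulr0.
rewrite (bigD1_seq w) ?undup_uniq ?mem_undup //= eqxx mulr1 big1 ?addr0 // => u uw.
by rewrite (negPf uw) mulr0.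
Qed.

Definition gcoef g : W := projT1 (cid (gcoef_exists g)).

Lemma gcoefE g w : (gcoef g)@_w = kappa w g.
Proof. exact: (projT2 (cid (gcoef_exists g))). Qed.

Lemma gcoef_linear : linear gcoef.
Proof.
move=> a g h; apply/malgP => w; rewrite mcoeffD mcoeffZ !gcoefE.
exact: kappa_linear.
Qed.

Lemma gcoefK : cancel gcoef gvec.
Proof. by move=> g; apply: kappa_ext => w; rewrite kappa_gvec gcoefE. Qed.

Lemma gvecK : cancel gvec gcoef.
Proof. by move=> z; apply/malgP => w; rewrite gcoefE kappa_gvec. Qed.

Lemma kappa_mul_M u v w :
  kappa w (cls (size u + size v) (M u ∙ M v)) = shuffle_count K u v w.
Proof.
rewrite kappa_cls; last exact: corad_mul (corad_M _) (corad_M _).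
case: eqP => [wuv|/eqP uvw]; last by rewrite shuffle_count_size // eq_sym.
rewrite (P_mul (corad_M u) (corad_M v)) ?wuv //; apply: eq_bigr => p _.
by rewrite !PM [u == _]eq_sym [v == _]eq_sym.
Qed.

Lemma shuffle_count_bilinear w :
  is_bilinear (fun z z' : W => \sum_(p <- splits w) z@_p.1 * z'@_p.2 : K^o).
Proof.
split=> y a z z'; rewrite scaler_sumr -big_split; apply: eq_bigr => p _ /=.
  exact: (mul_bilinear (@coef_linear _ _ p.1) (@coef_linear _ _ p.2)).1.
exact: (mul_bilinear (@coef_linear _ _ p.1) (@coef_linear _ _ p.2)).2.
Qed.

Lemma bilinear_kappa (b : W -> W -> G) w : is_bilinear b ->
  (forall u v, kappa w (b << u >> << v >>) = shuffle_count K u v w) ->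
  forall z z', kappa w (b z z') = \sum_(p <- splits w) z@_p.1 * z'@_p.2.
Proof.
move=> bP bE z z'; have sP := shuffle_count_bilinear w.
apply: (@malg_ext _ _ K^o (fun z => kappa w (b z z')) (fun z => \sum_(p <- splits w) z@_p.1 * z'@_p.2)) => [||u].
- exact: linear_comp (bP.1 _) (kappa_linear w).
- exact: sP.1.
apply: (@malg_ext _ _ K^o (fun z' => kappa w (b _ z')) (fun z' => \sum_(p <- splits w) _ * z'@_p.2)) => [||v].
- exact: linear_comp (bP.2 _) (kappa_linear w).
- exact: sP.2.
by rewrite bE; apply: eq_bigr => p _; rewrite !mcoeffU [u == _]eq_sym [v == _]eq_sym.
Qed.

(** The bilinear map [b], prescribed on basis vectors only, meets the description of [gr_mul] for
    all [x] and [y], as both sides have the same coordinates. *)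
Lemma gr_mulP i j x y : x \in corad H i -> y \in corad H j ->
  (cls i x : G) ∙ cls j y = cls (i + j) (x ∙ y).
Proof.
pose b (z z' : W) : G := mlin (fun u => mlin (fun v => cls (size u + size v) (M u ∙ M v) : G) z') z.
have bP : is_bilinear b.
  split=> z a u v; first exact: mlin_linear.
  rewrite /b /mlin scaler_sumr -big_split; apply: eq_bigr => t _ /=.
  by rewrite -!/(mlin _ _) mlin_linear scalerDr !scalerA mulrC.
have bE w u v : kappa w (b << u >> << v >>) = shuffle_count K u v w.
  by rewrite /b !mlinU kappa_mul_M.
have cP : is_bilinear (fun g h : G => b (gcoef g) (gcoef h)).
  exact: is_bilinear_comp bP gcoef_linear gcoef_linear.
move: i j x y.
pose Q (m : tensor G G -> G) := forall i j x y, x \in corad H i -> y \in corad H j ->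
  m ((cls i x : G) ⊗ cls j y) = cls (i + j) (x ∙ y).
suff : Q (hmul G) by move=> QG i j x y xi yj; rewrite -QG // -hmE.
rewrite /Q; have := @the_linearP _ _ _ (fun m : {linear tensor G G -> G} => Q m) _ (tliftP cP).
rewrite /Q -pureE hm.unlock -pureE; apply; rewrite pureE => i j x y xi yj.
rewrite -[LHS]/(tlft _ _) (tliftE cP) hmE; apply: kappa_ext => w.
rewrite (bilinear_kappa bP (bE w)) kappa_cls; last exact: corad_mul.
have split_size p : p \in splits w -> (size p.1 + size p.2)%N = size w.
  by case/subseq_splits => _ _ /perm_size; rewrite size_cat.
(* In length [i + j], a split into parts of other lengths than [i] and [j] has a part too long for
   [x] or for [y]. In any other length both sides vanish. *)
case: eqP => [wij|/eqP wij].
  rewrite (P_mul xi yj) ?wij //; apply: eq_big_seq => p /split_size pw.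
  rewrite !gcoefE !kappa_cls //; case: eqP => [p1|/eqP].
    by case: eqP => // p2; exfalso; apply: p2; move: pw; rewrite wij p1 => /addnI.
  rewrite mul0r neq_ltn => /orP[lt_p|gt_p]; last by move/coradP: xi => ->; rewrite ?mul0r.
  move/coradP: yj => ->; rewrite ?mulr0 //.
  by rewrite -(ltn_add2l (size p.1)) pw wij ltn_add2r.
rewrite big_seq big1 // => p /split_size pw; rewrite !gcoefE !kappa_cls //.
case: eqP => [p1|]; last by rewrite mul0r.
by case: eqP => [p2|]; [rewrite -pw p1 p2 eqxx in wij | rewrite mulr0].
Qed.

Lemma kappa_mul w g h : kappa w (g ∙ h) = \sum_(p <- splits w) kappa p.1 g * kappa p.2 h.
Proof.
have bP : is_bilinear (fun z z' : W => gvec z ∙ gvec z').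
  exact: is_bilinear_comp (hm_bilinear G) gvec_linear gvec_linear.
have bE u v : kappa w (gvec << u >> ∙ gvec << v >>) = shuffle_count K u v w.
  by rewrite !gvecU gr_mulP ?corad_M // kappa_mul_M.
rewrite -{1}[g]gcoefK -{1}[h]gcoefK (bilinear_kappa bP bE).
by apply: eq_bigr => p _; rewrite !gcoefE.
Qed.

Definition kappa2 u v : tensor G G -> K^o := tlft (fun g h => kappa u g * kappa v h : K^o).

Lemma kappa2_bilinear u v : is_bilinear (fun g h => kappa u g * kappa v h : K^o).
Proof. exact: mul_bilinear (kappa_linear _) (kappa_linear _). Qed.

Lemma kappa2_linear u v : linear (kappa2 u v).
Proof. exact: tliftP (kappa2_bilinear _ _). Qed.

Lemma kappa2_pure u v g h : kappa2 u v (g ⊗ h) = kappa u g * kappa v h.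
Proof. exact: (tliftE (kappa2_bilinear _ _)). Qed.

Lemma kappa2_coef2 u v t : kappa2 u v t = coef2 u v (tmap gcoef gcoef t).
Proof.
rewrite /coef2 (tlift_tmap gcoef_linear gcoef_linear).
  by apply: eq_tlift => g h; rewrite !gcoefE.
exact: mul_bilinear (@coef_linear _ _ u) (@coef_linear _ _ v).
Qed.

Lemma kappa2_ext s t : (forall u v, kappa2 u v s = kappa2 u v t) -> s = t.
Proof.
have can2 := tmapK gcoef_linear gvec_linear gcoef_linear gvec_linear gcoefK gcoefK.
move=> st; rewrite -[s]can2 -[t]can2; congr (tmap _ _ _).
by apply: coef2_ext => u v; rewrite -!kappa2_coef2.
Qed.

(** Deconcatenation, transported by [gvec], meets the description of [gr_comul]; so the result does
    not depend on how [hd x] is written as a sum. *)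
Lemma gr_comulP k x (s : seq (nat * nat * (H * H))) : x \in corad H k ->
    (forall p, p \in s -> [/\ (p.1.1 + p.1.2 = k)%N,
                              p.2.1 \in corad H p.1.1 & p.2.2 \in corad H p.1.2]) ->
    hd x = \sum_(p <- s) p.2.1 ⊗ p.2.2 ->
  hd (cls k x : G) = \sum_(p <- s) (cls p.1.1 p.2.1 : G) ⊗ (cls p.1.2 p.2.2 : G).
Proof.
have dL : linear (fun g : G => tmap gvec gvec (word_cuts (gcoef g))).
  exact: linear_comp (linear_comp gcoef_linear (@word_cuts_linear _ _)) (tmapP gvec_linear gvec_linear).
move: k x s.
pose Q (D : G -> tensor G G) := forall k x (s : seq (nat * nat * (H * H))), x \in corad H k ->
    (forall p, p \in s -> [/\ (p.1.1 + p.1.2 = k)%N,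
                              p.2.1 \in corad H p.1.1 & p.2.2 \in corad H p.1.2]) ->
    hd x = \sum_(p <- s) p.2.1 ⊗ p.2.2 ->
  D (cls k x) = \sum_(p <- s) (cls p.1.1 p.2.1 : G) ⊗ (cls p.1.2 p.2.2 : G).
suff QG : Q (hcomul G) by move=> k x s xk sk xs; rewrite -hdE; exact: QG.
rewrite /Q; have := @the_linearP _ _ _ (fun D : {linear G -> tensor G G} => Q D) _ dL.
rewrite /Q hd.unlock -pureE; apply; rewrite pureE => k x s xk sk xs.
rewrite -[LHS]/(tmap gvec gvec _); apply: kappa2_ext => u v.
have xs' : hd x = \sum_(p <- s) p.2.1 ⊗ p.2.2 by rewrite -hdE.
rewrite kappa2_coef2 (tmapK gvec_linear gcoef_linear gvec_linear gcoef_linear gvecK gvecK).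
rewrite coef2_word_cuts gcoefE kappa_cls // P_cat xs'.
have bP : is_bilinear (fun x1 x2 : H => P u x1 * P v x2 : K^o) by exact: mul_bilinear.
rewrite (linear_sums (tliftP bP)) (linear_sums (kappa2_linear u v)) size_cat.
transitivity (\sum_(p <- s) (if (size u + size v == k)%N then P u p.2.1 * P v p.2.2 else 0)).
  by case: eqP => _; [apply: eq_bigr => p _; rewrite (tliftE bP) | rewrite big1].
apply: eq_big_seq => p /sk[pk p1 p2].
rewrite kappa2_pure !kappa_cls //.
(* If [u] does not have length [p.1.1] while the total length is [k], then [u] or [v] is too long
   for its factor, which kills the product. *)
case: (eqVneq (size u) p.1.1) => [up|]; last rewrite neq_ltn => /orP[u_lt|u_gt].
- rewrite up -pk eqn_add2l; case: eqP => // _; by rewrite mulr0.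
- rewrite mul0r; case: eqP => // uvk; move/coradP: p2 => ->; rewrite ?mulr0 //.
  by rewrite -(ltn_add2l (size u)) uvk -pk ltn_add2r.
by rewrite mul0r; case: eqP => // _; move/coradP: p1 => ->; rewrite ?mul0r.
Qed.

Lemma kappa2_hd u v g : kappa2 u v (hd g) = kappa (u ++ v) g.
Proof.
rewrite -[g]gcoefK; move: (gcoef g) => z; move: z.
apply: (@malg_ext _ _ K^o (fun z => kappa2 u v (hd (gvec z))) (fun z => kappa (u ++ v) (gvec z))) => [||w].
- exact: linear_comp (linear_comp gvec_linear (@hd_linear _ G)) (kappa2_linear u v).
- exact: linear_comp gvec_linear (kappa_linear _).
rewrite gvecU (@gr_comulP _ _ [seq ((size q.1, size q.2), (M q.1, M q.2)) | q <- cuts w]).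
- rewrite big_map (linear_sums (kappa2_linear u v)) kappa_cls ?corad_M // PM.
  transitivity ((w == u ++ v)%:R : K^o).
    rewrite -(sum_cuts_eq K u v w); apply: eq_bigr => q _.
    rewrite kappa2_pure !kappa_cls ?corad_M // !PM.
    case: (eqVneq q.1 u) => [->|_]; last by rewrite if_same !mul0r.
    by case: (eqVneq q.2 v) => [->|_]; rewrite ?eqxx // if_same.
  by case: (eqVneq w (u ++ v)) => [->|_]; rewrite ?eqxx // if_same.
- exact: corad_M.
- by move=> p /mapP[q /cuts_cat -> ->] /=; rewrite size_cat !corad_M.
by rewrite big_map hd_M.
Qed.

Lemma kappa_h1 w : kappa w (h1 : G) = (w == [::])%:R.
Proof.
have -> : (h1 : G) = cls 0 (hone H) by rewrite h1.unlock.
rewrite h1E -M0 kappa_cls; last exact: (corad_M [::]).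
by rewrite PM eq_sym; case: w.
Qed.

Lemma gr_counitE g : he g = kappa [::] g.
Proof.
rewrite -[g]gcoefK; move: (gcoef g) => z; move: z.
apply: (@malg_ext _ _ K^o (fun z => he (gvec z)) (fun z => kappa [::] (gvec z))) => [||w].
- exact: linear_comp gvec_linear (@he_linear _ G).
- exact: linear_comp gvec_linear (kappa_linear _).
rewrite gvecU kappa_cls ?corad_M //.
pose Q (e : G -> K^o) := forall k x, x \in corad H k -> e (cls k x) = if k is 0 then he x else 0.
have : Q (hcounit G).
  rewrite /Q; have := @the_linearP _ _ _ (fun e : {linear G -> K^o} => Q e) _ (kappa_linear [::]).
  rewrite /Q he.unlock; apply => k x xk.
  by rewrite -[LHS]/(kappa _ _) kappa_cls //; case: k xk => [|k] xk //=; rewrite P0 heE.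
rewrite /Q -heE => -> //; last exact: corad_M.
by case: w => [|c w] //=; rewrite P0.
Qed.

End AssociatedGraded.

(** * The graded dual of a shuffle algebra *)

Section GradedDual.
Variables (K : fieldType) (G : hopf_data K) (deg : nat -> subspace G) (V : choiceType).
Local Notation W := (word_hopf K V).
(** [κ] and [gv] are dual bases indexed by words, and [wt] is the degree. By [κ_mul] and [κ_hd], [G]
    carries the shuffle product and deconcatenation. *)
Variables (κ : seq V -> G -> K^o) (gv : seq V -> G) (wt : seq V -> nat).
Hypothesis κL : forall w, linear (κ w).
Hypothesis κ_gv : forall u w, κ u (gv w) = (w == u)%:R.
Hypothesis gv_ext : forall φ ψ : G -> K^o, linear φ -> linear ψ ->
  (forall w, φ (gv w) = ψ (gv w)) -> φ =1 ψ.
Hypothesis κ_mul : forall w g h, κ w (g ∙ h) = \sum_(p <- splits w) κ p.1 g * κ p.2 h.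
Hypothesis κ_hd : forall u v g,
  tlft (fun g1 g2 => κ u g1 * κ v g2 : K^o) (hd g) = κ (u ++ v) g.
Hypothesis κ_h1 : forall w, κ w h1 = (w == [::])%:R.
Hypothesis κ_he : forall g, he g = κ [::] g.
Hypothesis κ_deg : forall n g w, g \in deg n -> wt w != n -> κ w g = 0.
Hypothesis gv_deg : forall w, gv w \in deg (wt w).
Hypothesis wt_fin : forall n, exists s : seq (seq V), forall w, (wt w < n)%N -> w \in s.

Local Notation D := (gdual_hopf deg).
Local Notation ev := (@gdual_fun K G deg).
Implicit Types (φ ψ : D) (g h : G) (u v w : seq V) (z : W).

Lemma ev_linear g : linear (fun φ : D => ev φ g).
Proof. by []. Qed.

Lemma gdual_ext φ ψ : (forall g, ev φ g = ev ψ g) -> φ = ψ.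
Proof. by move=> E; apply: val_inj; apply/funext. Qed.

Lemma gdual_linear φ : linear (ev φ).
Proof. by have /asboolP[] := valP (φ : gdual deg). Qed.

Lemma gdual_bound φ : exists N, forall n g, (N <= n)%N -> g \in deg n -> ev φ g = 0.
Proof. by have /asboolP[] := valP (φ : gdual deg). Qed.

Lemma coord_gdual w : κ w \in Subspace (gdual_closed deg).
Proof.
apply/asboolP; split; first exact: κL.
by exists (wt w).+1 => n g wn gn; apply: (κ_deg gn); rewrite neq_ltn wn.
Qed.

Definition dvec : W -> D := mlin (fun w => insubd (0 : gdual deg) (κ w) : D).

Lemma dvec_linear : linear dvec. Proof. exact: mlin_linear. Qed.

Lemma dvecU w g : ev (dvec << w >>) g = κ w g.
Proof. by rewrite /dvec mlinU /gdual_fun val_insubd coord_gdual. Qed.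

Lemma dvec_gv z w : ev (dvec z) (gv w) = z@_w.
Proof.
apply: (@malg_ext _ _ K^o (fun z => ev (dvec z) (gv w)) (fun z => z@_w)) => [||u].
- exact: linear_comp dvec_linear (ev_linear (gv w)).
- exact: coef_linear.
by rewrite dvecU κ_gv mcoeffU eq_sym.
Qed.

(** A functional of the graded dual vanishes in all degrees from some [N] on, and finitely many
    words have weight below [N]. *)
Lemma dcoef_exists φ : exists z, dvec z = φ.
Proof.
have [N φN] := gdual_bound φ; have [s sP] := wt_fin N.
exists (\sum_(u <- undup s) ev φ (gv u) *: (<< u >> : W)); apply: gdual_ext => g.
move: g; apply: gv_ext; [exact: gdual_linear | exact: gdual_linear | move=> w].
rewrite dvec_gv raddf_sum /=; under eq_bigr do rewrite mcoeffZ mcoeffU.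
case ws: (w \in s).
  rewrite (bigD1_seq w) ?undup_uniq ?mem_undup //= eqxx mulr1 big1 ?addr0 // => u uw.
  by rewrite (negPf uw) mulr0.
rewrite (φN (wt w)) ?gv_deg //; last by rewrite leqNgt; apply: contraFN ws; exact: sP.
rewrite big_seq big1 // => u; rewrite mem_undup.
by case: eqP => [->|_]; rewrite ?ws // mulr0.
Qed.

Definition dcoef φ : W := projT1 (cid (dcoef_exists φ)).

Lemma dcoefK : cancel dcoef dvec.
Proof. by move=> φ; exact: (projT2 (cid (dcoef_exists φ))). Qed.

Lemma dcoefE φ w : (dcoef φ)@_w = ev φ (gv w).
Proof. by rewrite -[φ in RHS]dcoefK dvec_gv. Qed.

Lemma dvecK : cancel dvec dcoef.
Proof. by move=> z; apply/malgP => w; rewrite dcoefE dvec_gv. Qed.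

Lemma dcoef_linear : linear dcoef.
Proof. by move=> a φ ψ; apply/malgP => w; rewrite mcoeffD mcoeffZ !dcoefE. Qed.

(** Concatenation is dual to deconcatenation, so the product of words, transported by [dvec], meets
    the description of [gdual_mul]. *)
Lemma gdual_mulP φ ψ g : ev (φ ∙ ψ) g = tlft (fun g1 g2 => ev φ g1 * ev ψ g2 : K^o) (hd g).
Proof.
move: φ ψ g; have cP : is_bilinear (fun φ ψ : D => dvec (dcoef φ ∙ dcoef ψ)).
  apply: is_bilinear_post dvec_linear.
  exact: is_bilinear_comp (hm_bilinear W) dcoef_linear dcoef_linear.
have cEU g u z' : ev (dvec ((<< u >> : W) ∙ z')) g =
    tlft (fun g1 g2 => κ u g1 * ev (dvec z') g2 : K^o) (hd g).
  apply: (@malg_ext _ _ K^o (fun z' => ev (dvec ((<< u >> : W) ∙ z')) g)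
    (fun z' => tlft (fun g1 g2 => κ u g1 * ev (dvec z') g2 : K^o) (hd g))) => [||v].
  - exact: linear_comp (linear_comp (@hml_linear _ W _) dvec_linear) (ev_linear g).
  - move=> a x y; rewrite -[RHS]tlift_linb; apply: eq_tlift => g1 g2.
    by rewrite dvec_linear ev_linear mulrDr scalerAr.
  rewrite word_hm dvecU -κ_hd; apply: eq_tlift => g1 g2.
  by rewrite !dvecU.
have cE g z z' : ev (dvec (z ∙ z')) g =
    tlft (fun g1 g2 => ev (dvec z) g1 * ev (dvec z') g2 : K^o) (hd g).
  apply: (@malg_ext _ _ K^o (fun z => ev (dvec (z ∙ z')) g)
    (fun z => tlft (fun g1 g2 => ev (dvec z) g1 * ev (dvec z') g2 : K^o) (hd g))) => [||u].
  - exact: linear_comp (linear_comp (@hmr_linear _ W z') dvec_linear) (ev_linear g).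
  - move=> a x y; rewrite -[RHS]tlift_linb; apply: eq_tlift => g1 g2.
    by rewrite dvec_linear ev_linear mulrDl scalerAl.
  by rewrite cEU; apply: eq_tlift => g1 g2; rewrite dvecU.
pose Q (m : tensor D D -> D) := forall φ ψ g,
  ev (m (φ ⊗ ψ)) g = tlft (fun g1 g2 => ev φ g1 * ev ψ g2 : K^o) (hd g).
suff QD : Q (hmul D) by move=> φ ψ g; rewrite -QD -hmE.
have [m mL mE] : exists2 m : tensor D D -> D, linear m &
    forall φ ψ, m (φ ⊗ ψ) = dvec (dcoef φ ∙ dcoef ψ).
  by exists (tlft (fun φ ψ : D => dvec (dcoef φ ∙ dcoef ψ)));
    [exact: tliftP cP | exact: tliftE cP].
rewrite /Q; have := @the_linearP _ _ _ (fun m : {linear tensor D D -> D} => Q m) _ mL.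
rewrite /Q hd.unlock -pureE -tliftE0; apply; rewrite pureE tliftE0 => φ ψ g.
by rewrite -[X in ev X g]/(m _) mE cE hdE !dcoefK.
Qed.

Definition ev2 g h : tensor D D -> K^o := tlft (fun φ ψ : D => ev φ g * ev ψ h : K^o).

Lemma ev2_bilinear g h : is_bilinear (fun φ ψ : D => ev φ g * ev ψ h : K^o).
Proof. exact: mul_bilinear (ev_linear g) (ev_linear h). Qed.

Lemma ev2_linear g h : linear (ev2 g h).
Proof. exact: tliftP (ev2_bilinear g h). Qed.

Lemma ev2_pure g h φ ψ : ev2 g h (φ ⊗ ψ) = ev φ g * ev ψ h.
Proof. exact: (tliftE (ev2_bilinear g h)). Qed.

Lemma ev2_ext s t : (forall g h, ev2 g h s = ev2 g h t) -> s = t.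
Proof.
have can2 := tmapK dcoef_linear dvec_linear dcoef_linear dvec_linear dcoefK dcoefK.
move=> st; rewrite -[s]can2 -[t]can2; congr (tmap _ _ _); apply: coef2_ext => u v.
have E r : coef2 u v (tmap dcoef dcoef r) = ev2 (gv u) (gv v) r.
  rewrite /coef2 (tlift_tmap dcoef_linear dcoef_linear).
    by apply: eq_tlift => φ ψ; rewrite !dcoefE.
  exact: mul_bilinear (@coef_linear _ _ u) (@coef_linear _ _ v).
by rewrite !E.
Qed.

Lemma ev2_dvec g h z : ev2 g h (tmap dvec dvec (hd z)) = ev (dvec z) (g ∙ h).
Proof.
apply: (@malg_ext _ _ K^o (fun z => ev2 g h (tmap dvec dvec (hd (z : W))))
  (fun z => ev (dvec z) (g ∙ h))) => [||w].
- exact: linear_comp (linear_comp (@hd_linear _ W) (tmapP dvec_linear dvec_linear)) (ev2_linear g h).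
- exact: linear_comp dvec_linear (ev_linear _).
rewrite word_hd (linear_sums (tmapP dvec_linear dvec_linear)).
rewrite (linear_sums (ev2_linear g h)) dvecU κ_mul; apply: eq_bigr => p _.
by rewrite (tmap_pure dvec_linear dvec_linear) ev2_pure !dvecU.
Qed.

(** Unshuffling is dual to the shuffle product; [ev2_dvec] is that pairing, and provides the map
    required by the description. *)
Lemma gdual_comulP φ g h : ev2 g h (hd φ) = ev φ (g ∙ h).
Proof.
have [m mL mE] : exists2 m : D -> tensor D D, linear m &
    forall φ, m φ = tmap dvec dvec (hd (dcoef φ)).
  exists (fun φ => tmap dvec dvec (hd (dcoef φ))) => //.
  exact: linear_comp (linear_comp dcoef_linear (@hd_linear _ W)) (tmapP dvec_linear dvec_linear).
move: φ g h; pose Q (m : D -> tensor D D) := forall φ g h, ev2 g h (m φ) = ev φ (g ∙ h).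
suff QD : Q (hcomul D) by move=> φ g h; rewrite -QD -hdE.
rewrite /Q; have := @the_linearP _ _ _ (fun m : {linear D -> tensor D D} => Q m) _ mL.
rewrite /Q hm.unlock /ev2 -pureE -tliftE0; apply; rewrite pureE tliftE0 => φ g h.
by rewrite -/(ev2 g h _) -[X in ev2 g h X]/(m _) mE ev2_dvec dcoefK hmE.
Qed.

Lemma dvec_morphism : bialg_morphism dvec.
Proof.
have dL := dvec_linear; apply: free_bialg_morphism => // [u v||w|w].
- rewrite [in LHS]word_hm; apply: gdual_ext => g; rewrite gdual_mulP dvecU -κ_hd.
  by apply: eq_tlift => g1 g2; rewrite !dvecU.
- rewrite [in LHS]word_h1; apply: gdual_ext => g; rewrite dvecU.
  have -> : (h1 : D) = insubd (0 : gdual deg) (hcounit G : G -> K^o) by rewrite h1.unlock.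
  have E : (hcounit G : G -> K^o) = κ [::] by apply/funext => x; rewrite heE κ_he.
  by rewrite E /gdual_fun val_insubd coord_gdual.
- by apply: ev2_ext => g h; rewrite gdual_comulP ev2_dvec.
rewrite [RHS]word_he.
have -> : he (dvec << w >>) = ev (dvec << w >>) (hone G) by rewrite he.unlock.
by rewrite dvecU h1E κ_h1.
Qed.

Lemma word_gdual_iso : bialg_iso W D.
Proof.
by exists dvec; [exists dcoef; [exact: dvecK | exact: dcoefK] | exact: dvec_morphism].
Qed.

End GradedDual.

Section CofreeDual.
Variables (K : fieldType) (H : hopf_data K) (V : choiceType).
Local Notation W := {malg K[seq V]}.
Variables (L : H -> W) (Li : W -> H).
Hypotheses (LL : linear L) (LK : cancel L Li) (LiK : cancel Li L).
Hypothesis L1 : L h1 = << [::] >>.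
Hypothesis Lhd : forall x, tmap L L (hd x) = word_cuts (L x).
Hypothesis Lhe : forall x, (L x)@_[::] = he x.
Hypotheses (m1l : forall x : H, h1 ∙ x = x) (m1r : forall x : H, x ∙ h1 = x).
Hypothesis hdM : forall x y : H, hd (x ∙ y) =
  tlft (fun x1 x2 => tlft (fun y1 y2 => (x1 ∙ y1) ⊗ (x2 ∙ y2)) (hd y)) (hd x).
Variables (deg : nat -> subspace H) (wt : seq V -> nat).
Hypothesis L_deg : forall n x w, x \in deg n -> wt w != n -> (L x)@_w = 0.
Hypothesis Li_deg : forall w, Li << w >> \in deg (wt w).
Hypothesis wt_fin : forall n, exists s : seq (seq V), forall w, (wt w < n)%N -> w \in s.

(** Whatever the lower terms of the product of [H], its associated graded algebra has the shuffle
    product and deconcatenation, so the graded dual is T(V). *)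
Lemma cofree_gdual_iso : bialg_iso (word_hopf K V) (gdual_hopf (gr_deg deg)).
Proof.
have PL := wcoef_linear LL; have PM := @wcoef_wvec _ _ _ L Li LiK.
have P_ext := @wcoef_ext _ _ _ L Li LK.
have coP := coradP LL LK LiK L1 Lhd.
have P_fin x : exists s : seq (seq V), forall w, w \notin s -> wcoef L w x = 0.
  by exists (msupp (L x)) => w; exact: mcoeff_outdom.
have P_mul i j x y w : x \in corad H i -> y \in corad H j -> (i + j <= size w)%N ->
    wcoef L w (x ∙ y) = \sum_(p <- splits w) wcoef L p.1 x * wcoef L p.2 y.
  by move=> /coP xi /coP yj; exact: (wcoef_mul LL LK LiK L1 Lhd m1l m1r hdM xi yj).
have co_mul i j x y : x \in corad H i -> y \in corad H j -> x ∙ y \in corad H (i + j).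
  by move=> /coP xi /coP yj; apply/coP; exact: (length_le_mul LL LK LiK L1 Lhd m1l m1r hdM xi yj).
have hd_M := hd_wvec LL LK LiK Lhd.
have P_cat := wcoef_cat LL Lhd.
have M0 := wvec0 LK L1.
have coM := corad_M PM coP.
apply: (@word_gdual_iso _ _ _ _ (kappa (wcoef L))
  (fun w => gr_cls (corad H) (size w) (wvec Li w) : gr_hopf H) wt).
- exact: (kappa_linear PL coP).
- move=> u w; rewrite (kappa_cls PL coP) // PM.
  by case: (eqVneq w u) => [->|]; [rewrite eqxx | case: ifP].
- move=> φ ψ φL ψL φψ g; rewrite -(gcoefK PL PM P_ext P_fin coP g).
  move: (gcoef _ _ g); have gL := gvec_linear (wvec Li).
  apply: malg_ext; [exact: linear_comp gL φL | exact: linear_comp gL ψL | move=> w].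
  by rewrite gvecU.
- exact: (kappa_mul PL PM P_ext P_fin coP P_mul co_mul).
- by move=> u v g; apply: (kappa2_hd PL PM P_ext P_fin coP hd_M P_cat).
- exact: (kappa_h1 PL PM coP M0).
- by move=> g; apply: (gr_counitE PL PM P_ext P_fin coP) => x; exact: Lhe.
- move=> n g w gn wn; apply: (span_kernel (kappa_linear PL coP w)) gn => _ [k [x [xk xn ->]]].
  by rewrite (kappa_cls PL coP) //; case: eqP => // _; exact: L_deg wn.
- by move=> w; apply: mem_span; exists (size w), (wvec Li w); split; [exact: coM | exact: Li_deg | by []].
exact: wt_fin.
Qed.

End CofreeDual.

(** * The Aguiar-Sottile algebra *)

Section AguiarSottile.
Variable K : fieldType.
Local Notation MR := (malvenuto_reutenauer K).
Local Notation letter := (letter pshift p0).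
Local Notation W := {malg K[seq letter]}.
Local Notation mr_theta := (theta pshift p0 psize mr_cut).
Implicit Types (a b : perm_word) (u v : seq nat).

Lemma mr_hm a b : (<< a >> : MR) ∙ << b >> =
  \sum_(w <- shuffles (val a) (up (psize a) (val b))) (<< pst w >> : MR).
Proof.
rewrite free_hm /shuffle_prod; apply: eq_big_seq => w /shuffles_perm wab.
have wP : is_perm_word w.
  by rewrite /is_perm_word (perm_size wab) (perm_trans wab) //; exact: perm_word_shift.
by rewrite perm_vecE // /pst st_id.
Qed.

Lemma mr_hm_pst u v : uniq (u ++ v) -> {in u & v, forall x y, (x < y)%N} ->
  (<< pst u >> : MR) ∙ << pst v >> = \sum_(w <- shuffles u v) (<< pst w >> : MR).
Proof.
move=> uuv uv; have := uuv; rewrite cat_uniq => /and3P[uu _ uv'].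
rewrite mr_hm /psize !val_pst // size_st -st_shuffles // big_map.
by apply: eq_bigr => w _; rewrite /pst st_st.
Qed.

Lemma mr_hd a : hd (<< a >> : MR) =
  \sum_(q <- cuts (val a)) (<< pst q.1 >> : MR) ⊗ (<< pst q.2 >> : MR).
Proof.
rewrite free_hd /deconcat pureE.
rewrite (sum_cuts_take (val a) (fun u v => (perm_vec K (st u) : MR) ⊗ (perm_vec K (st v) : MR))).
apply: eq_big_seq => q /cuts_cat aq.
have := perm_uniqP a; rewrite aq cat_uniq => /and3P[u1 _ u2].
by rewrite !perm_vecE // st_perm_word.
Qed.

Lemma mr_h1 : h1 = (<< p0 >> : MR).
Proof. by rewrite free_h1 perm_vecE // -[in RHS](val_pw p0). Qed.

Lemma mr_mul1 (x : MR) : h1 ∙ x = x.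
Proof.
rewrite mr_h1; apply: (@free_ext K _ _ _ _ _ MR (fun x : MR => (<< p0 >> : MR) ∙ x) id) => [||a].
- exact: hml_linear.
- by [].
rewrite mr_hm shuffles0 big_seq1 /psize /= /up (eq_map addn0) map_id.
by rewrite pst_val.
Qed.

Lemma mr_mulr1 (x : MR) : x ∙ h1 = x.
Proof.
rewrite mr_h1; apply: (@free_ext K _ _ _ _ _ MR (fun x : MR => x ∙ (<< p0 >> : MR)) id) => [||a].
- exact: hmr_linear.
- by [].
by rewrite mr_hm shuffles0r big_seq1 pst_val.
Qed.

Lemma mr_hdM (x y : MR) : hd (x ∙ y) =
  tlft (fun x1 x2 => tlft (fun y1 y2 => (x1 ∙ y1) ⊗ (x2 ∙ y2)) (hd y)) (hd x).
Proof.
have hdL := @hd_linear _ MR; have hmR := @hmr_linear _ MR; have hmL := @hml_linear _ MR.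
move: x; apply: free_ext => [||a].
- exact: linear_comp (hmR _) hdL.
- exact: linear_comp hdL (tliftP (comulM_bilinear _)).
move: y; apply: free_ext => [||b].
- exact: linear_comp (hmL _) hdL.
- move=> c y z; rewrite -tlift_linb; apply: eq_tlift => x1 x2.
  by rewrite hdL (tliftP (comulM_bilinearr _ _)).
pose n := psize a; have uab : uniq (val a ++ up n (val b)) := perm_uniqP (pshift a b).
rewrite mr_hm (linear_sums hdL).
transitivity (\sum_(w <- shuffles (val a) (up n (val b))) \sum_(q <- cuts w)
    (<< pst q.1 >> : MR) ⊗ (<< pst q.2 >> : MR)).
  apply: eq_big_seq => w /shuffles_perm/perm_uniq; rewrite uab => uw.
  rewrite mr_hd; have := congr1 (fun r => \sum_(q <- r) (<< q.1 >> : MR) ⊗ (<< q.2 >> : MR)) (mr_full_pst uw).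
  by rewrite /mr_full !big_map.
rewrite (sum_shuffles_cuts _ _ (fun w w' => (<< pst w >> : MR) ⊗ (<< pst w' >> : MR))).
rewrite (mr_hd a) [RHS](linear_sums (tliftP (comulM_bilinear _))).
apply: eq_big_seq => p ap.
have {}ap : val a = p.1 ++ p.2 := cuts_cat ap.
rewrite (tliftE (comulM_bilinear _)) (mr_hd b) [RHS](linear_sums (tliftP (comulM_bilinearr _ _))).
rewrite cuts_map big_map; apply: eq_big_seq => q bq.
have {}bq : val b = q.1 ++ q.2 := cuts_cat bq.
rewrite (tliftE (comulM_bilinearr _ _)) -/(up n q.1) -/(up n q.2).
have part r s : {subset r <= val a} -> {subset s <= val b} -> uniq r -> uniq s ->
    (<< pst r >> : MR) ∙ << pst s >> = \sum_(w <- shuffles r (up n s)) (<< pst w >> : MR).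
  move=> ra sb ur us; rewrite -(pst_up n s); have lt_rs : {in r & up n s, forall x y, (x < y)%N}.
    by move=> x _ /ra xa /mapP[z /sb zb ->]; apply: shift_lt xa _; apply: map_f zb.
  apply: mr_hm_pst => //; rewrite cat_uniq ur map_inj_uniq ?us; last exact: addIn.
  by rewrite andbT; apply/hasPn => x xs; apply/negP => xr; have := lt_rs _ _ xr xs; rewrite ltnn.
have /and3P[p1 _ p2] : [&& uniq p.1, ~~ has [in p.1] p.2 & uniq p.2].
  by rewrite -cat_uniq -ap perm_uniqP.
have /and3P[q1 _ q2] : [&& uniq q.1, ~~ has [in q.1] q.2 & uniq q.2].
  by rewrite -cat_uniq -bq perm_uniqP.
rewrite !part // ?ap ?bq; try by move=> x xr; rewrite mem_cat xr ?orbT.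
rewrite (linear_sums (pure_linearl _)); apply: eq_bigr => w _.
by rewrite (linear_sums (pure_linearr _)).
Qed.

Definition mr_words : MR -> W := mlin (fun a => \sum_(w <- mr_theta a) << w >>).

Lemma mr_words_linear : linear mr_words. Proof. exact: mlin_linear. Qed.

Lemma mr_wordsU a : mr_words << a >> = \sum_(w <- mr_theta a) << w >>.
Proof. exact: mlinU. Qed.

Let psize0 : psize p0 = 0%N. Proof. by []. Qed.

Lemma mr_words_bijective : bijective mr_words.
Proof.
exact: (theta_bijective pshift0 pshift0r pshiftA psizeM psize0 psize_eq0
  mr_cut_size mr_cut_neq0 mr_cut_full mr_cut_op).
Qed.

Lemma mr_words1 : mr_words h1 = << [::] >>.
Proof. by rewrite mr_h1 mr_wordsU (theta1 _ _ psize0) big_seq1. Qed.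

Lemma mr_words_hd x : tmap mr_words mr_words (hd x) = word_cuts (mr_words x).
Proof.
have wL := mr_words_linear; move: x; apply: free_ext => [||a].
- exact: linear_comp (@hd_linear _ MR) (tmapP wL wL).
- exact: linear_comp wL (@word_cuts_linear _ _).
rewrite mr_hd (linear_sums (tmapP wL wL)) mr_wordsU.
rewrite (linear_sums (@word_cuts_linear _ _)).
under [RHS]eq_bigr do rewrite word_cutsU.
rewrite (sum_theta_cuts psize0 psize_eq0 mr_cut_size mr_cut_neq0 mr_full0 mr_cut_assoc
  (fun s t : seq letter => (<< s >> : W) ⊗ (<< t >> : W)) a mr_fullE) big_map.
apply: eq_bigr => q _; rewrite tmap_pure // !mr_wordsU.
rewrite (linear_sums (pure_linearl _)); apply: eq_bigr => w _.
by rewrite (linear_sums (pure_linearr _)).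
Qed.

Lemma mr_words_he x : (mr_words x)@_[::] = he x.
Proof.
apply: (@malg_ext _ _ K^o (fun x => (mr_words x)@_[::]) (fun x => he (x : MR))) => [||a].
- exact: linear_comp mr_words_linear (@coef_linear _ _ [::]).
- exact: (@he_linear _ MR).
rewrite mr_wordsU free_he /deg0 raddf_sum /=.
case: (eqVneq a p0) => [->|a0]; first by rewrite (theta1 _ _ psize0) big_seq1 mcoeffU.
rewrite (negPf (a0 : val a != [::])) big_seq big1 // => w wa; rewrite mcoeffU.
case: eqP wa => // ->.
by rewrite (negPf (theta_nil _ psize_eq0 mr_cut_size mr_cut_neq0 a0)).
Qed.

Local Notation wt := (@weight _ pshift p0 psize).

Lemma mr_words_deg n x w : x \in mr_deg K n -> wt w != n -> (mr_words x)@_w = 0.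
Proof.
move=> xn wn; apply: (span_kernel (linear_comp mr_words_linear (@coef_linear _ _ w))) xn.
move=> _ [p pn ->] /=; rewrite mr_wordsU raddf_sum /= big_seq big1 // => u up.
rewrite mcoeffU; case: eqP up => // -> up.
by rewrite (weight_theta psize0 psize_eq0 mr_cut_size mr_cut_neq0 up) /psize pn eqxx in wn.
Qed.

(** Let [z] be the part of [x] outside degree [n]. Its image vanishes at words of weight [n] by
    degree, and at the others because those of [x] and [y] do; injectivity gives [z = 0]. *)
Lemma mr_deg_words x n : (forall w, wt w != n -> (mr_words x)@_w = 0) -> x \in mr_deg K n.
Proof.
move=> xn; rewrite [x]malg_sumU (bigID (fun a => psize a == n)) /=.
set y := (X in X + _); set z := (X in _ + X).
have yn : y \in mr_deg K n.
  by apply: rpred_sum => a /eqP an; apply: rpredZ; apply: mem_span; exists a.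
have xyz : x = y + z by rewrite [LHS]malg_sumU (bigID (fun a => psize a == n)).
suff -> : z = 0 by rewrite addr0.
apply: (bij_inj mr_words_bijective); rewrite (linear_0 mr_words_linear).
apply/malgP => w; rewrite mcoeff0; case: (eqVneq (wt w) n) => [wn|wn]; last first.
  have := xn w wn; rewrite xyz (linear_D mr_words_linear) mcoeffD.
  by rewrite (mr_words_deg yn wn) add0r.
rewrite /z (linear_sums mr_words_linear) raddf_sum /= big1 // => a an.
rewrite (linear_Z mr_words_linear) mcoeffZ (@mr_words_deg (psize a)) ?mulr0 ?wn 1?eq_sym //.
by apply: mem_span; exists a.
Qed.

(** A word occurs in [theta] of the product of its letters, a permutation whose size is the weight
    of the word. There are finitely many such permutations, and each gives a finite list. *)
Lemma mr_weight_fin n : exists s : seq (seq letter), forall w, (wt w < n)%N -> w \in s.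
Proof.
exists (flatten [seq flatten [seq mr_theta (pw u) | u <- seqs m (iota 1 m)] | m <- iota 0 n]).
move=> w wn; pose a := letters_prod w; have aw : psize a = wt w.
  exact: (sz_letters_prod psizeM psize0).
apply/flattenP; exists (flatten [seq mr_theta (pw u) | u <- seqs (psize a) (iota 1 (psize a))]).
  by apply: map_f; rewrite mem_iota aw.
apply/flattenP; exists (mr_theta a).
  rewrite -[in X in X \in _](val_pw a); apply/mapP; exists (val a) => //.
  by rewrite mem_seqs eqxx; apply/allP => x; rewrite mem_perm_word mem_iota add1n ltnS.
exact: (letters_prod_theta pshift0 psizeM psize0 psize_eq0 mr_cut_size mr_cut_neq0
  mr_cut_full mr_cut_op).
Qed.

Lemma word_aguiar_sottile_iso : bialg_iso (word_hopf K letter) (aguiar_sottile K).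
Proof.
have [g [fK gK]] := bijective_linear_inv (f := linear_of mr_words_linear) mr_words_bijective.
apply: (cofree_gdual_iso mr_words_linear fK gK mr_words1 mr_words_hd mr_words_he
  mr_mul1 mr_mulr1 mr_hdM mr_words_deg _ mr_weight_fin) => w.
apply: mr_deg_words => u uw; rewrite [mr_words _](gK) mcoeffU.
by case: (eqVneq w u) uw => // ->; rewrite eqxx.
Qed.

End AguiarSottile.

Theorem corollary6p5 (K : fieldType) (charK0 : [pchar K]%R =i pred0) :
  hopf_isomorphic (KS K) (aguiar_sottile K)
  /\ hopf_isomorphic (KS K) (grossman_larson K).
Proof.
split; last exact: KS_grossman_larson.
apply: hopf_isomorphic_of; first exact: is_hopf_algebra_iso (word_KS_iso K) (word_hopfP _ _).
exact: bialg_iso_trans (bialg_iso_sym (word_KS_iso K)) (word_aguiar_sottile_iso K).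
Qed.
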